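(* For all but finitely many $\gamma\in\mathbb{Q}$, the set $S_\gamma^{(3)}$ is infinite.
   Context: For $\gamma,c\in\mathbb{Q}$ let $f_{\gamma,c}(x)=(x-\gamma)^2+c$, with $n$-fold iterate $f_{\gamma,c}^n$, and let $\operatorname{Gal}(f_{\gamma,c}^n)$ be the Galois group over $\mathbb{Q}$ of its splitting field. $\operatorname{Gal}(f_{\gamma,c}^n)$ is called maximal if its order is $2^{2^n-1}$ (the order of the automorphism group of the complete rooted binary tree of depth $n$). $S_\gamma^{(3)}$ is the set of $c\in\mathbb{Q}$ such that $\operatorname{Gal}(f_{\gamma,c}^2)$ is maximal but $\operatorname{Gal}(f_{\gamma,c}^3)$ is not. *)

(* Defs.v *)
From HB Require Import structures.
From mathcomp Require Import all_boot all_order all_algebra all_fingroup all_solvable all_field.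
Set Implicit Arguments. Unset Strict Implicit. Unset Printing Implicit Defensive.
Import GRing.Theory Num.Theory.
Local Open Scope ring_scope.

Definition fgc (gamma c : rat) : {poly rat} := ('X - gamma%:P) ^+ 2 + c%:P.

Definition fiter (gamma c : rat) (n : nat) : {poly rat} :=
  iter n (fun q => fgc gamma c \Po q) 'X.

(* Gal(p) over Q has order m: some splitting field E of p over Q
   (inside a splitting-field extension L of Q) has |Gal(E/Q)| = m.
   Splitting fields are unique up to isomorphism, so "some" = "every". *)
Definition galOrderIs (p : {poly rat}) (m : nat) : Prop :=
  exists (L : splittingFieldType rat) (E : {subfield L}),
    splittingFieldFor 1%VS (map_poly (in_alg L) p) E /\
    #|('Gal(E / 1%AS))%g| = m.

Definition galMaximal (gamma c : rat) (n : nat) : Prop :=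
  galOrderIs (fiter gamma c n) (2 ^ (2 ^ n - 1))%N.

Definition inS3 (gamma c : rat) : Prop :=
  galMaximal gamma c 2 /\ ~ galMaximal gamma c 3.

(* Main.v *)
Require Import Defs.
From HB Require Import structures.
From mathcomp Require Import all_boot all_order all_algebra all_fingroup all_solvable all_field.
From mathcomp Require Import ring lra zify.
Set Implicit Arguments. Unset Strict Implicit. Unset Printing Implicit Defensive.
Import Order.TTheory GRing.Theory Num.Theory.
Local Open Scope ring_scope.

(* Fix gamma.  If -c, phi = (c - gamma)^2 + c and -c phi are nonsquares, then Gal(f^2) is maximal,
   and Gal(f^3) is not as soon as (phi - gamma)^2 + c = y^2 with y != 0.  The latter equation in
   (c, y) defines a genus one curve with a point P of infinite order: with g = 4 gamma (1 - gamma)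
   and d = 2 gamma - 1, the points k P give c_k = - e_k e_(k-1) / 4 and
   phi_k = gamma - (e_k + e_(k-1)) / 4, where consecutive terms of e satisfy a symmetric
   biquadratic relation.  That P has infinite order is read off the 2-adic absolute values of
   the e_k.

   Nonsquareness of a nonzero rational is an open condition at some prime, and suitable multiples
   of P are p-adically as small as one likes, so a single k at which -c_k, phi_k and -c_k phi_k are
   nonsquares yields infinitely many.

   If an odd prime p divides the numerator of gamma, such a k is found with 2 k - 1 = 3 p^i j: the
   p-adic expansion of phi_k shows that it is a nonsquare for j in a suitable class modulo p, and
   for 2 k - 1 in a suitable class modulo 32 the 2-adic valuation of c_k is odd and that of phi_k
   is even.  Otherwise the numerator of gamma = a / b is a power of 2 up to sign, and k = 3 or
   k = 4 works for all but finitely many gamma: up to squares phi_3 and phi_4 are values of binary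
   forms M3(a, b), M4(a, b) which differ from A3^2, A4^2 by multiples of high powers of a, as
   M3 M4 does from B^2, and the congruences for their square roots contradict their sizes.  If
   -c_k or -c_k phi_k is a square, then a, b and b - a are squares up to sign, and
   gamma = 4 q / (q + 1)^2, where k = 3 works. *)

(** * Galois groups of iterates *)

(** The condition on c is about the critical orbit gamma, c, phi, f(phi). Over a fixed root of f,
    the square roots adjoined at the third level come in pairs, and the four representatives have a
    product whose square is f^3(gamma). If f^3(gamma) = y^2 with y rational and nonzero, one of the
    seven quadratic steps is lost. Since (phi - gamma)^2 - y^2 = -c, put phi - gamma - y = -x/2 and
    phi - gamma + y = -z/2. Then c = -xz/4 and phi = gamma - (x + z)/4, and phi = (c - gamma)^2 + c
    becomes a relation symmetric and quadratic in x and z. Passing to the other solution in one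
    variable and exchanging the two composes two involutions of the curve, which is a translation:
    this is the chain e. Infinite order only supplies candidates. The obstacle is to find, for
    almost every gamma, one multiple with three nonsquares. Where no odd prime controls the
    expansion of phi, size at the real place is played against divisibility by powers of a. Limits
    are avoided: pigeonhole on residues replaces compactness. As division by zero is silent, the
    identities for e are proved up to a bound K below which an auxiliary sequence does not
    vanish. *)

Section QuadraticAdjunction.
Variables (F : fieldType) (L : fieldExtType F).
Implicit Types (K : {subfield L}) (x y : L).

Lemma adjoin_degree_sqr K x : x ^+ 2 \in K -> (adjoin_degree K x <= 2)%N.
Proof.
move=> Kx2; rewrite -ltnS -size_minPoly.
have sz: size ('X^2 - (x ^+ 2)%:P) = 3%N by rewrite size_XnsubC.
rewrite -sz; apply: dvdp_leq; first by rewrite -size_poly_eq0 sz.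
apply: minPoly_dvdp; first by rewrite rpredB ?rpredX ?polyOverX ?polyOverC.
by rewrite rootE !hornerE subrr.
Qed.

Lemma dim_Fadjoin_sqr_le K x :
  x ^+ 2 \in K -> (\dim <<K; x>> <= 2 * \dim K)%N.
Proof. by move=> Kx2; rewrite dim_Fadjoin leq_mul2r adjoin_degree_sqr ?orbT. Qed.

Lemma dim_Fadjoin_sqr K x :
  x ^+ 2 \in K -> x \notin K -> (\dim <<K; x>> = 2 * \dim K)%N.
Proof.
move=> Kx2 K'x; rewrite dim_Fadjoin; congr (_ * _)%N; apply/eqP.
rewrite eqn_leq adjoin_degree_sqr //= ltn_neqAle eq_sym.
by rewrite adjoin_deg_eq1 K'x.
Qed.

Lemma Fadjoin_sqrP K x y : x ^+ 2 \in K -> y \in <<K; x>>%VS ->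
  exists u v, [/\ u \in K, v \in K & y = u + v * x].
Proof.
move=> Kx2 Ky; have Ep := Fadjoin_poly_eq Ky.
have Kp := Fadjoin_polyOver K x y.
have sp : (size (Fadjoin_poly K x y) <= 2)%N.
  exact: leq_trans (size_Fadjoin_poly _ _ _) (adjoin_degree_sqr Kx2).
exists (Fadjoin_poly K x y)`_0, (Fadjoin_poly K x y)`_1.
split; [exact: (polyOverP Kp) | exact: (polyOverP Kp) |].
by rewrite -{1}Ep (horner_coef_wide _ sp) !big_ord_recl big_ord0 /= expr0 expr1 mulr1 addr0.
Qed.

End QuadraticAdjunction.

Lemma splitting_card_gal (L : splittingFieldType rat) (E : {subfield L}) (p : {poly rat}) :
  splittingFieldFor 1%VS (map_poly (in_alg L) p) E -> #|('Gal(E / 1%AS))%g| = \dim E.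
Proof.
move=> spE; rewrite -galois_dim ?dimv1 ?divn1 //.
apply/and3P; split; first exact: sub1v.
  apply/separableP => y _; apply: pcharf0_separable => q.
  by rewrite (fmorph_pchar (in_alg L)) pchar_num.
apply/(splitting_normalField (sub1v _)).
by exists (map_poly (in_alg L) p) => //; apply: alg_polyOver.
Qed.

Section Iterates.
Variables (gamma c : rat).

Section OverExtension.
Variable L : fieldExtType rat.
Local Notation "a %:L" := (in_alg L a) (at level 2, format "a %:L").

Definition fgcL : {poly L} := ('X - (gamma%:L)%:P) ^+ 2 + (c%:L)%:P.

Lemma map_fgc : map_poly (in_alg L) (fgc gamma c) = fgcL.
Proof. by rewrite rmorphD rmorphXn rmorphB /= map_polyX !map_polyC. Qed.

Lemma map_fiter2 : map_poly (in_alg L) (fiter gamma c 2) = fgcL \Po fgcL.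
Proof. by rewrite /fiter /= comp_polyXr map_comp_poly map_fgc. Qed.

Lemma map_fiter3 : map_poly (in_alg L) (fiter gamma c 3) = fgcL \Po (fgcL \Po fgcL).
Proof. by rewrite /fiter /= comp_polyXr !map_comp_poly map_fgc. Qed.

Lemma comp_fgcL (p : {poly L}) :
  fgcL \Po p = (p - (gamma%:L)%:P) ^+ 2 + (c%:L)%:P.
Proof. by rewrite /fgcL comp_polyD comp_polyC rmorphXn /= comp_polyB comp_polyX comp_polyC. Qed.

End OverExtension.
End Iterates.

Lemma root_of_prod_XsubC_factor (F : fieldType) (p q : {poly F}) (rs : seq F) :
  p %= \prod_(z <- rs) ('X - z%:P) -> q %| p -> (1 < size q)%N ->
  exists2 r, r \in rs & root q r.
Proof.
move=> Ep qp sq; have : q %| \prod_(z <- rs) ('X - z%:P) by rewrite -(eqp_dvdr _ Ep).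
case/dvdp_prod_XsubC => m Eq.
case Em: (mask m rs) Eq => [|r s] Eq.
  by move/eqp_size: Eq sq => ->; rewrite big_nil size_poly1.
exists r; first by apply: (@mem_mask _ r m); rewrite Em mem_head.
by rewrite (eqp_root Eq) big_cons rootM root_XsubC eqxx.
Qed.

Section GaloisCriterion.
Variables (gamma c : rat).

Lemma comp_fgcL_eval (L : fieldExtType rat) (r : L) :
  (fgcL gamma c L).[r] = (r - in_alg L gamma) ^+ 2 + in_alg L c.
Proof. by rewrite /fgcL !hornerE. Qed.

(** The third iterate is split by al, then bp and bm, then d1, ..., d4. The product of the d_i
    squares to f^3(gamma) = y^2, so d4 is plus or minus y / (d1 d2 d3) and six quadratic steps
    suffice instead of seven. *)
Lemma splitting_fiter3_dim (L : splittingFieldType rat) (E : {subfield L}) (y : rat) :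
  y != 0 -> ((c - gamma) ^+ 2 + c - gamma) ^+ 2 + c = y ^+ 2 ->
  splittingFieldFor 1%VS (map_poly (in_alg L) (fiter gamma c 3)) E ->
  (\dim E <= 64)%N.
Proof.
move=> y0 Ey [rs]; rewrite map_fiter3 => Ep <-.
set f := fgcL gamma c L in Ep *.
set g := in_alg L gamma; set k := in_alg L c.
have fE p : f \Po p = (p - g%:P) ^+ 2 + k%:P by rewrite comp_fgcL.
have fe r : f.[r] = (r - g) ^+ 2 + k by rewrite comp_fgcL_eval.
have szf : size f = 3%N.
  rewrite /f /fgcL size_polyDl; first by rewrite size_exp_XsubC.
  by rewrite size_exp_XsubC (leq_ltn_trans (size_polyC_leq1 _)).
have szff : size (f \Po f) = 5%N.
  by have := size_comp_poly f f; rewrite szf; case: size => //= n ->.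
have szfff : (1 < size (f \Po (f \Po f)))%N.
  by have := size_comp_poly f (f \Po f); rewrite szf szff; case: size => //= n ->.
have [r0 r0s r00] : exists2 r, r \in rs & root (f \Po (f \Po f)) r.
  exact: (root_of_prod_XsubC_factor Ep (dvdpp _)).
pose al := f.[f.[r0]] - g.
have Eal : al ^+ 2 = - k.
  by move: r00; rewrite rootE !horner_comp fe -/al addr_eq0 => /eqP.
(* As c = - a^2, the third iterate is a difference of two squares. The splitting field is known only
   through the list [rs], so the intermediate square roots are read off roots of such factors in
   [rs]. *)
have fact1 (a : L) : a ^+ 2 = - k -> (f \Po f) - (g + a)%:P %| f \Po (f \Po f).
  move=> Ea; apply/dvdpP; exists ((f \Po f) - (g - a)%:P).
  rewrite [LHS]fE -[k]opprK -Ea !(polyCD, polyCN) rmorphXn /=; ring.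
have root1 (a : L) : a ^+ 2 = - k -> exists2 r, r \in rs & f.[f.[r]] = g + a.
  move=> Ea; have [|r rr] := root_of_prod_XsubC_factor Ep (fact1 a Ea).
    by rewrite size_polyDl szff // size_polyN (leq_ltn_trans (size_polyC_leq1 _)).
  by rewrite rootE hornerD hornerN hornerC horner_comp subr_eq0 => /eqP Er; exists r.
have [rp rps Erp] := root1 al Eal.
have [rm rms Erm] := root1 (- al) (etrans (sqrrN _) Eal).
pose bp := f.[rp] - g; pose bm := f.[rm] - g.
have Ebp : bp ^+ 2 = g - k + al.
  by move: Erp; rewrite fe -/bp => E1; apply: (addIr k); rewrite E1; ring.
have Ebm : bm ^+ 2 = g - k - al.
  by move: Erm; rewrite fe -/bm => E1; apply: (addIr k); rewrite E1; ring.
have fact2 (b : L) : (b ^+ 2 + k - g) ^+ 2 = - k -> f - (g + b)%:P %| f \Po (f \Po f).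
  move=> Eb; apply: (dvdp_trans _ (fact1 _ Eb)); apply/dvdpP.
  exists (f - (g - b)%:P); rewrite fE.
  have -> : g + (b ^+ 2 + k - g) = b ^+ 2 + k by ring.
  rewrite !(polyCD, polyCN) rmorphXn /=; ring.
have root2 (b : L) : (b ^+ 2 + k - g) ^+ 2 = - k ->
    exists2 r, r \in rs & (r - g) ^+ 2 = g - k + b.
  move=> Eb; have [|r rr] := root_of_prod_XsubC_factor Ep (fact2 b Eb).
    by rewrite size_polyDl szf // size_polyN (leq_ltn_trans (size_polyC_leq1 _)).
  rewrite rootE hornerD hornerN hornerC fe subr_eq0 => /eqP Er; exists r => //.
  by apply: (addIr k); rewrite Er; ring.
have Hbp : (bp ^+ 2 + k - g) ^+ 2 = - k by rewrite Ebp -[RHS]Eal; ring.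
have Hbm : (bm ^+ 2 + k - g) ^+ 2 = - k by rewrite Ebm -[RHS]Eal; ring.
have [r1 _ E1] := root2 bp Hbp.
have [r2 _ E2] : exists2 r, r \in rs & (r - g) ^+ 2 = g - k + - bp.
  by apply: root2; rewrite sqrrN.
have [r3 _ E3] := root2 bm Hbm.
have [r4 _ E4] : exists2 r, r \in rs & (r - g) ^+ 2 = g - k + - bm.
  by apply: root2; rewrite sqrrN.
set d1 := r1 - g in E1; set d2 := r2 - g in E2.
set d3 := r3 - g in E3; set d4 := r4 - g in E4.
have Eprod : (d1 * d2 * d3 * d4) ^+ 2 = (in_alg L y) ^+ 2.
  have -> : in_alg L y ^+ 2 = ((k - g) ^+ 2 + k - g) ^+ 2 + k.
    by rewrite -rmorphXn -Ey !(rmorphD, rmorphN, rmorphXn).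
  rewrite !exprMn E1 E2 E3 E4.
  have -> : (g - k + bp) * (g - k - bp) * (g - k + bm) * (g - k - bm) =
     ((g - k) ^+ 2 - bp ^+ 2) * ((g - k) ^+ 2 - bm ^+ 2) by ring.
  rewrite Ebp Ebm.
  have -> : k = - al ^+ 2 by rewrite Eal opprK.
  ring.
have yL0 : in_alg L y != 0 by rewrite fmorph_eq0.
have d0 : d1 * d2 * d3 != 0.
  apply: contraNneq yL0 => dd; move: Eprod; rewrite dd mul0r expr0n /= => /esym/eqP.
  by rewrite expf_eq0.
pose K0 : {subfield L} := 1%AS.
pose K1 := <<K0; al>>%AS; pose K2 := <<K1; bp>>%AS; pose K3 := <<K2; bm>>%AS.
pose K4 := <<K3; d1>>%AS; pose K5 := <<K4; d2>>%AS; pose K6 := <<K5; d3>>%AS.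
have gK (K : {subfield L}) (x : rat) : in_alg L x \in K by rewrite rpredZ ?mem1v.
have gkK (K : {subfield L}) : g - k \in K by rewrite rpredB ?gK.
have sK (K : {subfield L}) x : {subset K <= <<K; x>>%VS}.
  by apply/subvP; apply: subv_adjoin.
have alK1 : al \in K1 by apply: memv_adjoin.
have bpK2 : bp \in K2 by apply: memv_adjoin.
have bmK3 : bm \in K3 by apply: memv_adjoin.
have bpK3 : bp \in K3 by apply: sK.
have d1K6 : d1 \in K6 by do 2!apply: (sK); apply: memv_adjoin.
have d2K6 : d2 \in K6 by apply: sK; apply: memv_adjoin.
have d3K6 : d3 \in K6 by apply: memv_adjoin.
have bmK5 : bm \in K5 by do 2!apply: (sK).
have bpK4 : bp \in K4 by apply: sK.
have dim6 : (\dim K6 <= 64)%N.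
  have h1 : (\dim K1 <= 2 * \dim K0)%N by apply: dim_Fadjoin_sqr_le; rewrite Eal rpredN gK.
  have h2 : (\dim K2 <= 2 * \dim K1)%N.
    by apply: dim_Fadjoin_sqr_le; rewrite Ebp rpredD // gkK.
  have h3 : (\dim K3 <= 2 * \dim K2)%N.
    by apply: dim_Fadjoin_sqr_le; rewrite Ebm rpredB ?gkK // sK.
  have h4 : (\dim K4 <= 2 * \dim K3)%N.
    by apply: dim_Fadjoin_sqr_le; rewrite E1 rpredD ?gkK.
  have h5 : (\dim K5 <= 2 * \dim K4)%N.
    by apply: dim_Fadjoin_sqr_le; rewrite E2 rpredB ?gkK.
  have h6 : (\dim K6 <= 2 * \dim K5)%N.
    by apply: dim_Fadjoin_sqr_le; rewrite E3 rpredD ?gkK.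
  have h0 : \dim K0 = 1%N by rewrite dimv1.
  apply: leq_trans h6 _; rewrite (@leq_mul2l 2 _ 32) /=.
  apply: leq_trans h5 _; rewrite (@leq_mul2l 2 _ 16) /=.
  apply: leq_trans h4 _; rewrite (@leq_mul2l 2 _ 8) /=.
  apply: leq_trans h3 _; rewrite (@leq_mul2l 2 _ 4) /=.
  apply: leq_trans h2 _; rewrite (@leq_mul2l 2 _ 2) /=.
  by rewrite h0 in h1.
apply: leq_trans (dimvS _) dim6.
apply/Fadjoin_seqP; split; first exact: sub1v.
move=> r rrs.
have d4K6 : d4 \in K6.
  have : (d4 - in_alg L y / (d1 * d2 * d3)) * (d4 + in_alg L y / (d1 * d2 * d3)) = 0.
    rewrite -subr_sqr expr_div_n -Eprod.
    rewrite [_ * _ * _ * d4]mulrC exprMn mulfK ?subrr //.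
    by rewrite expf_eq0.
  have yd : in_alg L y / (d1 * d2 * d3) \in K6 by rewrite rpred_div ?rpredM ?gK.
  move/eqP; rewrite mulf_eq0 subr_eq0 addr_eq0.
  by case/orP=> /eqP ->; rewrite ?rpredN.
(* The left side is f^3(r), so every listed root is gamma plus or minus one of the d_i. *)
have allr : (r - g - d1) * (r - g + d1) * ((r - g - d2) * (r - g + d2)) *
    ((r - g - d3) * (r - g + d3)) * ((r - g - d4) * (r - g + d4)) = 0.
  have rr : (f \Po (f \Po f)).[r] = 0.
    apply/rootP; rewrite (eqp_root Ep) root_prod_XsubC //.
  rewrite -!subr_sqr E1 E2 E3 E4.
  rewrite !horner_comp !fe in rr; rewrite -[RHS]rr.
  set x := (r - g) ^+ 2.
  have -> : (x - (g - k + bp)) * (x - (g - k - bp)) * (x - (g - k + bm)) * (x - (g - k - bm)) =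
     ((x + k - g) ^+ 2 - bp ^+ 2) * ((x + k - g) ^+ 2 - bm ^+ 2) by ring.
  rewrite Ebp Ebm.
  have -> : k = - al ^+ 2 by rewrite Eal opprK.
  ring.
have inK d : d \in K6 -> (r - g - d) * (r - g + d) == 0 -> r \in K6.
  move=> dK; rewrite mulf_eq0 subr_eq0 addr_eq0 !subr_eq.
  by case/orP=> /eqP ->; rewrite ?rpredD ?rpredN ?gK.
move/eqP: allr; rewrite [_ * _ == 0]mulf_eq0 => /orP[|/inK]; last exact.
rewrite mulf_eq0 => /orP[|/inK]; last exact.
by rewrite mulf_eq0 => /orP[|] /inK; apply.
Qed.

Lemma not_galMaximal3 (y : rat) :
  y != 0 -> ((c - gamma) ^+ 2 + c - gamma) ^+ 2 + c = y ^+ 2 ->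
  ~ galMaximal gamma c 3.
Proof.
move=> y0 Ey [L [E [spE cE]]].
have := splitting_fiter3_dim y0 Ey spE.
by rewrite -(splitting_card_gal spE) cE.
Qed.

End GaloisCriterion.

Definition nonsquare (x : rat) := forall s : rat, x != s ^+ 2.

Lemma alg_lin_indep (L : fieldExtType rat) (al : L) (u v : rat) :
  al \notin 1%VS -> in_alg L u + in_alg L v * al = 0 -> u = 0 /\ v = 0.
Proof.
move=> al1 E; have [v0|v0] := eqVneq v 0.
  split=> //; move: E; rewrite v0 rmorph0 mul0r addr0 => /eqP.
  by rewrite fmorph_eq0 => /eqP.
case/negP: al1; have -> : al = in_alg L (- u / v).
  apply: (mulfI (_ : in_alg L v != 0)); first by rewrite fmorph_eq0.
  rewrite -rmorphM [v * _]mulrC divfK // rmorphN.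
  by apply/eqP; rewrite -addr_eq0 addrC E.
by rewrite rpredZ ?mem1v.
Qed.

Section FullDegree.
Variables (gamma c : rat).
Let phi := (c - gamma) ^+ 2 + c.
Hypotheses (nsc : nonsquare (- c)) (nsphi : nonsquare phi) (nscphi : nonsquare (- c * phi)).

Section InField.
Variables (L : fieldExtType rat) (al b1 b2 : L).
Local Notation i := (in_alg L).
Hypotheses (Eal : al ^+ 2 = i (- c)).
Hypotheses (Eb1 : b1 ^+ 2 = i (gamma - c) + al) (Eb2 : b2 ^+ 2 = i (gamma - c) - al).

Lemma alpha_notin : al \notin 1%VS.
Proof.
apply/negP=> /vlineP[k Ek]; have := nsc k; case/negP; apply/eqP.
apply: (fmorph_inj (in_alg L)); transitivity (al ^+ 2); first by rewrite Eal.
by rewrite Ek rmorphXn.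
Qed.

Let K1 : {subfield L} := <<1%AS; al>>%AS.
Let K2 : {subfield L} := <<K1; b1>>%AS.
Let K3 : {subfield L} := <<K2; b2>>%AS.

Lemma K1P x : x \in K1 -> exists u v, x = i u + i v * al.
Proof.
case/Fadjoin_sqrP; first by rewrite Eal rpredZ ?mem1v.
move=> u' [v' [/vlineP[u ->] /vlineP[v ->] ->]]; by exists u, v.
Qed.

Lemma alpha_in : al \in K1. Proof. exact: memv_adjoin. Qed.

(* Taking norms from [Q(al)] to [Q]: the element [gamma - c +- al] has norm [phi]. *)
Lemma conj_notin (b : L) (e : rat) : e ^+ 2 = 1 ->
  b ^+ 2 = i (gamma - c) + i e * al -> b \notin K1.
Proof.
move=> e2 Eb; apply/negP=> /K1P[u [v Ebuv]].
have : i (u ^+ 2 - c * v ^+ 2 - (gamma - c)) + i (2 * u * v - e) * al = 0.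
  have : b ^+ 2 - (i (gamma - c) + i e * al) = 0 by rewrite Eb subrr.
  rewrite Ebuv => <-.
  have -> : (i u + i v * al) ^+ 2 = i u ^+ 2 + i v ^+ 2 * al ^+ 2 + 2 * i u * i v * al by ring.
  rewrite Eal !(rmorphB, rmorphM, rmorphXn, rmorphN, rmorph_nat); ring.
case/(alg_lin_indep alpha_notin)=> /eqP; rewrite subr_eq0 => /eqP Ea /eqP.
rewrite subr_eq0 => /eqP Ec.
have /negP[] := nsphi (u ^+ 2 + c * v ^+ 2); apply/eqP.
have -> : (u ^+ 2 + c * v ^+ 2) ^+ 2 = (u ^+ 2 - c * v ^+ 2) ^+ 2 + c * (2 * u * v) ^+ 2 by ring.
by rewrite Ea Ec e2 /phi; ring.
Qed.

Lemma b1_notin : b1 \notin K1.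
Proof. by apply: (@conj_notin _ 1); rewrite ?expr1n // rmorph1 mul1r. Qed.

(** If b2 = u + v b1 over K1, squaring expresses 2 u v b1 in K1, so u v = 0. The case v = 0 puts b2
    in K1. The case u = 0 puts b1 b2 in K1, and its square is phi: writing b1 b2 = s + t al forces s
    t = 0, so phi or -c phi is a rational square. *)
Lemma b2_notin : b2 \notin K2.
Proof.
have gK1 a : i a \in K1 by rewrite rpredZ ?mem1v.
have b2K1 : b2 \notin K1.
  by apply: (@conj_notin _ (- 1)); rewrite ?sqrrN ?expr1n // rmorphN1 mulN1r.
have b1K1 : b1 ^+ 2 \in K1 by rewrite Eb1 rpredD ?gK1 ?alpha_in.
have b2K2 : b2 ^+ 2 \in K1 by rewrite Eb2 rpredB ?gK1 ?alpha_in.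
apply/negP=> /(Fadjoin_sqrP b1K1)[u [v [uK vK Eb]]].
have uv0 : u * v = 0.
  have [//|uv0] := eqVneq (u * v) 0; case/negP: b1_notin.
  have -> : b1 = (b2 ^+ 2 - u ^+ 2 - v ^+ 2 * b1 ^+ 2) / (2 * (u * v)).
    apply: (mulIf (_ : 2 * (u * v) != 0)); last first.
      rewrite divfK; first by rewrite Eb; ring.
      by rewrite mulf_neq0 // -(rmorph_nat (in_alg L)) fmorph_eq0.
    by rewrite mulf_neq0 // -(rmorph_nat (in_alg L)) fmorph_eq0.
  have nK : (2 : L) \in K1 by rewrite rpred_nat.
  have u2K : u ^+ 2 \in K1 by rewrite rpredX.
  have v2K : v ^+ 2 \in K1 by rewrite rpredX.
  have h : b2 ^+ 2 - u ^+ 2 - v ^+ 2 * b1 ^+ 2 \in K1 by do 2?apply: rpredB => //; apply: rpredM.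
  by apply: rpred_div => //; do 2?apply: rpredM.
have [v0|v0] := eqVneq v 0.
  by case/negP: b2K1; rewrite Eb v0 mul0r addr0.
have u0 : u = 0 by move/eqP: uv0; rewrite mulf_eq0 (negPf v0) orbF => /eqP.
have wK : b1 * b2 \in K1 by rewrite Eb u0 add0r mulrCA -expr2 rpredM.
have [s [t Ew]] := K1P wK.
have : i (s ^+ 2 - c * t ^+ 2 - phi) + i (2 * s * t) * al = 0.
  have : (b1 * b2) ^+ 2 - i phi = 0.
    apply/eqP; rewrite subr_eq0; apply/eqP.
    rewrite exprMn Eb1 Eb2.
    have -> : (i (gamma - c) + al) * (i (gamma - c) - al) = i (gamma - c) ^+ 2 - al ^+ 2 by ring.
    rewrite Eal -rmorphXn -rmorphB; congr (in_alg L _); rewrite /phi; ring.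
  rewrite Ew => <-.
  have -> : (i s + i t * al) ^+ 2 = i s ^+ 2 + i t ^+ 2 * al ^+ 2 + 2 * i s * i t * al by ring.
  rewrite Eal !(rmorphB, rmorphM, rmorphXn, rmorphN, rmorph_nat); ring.
case/(alg_lin_indep alpha_notin)=> /eqP; rewrite subr_eq0 => /eqP Ea /eqP.
rewrite !mulf_eq0 /= => /orP[|] /eqP z0.
  have /negP[] := nscphi (c * t); apply/eqP.
  by rewrite -Ea z0; ring.
have /negP[] := nsphi s; apply/eqP.
by rewrite -Ea z0; ring.
Qed.

Lemma dim_K3 : (\dim K3 = 8)%N.
Proof.
have gK (K : {subfield L}) a : i a \in K by rewrite rpredZ ?mem1v.
rewrite (@dim_Fadjoin_sqr _ _ K2 b2) ?b2_notin //.
  rewrite (@dim_Fadjoin_sqr _ _ K1 b1) ?b1_notin //.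
    by rewrite (@dim_Fadjoin_sqr _ _ 1%AS al) ?alpha_notin ?Eal ?gK // dimv1.
  by rewrite Eb1 rpredD ?gK ?alpha_in.
rewrite Eb2 rpredB ?gK //.
by apply: (subvP (subv_adjoin _ _)); apply: alpha_in.
Qed.

End InField.

Lemma galMaximal2 : galMaximal gamma c 2.
Proof.
(* The roots are taken among the algebraic numbers, and the number field they generate is then cut
   out; it is the splitting field, since gamma + b1 and gamma + b2 give back b1, b2 and al. *)
pose za : algC := sqrtC (ratr (- c)).
pose z1 : algC := sqrtC (ratr (gamma - c) + za); pose z2 : algC := sqrtC (ratr (gamma - c) - za).
have [Q [QC [s [Es genQ]]]] := num_field_exists [:: za; z1; z2].
case: s Es genQ => [//|al [//|b1 [//|b2 [|//]]]] [Ea E1 E2] genQ.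
have iE a : QC (in_alg Q a) = ratr a by have -> : in_alg Q a = ratr a := alg_num_field _ _; rewrite fmorph_rat.
have Eal : al ^+ 2 = in_alg Q (- c).
  by apply: (fmorph_inj QC); rewrite rmorphXn /= Ea sqrtCK -iE.
have Eb1 : b1 ^+ 2 = in_alg Q (gamma - c) + al.
  by apply: (fmorph_inj QC); rewrite rmorphXn rmorphD /= E1 sqrtCK -iE Ea.
have Eb2 : b2 ^+ 2 = in_alg Q (gamma - c) - al.
  by apply: (fmorph_inj QC); rewrite rmorphXn rmorphB /= E2 sqrtCK -iE Ea.
set g := in_alg Q gamma; set k := in_alg Q c.
pose rs := [:: g + b1; g - b1; g + b2; g - b2].
have Ep : map_poly (in_alg Q) (fiter gamma c 2) = \prod_(z <- rs) ('X - z%:P).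
  rewrite map_fiter2 comp_fgcL /fgcL -/g -/k !big_cons big_nil.
  have e1 : (b1 ^+ 2)%:P = g%:P - k%:P + al%:P by rewrite Eb1 rmorphB !(polyCD, polyCN).
  have e2 : (b2 ^+ 2)%:P = g%:P - k%:P - al%:P by rewrite Eb2 polyCD rmorphB !(polyCD, polyCN).
  have ea : (al ^+ 2)%:P = - k%:P by rewrite Eal rmorphN polyCN.
  rewrite !(polyCD, polyCN) !rmorphXn /= in e1 e2 ea *.
  transitivity ((('X - g%:P) ^+ 2 - b1%:P ^+ 2) * (('X - g%:P) ^+ 2 - b2%:P ^+ 2)); last by ring.
  rewrite e1 e2; have -> : k%:P = - al%:P ^+ 2 by rewrite ea opprK.
  ring.
have genE : <<1 & rs>>%VS = fullv.
  apply/eqP; rewrite eqEsubv subvf -genQ /=; apply/Fadjoin_seqP.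
  split; first exact: subv_adjoin_seq.
  have rE x : x \in rs -> x \in <<1%AS & rs>>%AS by apply: seqv_sub_adjoin.
  have gE a : in_alg Q a \in <<1%AS & rs>>%AS by rewrite rpredZ ?mem1v.
  have b1E : b1 \in <<1%AS & rs>>%AS.
    by rewrite -[b1](addrK g) addrC addrA addrAC -addrA rpredD ?rpredN ?gE // rE ?inE ?eqxx.
  have b2E : b2 \in <<1%AS & rs>>%AS.
    by rewrite -[b2](addrK g) addrC addrA addrAC -addrA rpredD ?rpredN ?gE // rE ?inE ?eqxx ?orbT.
  move=> x; rewrite !inE => /or3P[] /eqP-> //.
  have -> : al = b1 ^+ 2 - in_alg Q (gamma - c) by rewrite Eb1 addrC addKr.
  by rewrite rpredB ?rpredX ?gE.
have spl : splittingFieldFor 1%VS (map_poly (in_alg Q) (fiter gamma c 2)) {:Q}.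
  by exists rs => //; rewrite Ep eqpxx.
have ax : splitting_field_axiom Q.
  by exists (map_poly (in_alg Q) (fiter gamma c 2)) => //; apply: alg_polyOver.
pose LM := FieldExt_isSplittingField.Build rat Q ax.
pose L : splittingFieldType rat := HB.pack Q LM.
exists L, {:L}%AS; split; first exact: spl.
rewrite (@splitting_card_gal L {:L}%AS _ spl).
have E8 := dim_K3 Eal Eb1 Eb2.
have -> : (2 ^ (2 ^ 2 - 1) = 8)%N by [].
rewrite -E8; have -> : \dim {:L} = \dim {:Q} by [].
by rewrite -genQ !adjoin_cons Fadjoin_nil.
Qed.

End FullDegree.

Theorem inS3_of_square (gamma c y : rat) :
  y != 0 -> ((c - gamma) ^+ 2 + c - gamma) ^+ 2 + c = y ^+ 2 ->
  nonsquare (- c) -> nonsquare ((c - gamma) ^+ 2 + c) ->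
  nonsquare (- c * ((c - gamma) ^+ 2 + c)) -> inS3 gamma c.
Proof.
move=> y0 Ey h1 h2 h3; split; first exact: galMaximal2.
exact: not_galMaximal3 y0 Ey.
Qed.

Ltac nat_only := repeat match goal with
  | H : ?T |- _ =>
    tryif (lazymatch T with
      | nat => idtac | @eq nat _ _ => idtac | is_true (leq _ _) => idtac
      | is_true (odd _) => idtac | is_true (~~ odd _) => idtac
      | _ => fail end) then fail else clear H
  end.
Ltac nat_lia := nat_only; lia.
Ltac nat_nia := nat_only; nia.

(** * Nonarchimedean absolute values *)

(** The values lie in the ordered field F itself, so that p-adic sizes are compared by ordinary
    inequalities without real numbers or valuations. *)
Record nonarch (F : realFieldType) := Nonarch {
  nonarch_fun :> F -> F;
  pabs_ge0 : forall x, 0 <= nonarch_fun x;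
  pabs_eq0 : forall x, (nonarch_fun x == 0) = (x == 0);
  pabsM : forall x y, nonarch_fun (x * y) = nonarch_fun x * nonarch_fun y;
  pabsD : forall x y, nonarch_fun (x + y) <= Num.max (nonarch_fun x) (nonarch_fun y)
}.

Arguments pabs_ge0 {F}.
Arguments pabs_eq0 {F}.
Arguments pabsM {F} {n}.
Arguments pabsD {F} {n}.

Section NonarchimedeanTheory.
Variables (F : realFieldType) (v : nonarch F).
Implicit Types (x y s t : F).

Lemma pabs0 : v 0 = 0. Proof. by apply/eqP; rewrite pabs_eq0. Qed.

Lemma pabs_gt0 x : x != 0 -> 0 < v x.
Proof. by move=> x0; rewrite lt_neqAle pabs_ge0 eq_sym pabs_eq0 x0. Qed.

Lemma pabs1 : v 1 = 1.
Proof.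
have v0 : v 1 != 0 by rewrite pabs_eq0 oner_eq0.
by apply: (mulfI v0); rewrite -pabsM !mulr1.
Qed.

Lemma pabsV x : v x^-1 = (v x)^-1.
Proof.
have [->|x0] := eqVneq x 0; first by rewrite invr0 pabs0 invr0.
apply: (mulfI (_ : v x != 0)); first by rewrite pabs_eq0.
by rewrite -pabsM !divff ?pabs_eq0 // pabs1.
Qed.

Lemma pabsX x k : v (x ^+ k) = v x ^+ k.
Proof. by elim: k => [|k IH]; rewrite ?pabs1 // !exprS pabsM IH. Qed.

Lemma pabsN x : v (- x) = v x.
Proof.
apply/eqP; rewrite -(eqrXn2 (_ : 0 < 2)%N) ?pabs_ge0 //.
by rewrite -!pabsX sqrrN.
Qed.

Lemma pabsBC x y : v (x - y) = v (y - x).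
Proof. by rewrite -pabsN opprB. Qed.

Lemma pabsD_le t x y : v x <= t -> v y <= t -> v (x + y) <= t.
Proof. by move=> xt yt; apply: le_trans (pabsD _ _) _; rewrite ge_max xt. Qed.

Lemma pabsB_le t x y : v x <= t -> v y <= t -> v (x - y) <= t.
Proof. by move=> xt yt; rewrite pabsD_le ?pabsN. Qed.

Lemma pabsD_lt t x y : v x < t -> v y < t -> v (x + y) < t.
Proof. by move=> xt yt; apply: le_lt_trans (pabsD _ _) _; rewrite gt_max xt. Qed.

Lemma pabsB_lt t x y : v x < t -> v y < t -> v (x - y) < t.
Proof. by move=> xt yt; rewrite pabsD_lt ?pabsN. Qed.

Lemma pabsDl x y : v y < v x -> v (x + y) = v x.
Proof.
move=> yx; apply/eqP; rewrite eq_le pabsD_le ?(ltW yx) //= leNgt.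
apply/negP=> lt; have := pabsB_lt lt yx.
by rewrite addrK ltxx.
Qed.

Lemma pabsDr x y : v x < v y -> v (x + y) = v y.
Proof. by rewrite addrC; apply: pabsDl. Qed.

Lemma pabsBl x y : v y < v x -> v (x - y) = v x.
Proof. by rewrite -[v y]pabsN; apply: pabsDl. Qed.

Lemma pabsM_le s t x y : v x <= s -> v y <= t -> v (x * y) <= s * t.
Proof. by move=> xs yt; rewrite pabsM ler_pM ?pabs_ge0. Qed.

Lemma pabsM_le1 x y : v x <= 1 -> v y <= 1 -> v (x * y) <= 1.
Proof. by move=> xs yt; rewrite -[1]mulr1 pabsM_le. Qed.

Lemma pabsX_le1 x k : v x <= 1 -> v (x ^+ k) <= 1.
Proof. by move=> x1; rewrite pabsX exprn_ile1 ?pabs_ge0. Qed.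

Lemma pabs_nat_le1 k : v k%:R <= 1.
Proof. by elim: k => [|k IH]; rewrite ?pabs0 ?ler01 // -natr1 pabsD_le ?pabs1. Qed.

Lemma pabs_intr_le1 (n : int) : v n%:~R <= 1.
Proof.
by case: n => k; rewrite ?NegzE ?rmorphN /= ?pabsN; apply: pabs_nat_le1.
Qed.

End NonarchimedeanTheory.

(** * The p-adic absolute value on the rationals *)

Section PadicAbsoluteValue.
Variable p : nat.
Implicit Types (m n : int) (x y : rat).

Definition iabs n : rat := if n == 0 then 0 else (p%:R ^+ logn p `|n|)^-1.

(* For composite [p], where [logn p] is [0], this is the trivial absolute value, so the
   algebraic laws need no primality. *)
Definition padic_fun x : rat := iabs (numq x) / iabs (denq x).

Lemma logn_pow_gt0 k : 0 < (p%:R ^+ logn p k : rat).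
Proof. by case: p => [|q]; [rewrite lognE /= | rewrite exprn_gt0 ?ltr0Sn]. Qed.

Lemma iabs_gt0 n : n != 0 -> 0 < iabs n.
Proof. by move=> n0; rewrite /iabs (negPf n0) invr_gt0 logn_pow_gt0. Qed.

Lemma iabs_ge0 n : 0 <= iabs n.
Proof. by rewrite /iabs; case: eqP => // _; rewrite invr_ge0 ltW ?logn_pow_gt0. Qed.

Lemma iabs_eq0 n : (iabs n == 0) = (n == 0).
Proof. by have [->|/iabs_gt0/gt_eqF] := eqVneq n 0; rewrite // /iabs eqxx. Qed.

Lemma iabsM m n : iabs (m * n) = iabs m * iabs n.
Proof.
rewrite /iabs mulf_eq0; have [_|m0] := eqVneq m 0; first by rewrite mul0r.
have [_|n0] := eqVneq n 0; first by rewrite mulr0.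
by rewrite /= abszM lognM ?absz_gt0 // exprD invfM.
Qed.

Lemma iabsD m n : iabs (m + n) <= Num.max (iabs m) (iabs n).
Proof.
have [->|m0] := eqVneq m 0; first by rewrite add0r le_max lexx orbT.
have [->|n0] := eqVneq n 0; first by rewrite addr0 le_max lexx.
have [->|mn0] := eqVneq (m + n) 0; first by rewrite {1}/iabs eqxx le_max iabs_ge0.
have [pp|np] := boolP (prime p); last first.
  have l0 k : logn p k = 0%N by rewrite lognE (negPf np).
  by rewrite /iabs (negPf m0) (negPf mn0) !l0 le_max lexx.
have le_p (k l : nat) : ((p%:R ^+ k)^-1 <= ((p%:R ^+ l)^-1 : rat)) = (l <= k)%N.
  by rewrite lef_pV2 ?posrE ?exprn_gt0 ?ltr0n ?prime_gt0 // ler_eXn2l // ltr1n prime_gt1.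
rewrite /iabs (negPf m0) (negPf n0) (negPf mn0) le_max !le_p -geq_min.
rewrite -pfactor_dvdn ?absz_gt0 //.
suff : ((p ^ minn (logn p `|m|) (logn p `|n|))%N%:Z %| m + n)%Z by [].
by apply: rpredD; rewrite dvdzE /= pfactor_dvdn ?absz_gt0 // ?geq_minl ?geq_minr.
Qed.

Lemma padic_fun_frac m n : n != 0 -> padic_fun (m%:~R / n%:~R) = iabs m / iabs n.
Proof.
move=> n0; set x := _ / _.
have E : numq x * n = m * denq x.
  apply/eqP; rewrite -(eqr_int rat) !rmorphM /= numqE /x mulrAC divfK ?intr_eq0 //.
apply/eqP; rewrite /padic_fun eqr_div ?iabs_eq0 ?denq_eq0 //.
by rewrite -!iabsM E.
Qed.

Lemma padic_fun_int n : padic_fun n%:~R = iabs n.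
Proof.
rewrite -[n%:~R]divr1 -[1](mulr1z 1) padic_fun_frac // {2}/iabs /=.
by rewrite logn1 expr0 invr1 divr1.
Qed.

Lemma padic_fun_ge0 x : 0 <= padic_fun x.
Proof. by rewrite divr_ge0 ?iabs_ge0. Qed.

Lemma padic_fun_eq0 x : (padic_fun x == 0) = (x == 0).
Proof. by rewrite mulf_eq0 invr_eq0 !iabs_eq0 denq_eq0 orbF numq_eq0. Qed.

Lemma padic_funM x y : padic_fun (x * y) = padic_fun x * padic_fun y.
Proof.
rewrite -{1}[x]divq_num_den -{1}[y]divq_num_den mulf_div -!rmorphM /=.
by rewrite padic_fun_frac ?mulf_neq0 ?denq_eq0 // !iabsM mulf_div.
Qed.

Lemma padic_funD x y : padic_fun (x + y) <= Num.max (padic_fun x) (padic_fun y).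
Proof.
have dx : denq x != 0 by rewrite denq_eq0.
have dy : denq y != 0 by rewrite denq_eq0.
have E : x + y = (numq x * denq y + numq y * denq x)%:~R / (denq x * denq y)%:~R.
  rewrite -{1}[x]divq_num_den -{1}[y]divq_num_den addf_div ?intr_eq0 //.
  by rewrite !(rmorphD, rmorphM).
rewrite E padic_fun_frac ?mulf_neq0 // ler_pdivrMr ?iabs_gt0 ?mulf_neq0 //.
apply: le_trans (iabsD _ _) _; rewrite maxr_pMl ?iabs_ge0 // !iabsM.
have nx z : iabs (numq z) = padic_fun z * iabs (denq z) by rewrite divfK ?iabs_eq0 ?denq_eq0.
by rewrite !nx mulrA -[_ * _ * iabs (denq x)]mulrA [iabs (denq y) * _]mulrC mulrA.
Qed.

End PadicAbsoluteValue.

Definition padic p : nonarch rat :=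
  Nonarch (padic_fun_ge0 p) (padic_fun_eq0 p) (padic_funM p) (padic_funD p).
Arguments padic : simpl never.

Lemma padic_int p n : padic p n%:~R = iabs p n. Proof. exact: padic_fun_int. Qed.

Section Prime.
Variable p : nat.
Implicit Types (n : int) (x : rat).
Hypothesis pp : prime p.
Let p0 : 0 < (p%:R : rat). Proof. by rewrite ltr0n prime_gt0. Qed.
Let p1 : 1 < (p%:R : rat). Proof. by rewrite ltr1n prime_gt1. Qed.
Let pn0 : (p%:R : rat) != 0. Proof. by rewrite gt_eqF. Qed.

Lemma pabs_p : padic p p%:R = p%:R^-1.
Proof.
rewrite -[p%:R]/(p%:Z%:~R) padic_int /iabs; case: eqP => [[]|_] /=.
  by move=> e; move: pp; rewrite e.
by rewrite logn_prime // eqxx expr1.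
Qed.

Lemma pabs_natE k : (0 < k)%N -> padic p k%:R = (p%:R ^+ logn p k)^-1.
Proof. by move=> k0; rewrite -[k%:R]/(k%:Z%:~R) padic_int /iabs eqz_nat eqn0Ngt k0. Qed.

Lemma pabs_nat_eq1 k : ~~ (p %| k)%N -> padic p k%:R = 1.
Proof.
move=> pk; have k0 : (0 < k)%N by case: k pk => //; rewrite dvdn0.
have -> : padic p k%:R = (p%:R ^+ logn p k)^-1 by apply: pabs_natE.
have : ~~ (0 < logn p k)%N by rewrite logn_gt0 mem_primes pp k0.
by rewrite -eqn0Ngt => /eqP ->; rewrite expr0 invr1.
Qed.

Lemma pabs_nat_lt1 k : (p %| k)%N -> padic p k%:R <= p%:R^-1.
Proof.
case/dvdnP=> m ->; rewrite natrM pabsM pabs_p ler_piMl ?invr_ge0 ?(ltW p0) //.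
exact: pabs_nat_le1.
Qed.

Lemma pabs_int_eq1 n : ~~ (p %| `|n|)%N -> padic p n%:~R = 1.
Proof.
move=> pn; case: n pn => k pk; first exact: pabs_nat_eq1.
by rewrite NegzE rmorphN pabsN; apply: pabs_nat_eq1.
Qed.

Lemma pabs_int_lt1 n : (p %| `|n|)%N -> padic p n%:~R <= p%:R^-1.
Proof.
case: n => k pk; first exact: pabs_nat_lt1.
by rewrite NegzE rmorphN pabsN; apply: pabs_nat_lt1.
Qed.

Lemma pabs_exprz x : x != 0 -> exists k : int, padic p x = p%:R ^ k.
Proof.
move=> x0; have nx : numq x != 0 by rewrite numq_eq0.
exists ((logn p `|denq x|)%:Z - (logn p `|numq x|)%:Z).
rewrite -[padic p x]/(padic_fun p x) /padic_fun /iabs (negPf nx) (negPf (denq_neq0 x)) invrK.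
by rewrite expfzDr // exprnN mulrC.
Qed.

Lemma exprz_inj_p (j k : int) : (p%:R : rat) ^ j = p%:R ^ k -> j = k.
Proof. by apply: ieexprIz => //; rewrite gt_eqF. Qed.

Lemma nonsquare_pabs_odd x (k : int) : padic p x = p%:R ^ (2 * k + 1) -> nonsquare x.
Proof.
move=> Ex s; apply/eqP=> Es; have s0 : s != 0.
  apply/eqP=> s0; move: Ex; rewrite Es s0 expr0n pabs0 => /esym/eqP.
  by rewrite (negPf (expfz_neq0 _ pn0)).
have [j Ej] := pabs_exprz s0; move: Ex; rewrite Es pabsX Ej.
rewrite [_ ^+ 2]exprnP exprz_exp => /exprz_inj_p; lia.
Qed.

Lemma pabs_lt1_le x : padic p x < 1 -> padic p x <= p%:R^-1.
Proof.
have [->|x0] := eqVneq x 0; first by rewrite pabs0 invr_ge0 (ltW p0).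
have [k ->] := pabs_exprz x0.
rewrite -[1](expr0z p%:R) -[p%:R^-1]/(p%:R ^ (-1)) ltr_eXz2l // ler_eXz2l //.
Qed.

Lemma exists_exprz_lt (e : rat) : 0 < e -> exists k : nat, (p%:R ^+ k)^-1 < e.
Proof.
move=> e0; have := archi_boundP (ltW (_ : 0 < e^-1)); rewrite invr_gt0 => /(_ e0) He.
exists (Num.bound e^-1); rewrite -[X in _ < X]invrK ltf_pV2 ?posrE ?invr_gt0 ?exprn_gt0 //.
apply: lt_trans He _; rewrite -natrX ltr_nat.
by apply: ltn_expl; apply: prime_gt1.
Qed.

End Prime.

(** * Squares, residues and local nonsquareness *)

Lemma even_logn_sqr (n : nat) : (0 < n)%N ->
  (forall q, prime q -> ~~ odd (logn q n)) -> exists m, n = (m ^ 2)%N.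
Proof.
move=> n0 ev; exists (\prod_(f <- prime_decomp n) f.1 ^ (f.2./2))%N.
rewrite {1}(prod_prime_decomp n0).
rewrite (big_morph (expn^~ 2) (fun a b => expnMn a b 2) (exp1n 2)).
apply: eq_big_seq => -[q e] qe /=; rewrite -expnM.
have [pq e0 _] := mem_prime_decomp qe.
have Ee : e = logn q n.
  by move: qe; rewrite prime_decompE => /mapP[r _ [-> ->]].
by rewrite muln2 even_halfK // Ee ev.
Qed.

Lemma rat_sqr_int (n : int) (x : rat) : n%:~R = x ^+ 2 -> exists m : int, n = m ^+ 2.
Proof.
move=> E; have dn : (denq x %| numq x)%Z.
  have : (denq x ^+ 2 %| numq x ^+ 2)%Z.
    apply/dvdzP; exists n; apply/eqP; rewrite -(eqr_int rat) !expr2 !intrM E numqE.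
    by apply/eqP; ring.
  by rewrite !dvdzE !abszX dvdn_pexp2r.
have d1 : denq x = 1.
  have := coprime_num_den x; rewrite /coprime; move: dn; rewrite dvdzE => /gcdn_idPr ->.
  by move/eqP=> h; rewrite -[LHS]gez0_abs ?h // ltW ?denq_gt0.
exists (numq x); apply/eqP; by rewrite -(eqr_int rat) expr2 intrM E numqE d1 mulr1 expr2.
Qed.

Lemma nonsquare_intM (n : int) (u : rat) :
  u != 0 -> (forall m : int, n != m ^+ 2) -> nonsquare (n%:~R * u ^+ 2).
Proof.
move=> u0 ns s; apply/eqP=> E; have [m /eqP] : exists m : int, n = m ^+ 2.
  apply: (@rat_sqr_int n (s / u)).
  by rewrite expr_div_n -E mulfK // expf_eq0.
by rewrite (negPf (ns m)).
Qed.

Lemma nonsquareM (x u : rat) : u != 0 -> nonsquare (x * u ^+ 2) -> nonsquare x.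
Proof.
move=> u0 ns s; apply/eqP=> E; have := ns (s * u).
by rewrite E exprMn eqxx.
Qed.

Lemma nonsquare_neq0 (x : rat) : nonsquare x -> x != 0.
Proof. by move/(_ 0); rewrite expr0n. Qed.

Lemma pabs_denq (p : nat) (t : rat) : prime p -> padic p t <= 1 -> padic p (denq t)%:~R = 1.
Proof.
move=> pp t1; apply: pabs_int_eq1 => //; apply/negP=> d2.
have n2 : (p %| `|numq t|)%N.
  apply/negP=> /negP/(pabs_int_eq1 pp); rewrite numqE pabsM => h.
  have := pabs_int_lt1 pp d2 => h2.
  have : padic p t * padic p (denq t)%:~R <= 1 * p%:R^-1 by rewrite ler_pM ?pabs_ge0.
  by rewrite h mul1r leNgt invf_lt1 ?ltr1n ?ltr0n ?prime_gt1 ?prime_gt0.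
have := coprime_num_den t; rewrite /coprime => /eqP g1.
have : (p %| gcdn `|numq t| `|denq t|)%N by rewrite dvdn_gcd n2.
by rewrite g1 dvdn1 => /eqP p1; move: pp; rewrite p1.
Qed.

Lemma pabs_residue (p : nat) (t : rat) : prime p -> padic p t <= 1 ->
  exists2 m : nat, (m < p)%N & padic p (t - m%:R) < 1.
Proof.
move=> pp t1; have d1 := pabs_denq pp t1.
have p0 : (p%:Z != 0) by rewrite -lt0n prime_gt0.
have cop : coprimez (denq t) p.
  rewrite coprimezE coprime_sym prime_coprime //.
  apply/negP=> /(pabs_int_lt1 pp); rewrite d1 leNgt invf_lt1 ?ltr1n ?ltr0n ?prime_gt1 ?prime_gt0 //.
have [[u v] Euv] := coprimezP _ _ cop; rewrite /= in Euv.
(* The Bezout coefficient u inverts the denominator of t modulo p. *)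
pose z := ((numq t * u) %% p)%Z.
have z0 : 0 <= z by apply: modz_ge0.
have zp : z < p by apply: ltz_pmod; rewrite ltz_nat prime_gt0.
exists `|z|%N; first by rewrite -ltz_nat gez0_abs.
have -> : `|z|%N%:R = z%:~R :> rat by rewrite -[in RHS](gez0_abs z0).
have E : t - z%:~R = (p%:Z * (numq t * v + denq t * ((numq t * u) %/ p)%Z))%:~R / (denq t)%:~R.
  apply: (mulIf (_ : (denq t)%:~R != 0 :> rat)); first by rewrite intr_eq0 denq_eq0.
  rewrite divfK ?intr_eq0 ?denq_eq0 // mulrBl -numqE -rmorphM -rmorphB /=; congr (_%:~R).
  have -> : z = numq t * u - ((numq t * u) %/ p)%Z * p.
    by apply/eqP; rewrite eq_sym subr_eq addrC; apply/eqP; exact: divz_eq.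
  by rewrite -[X in X - _]mulr1 -{1}Euv; ring.
rewrite E pabsM pabsV d1 invr1 mulr1 intrM pabsM (pabs_p pp : padic p (p%:Z%:~R) = _).
apply: le_lt_trans (_ : p%:R^-1 < 1); last by rewrite invf_lt1 ?ltr1n ?ltr0n ?prime_gt1 ?prime_gt0.
by rewrite ler_piMr ?invr_ge0 // pabs_intr_le1.
Qed.

Lemma pabs2_unit (t : rat) : padic 2 t = 1 -> padic 2 (t - 1) < 1.
Proof.
move=> t1; have [|[|[|//]] _ h //] := @pabs_residue 2 t isT; first by rewrite t1.
by move: h; rewrite subr0 t1 ltxx.
Qed.

Lemma pabs2_2 : padic 2 2 = 2^-1.
Proof. exact: (@pabs_p 2 isT). Qed.

(** No square comes closer to -1 than 1/2: for |t| different from 1 the two terms differ in size,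
    and for a unit t one has t^2 + 1 = 2 t + (t - 1)^2, where the last term is at most 1/4. *)
Lemma pabs2_sqr1D (t : rat) : 2^-1 <= padic 2 (t ^+ 2 + 1).
Proof.
have [t1|t1] := ltP (padic 2 t) 1.
  by rewrite pabsDr ?pabs1 ?pabsX ?exprn_ilt1 ?pabs_ge0.
have := t1; rewrite le_eqVlt => /orP[/eqP t1e|t1g]; last first.
  rewrite pabsDl ?pabs1 pabsX ?exprn_egt1 //.
  by apply: (@le_trans _ _ 1) => //; rewrite exprn_ege1.
have h := pabs2_unit (esym t1e).
have -> : t ^+ 2 + 1 = 2 * t + (t - 1) ^+ 2 by ring.
have h4 : padic 2 ((t - 1) ^+ 2) < 2^-1.
  apply: (@le_lt_trans _ _ (2^-1 ^+ 2)) => //.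
  rewrite pabsX; have := pabs_lt1_le (isT : prime 2) h => h'.
  by rewrite ler_pXn2r // nnegrE ?pabs_ge0.
have h2 : padic 2 (2 * t) = 2^-1 by rewrite pabsM pabs2_2 -t1e mulr1.
by rewrite pabsDl h2.
Qed.

(* An odd valuation at some prime is stable under perturbation; otherwise [x = - s ^ 2],
   and [-1] is not a square near [1] at the prime 2. *)
Lemma nonsquare_local (x : rat) : nonsquare x ->
  exists2 q, prime q &
  exists2 e : rat, 0 < e & forall x', padic q (x' - x) < e -> nonsquare x'.
Proof.
move=> nx; have x0 := nonsquare_neq0 nx.
have pn0 : (0 < `|numq x|)%N by rewrite absz_gt0 numq_eq0.
have pd0 : (0 < `|denq x|)%N by rewrite absz_gt0 denq_eq0.
(* N is |x| times the square of the denominator, so it has the same square class as |x|. *)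
pose N := (`|numq x| * `|denq x|)%N.
have N0 : (0 < N)%N by rewrite muln_gt0 pn0.
have [[q pq oq]|ev] : (exists2 q, prime q & odd (logn q N)) \/
    (forall q, prime q -> ~~ odd (logn q N)).
- have [/hasP[q _ /andP[pq oq]]|/hasPn hn] :=
    boolP (has (fun q => prime q && odd (logn q N)) (primes N)).
    by left; exists q.
  right=> q pq; have [qN|qN] := boolP (q \in primes N).
    by have := hn q qN; rewrite pq.
  by rewrite -logn_gt0 lt0n negbK in qN; rewrite (eqP qN).
- exists q => //; exists (padic q x); first exact: pabs_gt0.
  move=> x' xx; have Ex' : padic q x' = padic q x by rewrite -[x'](subrK x) pabsDr.
  have [k Ek] : exists k : int, (logn q N)%:Z = 2 * k + 1.
    by exists (logn q N)./2%:Z; rewrite -[in LHS](odd_double_half (logn q N)) oq; lia.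
  have qn0 : (q%:R : rat) != 0 by rewrite pnatr_eq0 -lt0n prime_gt0.
  pose a := (logn q `|numq x|)%:Z; pose b := (logn q `|denq x|)%:Z.
  apply: (@nonsquare_pabs_odd q pq _ (k - a)).
  rewrite Ex' -[padic q x]/(padic_fun q x) /padic_fun /iabs numq_eq0 (negPf x0) (negPf (denq_neq0 x)) invrK.
  have -> : 2 * (k - a) + 1 = b - a.
    by move: Ek; rewrite lognM // PoszD -/a -/b; lia.
  by rewrite expfzDr // exprnN mulrC.
have [m Em] := even_logn_sqr N0 ev.
have dn0 : (denq x)%:~R != 0 :> rat by rewrite intr_eq0 denq_eq0.
have absx : `|x| = (m%:R / (denq x)%:~R) ^+ 2.
  have Nm : `|numq x|%:~R * (denq x)%:~R = m%:R ^+ 2 :> rat.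
    rewrite -[denq x]absz_denq -natrX -Em natrM -abszE.
    by [].
  rewrite expr_div_n -Nm -{1}[x]divq_num_den normrM normfV -!intr_norm.
  rewrite [`|denq x|]gtr0_norm ?denq_gt0 //.
  by field.
have xneg : x < 0.
  rewrite ltNge; apply/negP=> xp; have := nx (m%:R / (denq x)%:~R).
  by rewrite -absx ger0_norm ?eqxx.
(* With x = - w^2, division by w^2 turns this radius into 1/2, the distance from -1 to the
   squares. *)
exists 2%N => //; exists (padic 2 x / 2); first by rewrite divr_gt0 ?pabs_gt0.
move=> x' xx s; apply/eqP=> Ex'.
set w := m%:R / _ in absx.
have Ex : x = - w ^+ 2 by rewrite -absx ltr0_norm ?opprK.
have w0 : w != 0 by apply: contraNneq x0; rewrite Ex => ->; rewrite expr0n oppr0.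
have := pabs2_sqr1D (s / w); rewrite leNgt => /negP; apply.
have -> : (s / w) ^+ 2 + 1 = (x' - x) / w ^+ 2.
  by rewrite Ex' Ex; field.
rewrite pabsM pabsV -[padic 2 (w ^+ 2)]pabsN -Ex ltr_pdivrMr ?pabs_gt0 //.
by rewrite mulrC.
Qed.

(** * The elliptic sequence *)

Section EllipticSequence.
Variables (F : realFieldType) (g d : F).
Hypothesis gd : g = 1 - d ^+ 2.

(** This is 16 ((c - gamma)^2 + c - phi) for c = - x y / 4, phi = gamma - (x + y) / 4, g = 4 gamma
    (1 - gamma) and d = 2 gamma - 1. *)
Definition biquad (x y : F) := x ^+ 2 * y ^+ 2 + 4 * d * (x * y) + 4 * (x + y) - 4 * g.

(** For fixed y, [biquad] is quadratic in the other variable with sum of roots - (4 d y + 4) / y^2,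
    and the recursion moves to the other root. At y = 0 the equation degenerates to x = g, the
    second root being the pole at the origin; this gives the starting pair. *)
Fixpoint epair (k : nat) : F * F :=
  if k is j.+1 then
    let: (x, y) := epair j in (y, - (4 * d * y + 4) / y ^+ 2 - x)
  else (0, g).

(* [eseq k] is, up to an affine change, the Weierstrass abscissa of [k P]; the value at 0,
   a pole, is junk. *)
Definition eseq k := (epair k.-1).1.

(** The recursion W_(k+1) W_(k-1) = e_k W_k^2 is that of the division polynomials at P, where e_k
    plays the role of x(P) - x(k P). *)
Fixpoint wpair (k : nat) : F * F :=
  if k is j.+1 then
    let: (x, y) := wpair j in (y, eseq j.+2 * y ^+ 2 / x)
  else (1, 2).

Definition wseq k := if k is j.+1 then (wpair j).1 else 0.

Local Notation e := eseq.
Local Notation W := wseq.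

Lemma eseq1 : e 1 = 0. Proof. by []. Qed.
Lemma eseq2 : e 2 = g. Proof. by []. Qed.

Lemma eseqS k : e k.+3 = - (4 * d * e k.+2 + 4) / e k.+2 ^+ 2 - e k.+1.
Proof. by rewrite /eseq /=; case: (epair k). Qed.

Lemma wseq1 : W 1 = 1. Proof. by []. Qed.
Lemma wseq2 : W 2 = 2. Proof. by []. Qed.

Lemma wseqS k : W k.+3 = e k.+2 * W k.+2 ^+ 2 / W k.+1.
Proof. by rewrite /wseq /=; case: (wpair k). Qed.

(** On the curve this says that no k P with 0 < k <= K is the origin. It keeps the recursions clear
    of division by zero. *)
Definition wnz K := forall k, (0 < k <= K)%N -> W k != 0.

Lemma wnzW K J : (J <= K)%N -> wnz K -> wnz J.
Proof. by move=> JK nz k /andP[k0 kJ]; rewrite nz ?k0 ?(leq_trans kJ). Qed.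

Lemma wmul k : W k.+1 != 0 -> W k.+3 * W k.+1 = e k.+2 * W k.+2 ^+ 2.
Proof. by move=> nz; rewrite wseqS divfK. Qed.

Lemma wmul1 k : (0 < k)%N -> W k != 0 -> W k.+2 * W k = e k.+1 * W k.+1 ^+ 2.
Proof. by case: k => // k _; apply: wmul. Qed.

Lemma eseq_neq0 K k : wnz K -> (1 < k < K)%N -> e k != 0.
Proof.
case: k => [|[|k]] // nz /andP[_ kK].
have w3 : W k.+3 != 0 by apply: nz; rewrite kK.
by move: w3; rewrite wseqS; apply: contra_neq => ->; rewrite !mul0r.
Qed.

Lemma biquadC x y : biquad x y = biquad y x.
Proof. by rewrite /biquad; ring. Qed.

Lemma biquad_other x y : x != 0 -> biquad y x = 0 ->
  biquad x (- (4 * d * x + 4) / x ^+ 2 - y) = 0.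
Proof.
move=> x0 h; rewrite -[RHS]h /biquad; field.
exact: x0.
Qed.

Lemma biquad_eseq K k : wnz K -> (0 < k < K)%N -> biquad (e k) (e k.+1) = 0.
Proof.
move=> nz; elim: k => [|k IH] // /andP[_ kK].
case: k IH kK => [|k] IH kK; first by rewrite /biquad eseq1 eseq2; ring.
rewrite eseqS; apply: biquad_other; last by apply: IH; rewrite /= ltnW.
by apply: (eseq_neq0 nz); rewrite /=.
Qed.

Lemma eseq_sum K k : wnz K -> (k.+2 < K)%N ->
  e k.+2 ^+ 2 * (e k.+3 + e k.+1) = - (4 * d * e k.+2 + 4).
Proof.
move=> nz kK; have x0 : e k.+2 != 0 by apply: (eseq_neq0 nz); rewrite /=.
by rewrite eseqS; field.
Qed.

Lemma eseq_prod K k : wnz K -> (k.+2 < K)%N ->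
  e k.+2 ^+ 2 * (e k.+3 * e k.+1) = 4 * (e k.+2 - g).
Proof.
move=> nz kK; have S := eseq_sum nz kK.
have : biquad (e k.+1) (e k.+2) = 0 by apply: (biquad_eseq nz); rewrite /= ltnW.
have -> : e k.+2 ^+ 2 * (e k.+3 * e k.+1) =
  (e k.+2 ^+ 2 * (e k.+3 + e k.+1)) * e k.+1 - e k.+2 ^+ 2 * e k.+1 ^+ 2 by ring.
rewrite S /biquad => h; apply/eqP; rewrite -subr_eq0 -[X in _ == X]oppr0 -[X in _ == - X]h.
by apply/eqP; ring.
Qed.

(* The identity [(e_(m+1) - e_n) (e_(m-1) - e_n) e_m ^ 2 = biquad e_m e_n], whose right side
   is symmetric, makes the elliptic divisibility law below an easy induction. *)
Lemma eseq_step K k y : wnz K -> (k.+2 < K)%N ->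
  e k.+2 ^+ 2 * ((e k.+3 - y) * (e k.+1 - y)) = biquad (e k.+2) y.
Proof.
move=> nz kK; have S := eseq_sum nz kK; have P := eseq_prod nz kK.
have -> : e k.+2 ^+ 2 * ((e k.+3 - y) * (e k.+1 - y)) = e k.+2 ^+ 2 * (e k.+3 * e k.+1)
  - (e k.+2 ^+ 2 * (e k.+3 + e k.+1)) * y + e k.+2 ^+ 2 * y ^+ 2 by ring.
by rewrite S P /biquad; ring.
Qed.

(** The addition law of division polynomials for the indices n + s and n. For n = 1 it is the
    recursion of W, for n = 2 the formula for e_(m+1) e_(m-1); larger n reduce to three instances
    with smaller n. *)
Theorem wseq_law K n s : wnz K -> (0 < n)%N -> (0 < s)%N -> (2 * n + s <= K.+1)%N ->
  W (2 * n + s) * W s = W (n + s) ^+ 2 * W n ^+ 2 * (e (n + s) - e n).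
Proof.
move=> nz; have [m] := ubnP n; elim: m n s => // m IH [|[|[|n]]] // [|s] // nm _ _ nK.
- rewrite muln1 add1n -[(2 + s.+1)%N]/s.+3 wmul ?nz // ?eseq1 ?wseq1; last by nat_lia.
  by rewrite expr1n mulr1 subr0 mulrC.
- rewrite -[(2 * 2 + s.+1)%N]/s.+1.+4 -[(2 + s.+1)%N]/s.+3 eseq2 wseq2.
  have n1 : W s.+1 != 0 by apply: nz; nat_lia.
  have n2 : W s.+2 != 0 by apply: nz; nat_lia.
  have n3 : W s.+3 != 0 by apply: nz; nat_lia.
  apply: (mulIf (_ : W s.+3 ^+ 2 != 0)); first by rewrite expf_eq0.
  have E1 := wmul n1; have E2 := wmul n2; have E3 := wmul n3.
  have -> : W s.+1.+4 * W s.+1 * W s.+3 ^+ 2 = (W s.+1.+4 * W s.+3) * (W s.+3 * W s.+1) by ring.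
  rewrite E1 E3; have P := @eseq_prod K s.+1 nz ltac:(nat_lia).
  transitivity (e s.+4 * e s.+2 * (W s.+4 * W s.+2) ^+ 2); first by ring.
  rewrite E2 exprMn mulrA [_ * _ * e _ ^+ 2]mulrC P; ring.
(* The target and the three instances are the index pairs (x + 1, n + 3), (x + 1, n + 1), (x + 2, n
   + 2) and (x, n + 2), the neighbours of (x + 1, n + 2). Stepping in either coordinate gives the
   same [biquad]. *)
- pose x := (n.+2 + s.+1)%N; have Ex : x = (n + s).+3 by rewrite /x; nat_lia.
  have I1 : W (2 * n.+2 + s.+3) * W s.+3 =
     W (n.+2 + s.+3) ^+ 2 * W n.+2 ^+ 2 * (e (n.+2 + s.+3) - e n.+2).
    by apply: IH => //; nat_lia.
  have I2 : W (2 * n.+2 + s.+1) * W s.+1 =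
     W (n.+2 + s.+1) ^+ 2 * W n.+2 ^+ 2 * (e (n.+2 + s.+1) - e n.+2).
    by apply: IH => //; nat_lia.
  have I3 : W (2 * n.+1 + s.+3) * W s.+3 =
     W (n.+1 + s.+3) ^+ 2 * W n.+1 ^+ 2 * (e (n.+1 + s.+3) - e n.+1).
    by apply: IH => //; nat_lia.
  rewrite -/x in I2.
  rewrite (_ : n.+2 + s.+3 = x.+2)%N in I1; last by rewrite /x; nat_lia.
  rewrite (_ : n.+1 + s.+3 = x.+1)%N in I3; last by rewrite /x; nat_lia.
  rewrite (_ : 2 * n.+1 + s.+3 = 2 * n.+2 + s.+1)%N in I3; last by nat_lia.
  rewrite (_ : n.+3 + s.+1 = x.+1)%N; last by rewrite /x; nat_lia.
  rewrite (_ : 2 * n.+3 + s.+1 = 2 * n.+2 + s.+3)%N; last by nat_lia.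
  have nz1 : W (2 * n.+2 + s.+1) != 0 by apply: nz; nat_lia.
  have nz2 : W s.+3 != 0 by apply: nz; nat_lia.
  have nzx : W x != 0 by apply: nz; nat_lia.
  have nzn : W n.+1 != 0 by apply: nz; nat_lia.
  apply: (mulIf (_ : W (2 * n.+2 + s.+1) * W s.+3 != 0)); first by rewrite mulf_neq0.
  transitivity ((W (2 * n.+2 + s.+3) * W s.+3) * (W (2 * n.+2 + s.+1) * W s.+1)); first by ring.
  rewrite I1 I2 I3.
  have P1 := @eseq_step K (n + s).+2 (e n.+2) nz ltac:(nat_lia).
  have P2 := @eseq_step K n (e x.+1) nz ltac:(nat_lia).
  rewrite -Ex in P1.
  have P12 : e x.+1 ^+ 2 * ((e x.+2 - e n.+2) * (e x - e n.+2)) =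
             e n.+2 ^+ 2 * ((e n.+3 - e x.+1) * (e n.+1 - e x.+1)).
    by rewrite P2 biquadC -P1.
  have Wx : W x.+2 * W x = e x.+1 * W x.+1 ^+ 2 by apply: wmul1 => //; rewrite /x; nat_lia.
  have Wn := wmul nzn.
  transitivity ((W x.+2 * W x) ^+ 2 * W n.+2 ^+ 4 * ((e x.+2 - e n.+2) * (e x - e n.+2))).
    by ring.
  rewrite Wx.
  transitivity (W x.+1 ^+ 4 * (W n.+3 * W n.+1) ^+ 2 * ((e n.+3 - e x.+1) * (e n.+1 - e x.+1)));
    last by ring.
  rewrite Wn !exprMn.
  transitivity (W x.+1 ^+ 4 * W n.+2 ^+ 4 *
     (e x.+1 ^+ 2 * ((e x.+2 - e n.+2) * (e x - e n.+2)))); first by ring.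
  rewrite P12; ring.
Qed.

(** The abscissae of the sum and the difference of two multiples of P, here with indices m = n + s
    and n. The law of W at s + 1, s and s - 1 gives the product; for s = 1 both sides vanish. *)
Lemma eseq_sym_prod K n s : wnz K -> (0 < n)%N -> (0 < s)%N -> (2 * n + s <= K)%N ->
  e (2 * n + s) * e s * (e (n + s) - e n) ^+ 2 = biquad (e (n + s)) (e n).
Proof.
move=> nz; case: n => // n _; case: s => // -[|s] _ nK.
  rewrite eseq1 mulr0 mul0r addn1 biquadC (biquad_eseq nz) //; nat_lia.
have [x Ex] : exists x, (n.+1 + s.+2 = x.+3)%N by exists (n + s)%N; nat_lia.
have Ey : (2 * n.+1 + s.+2 = (2 * n + s).+4)%N by nat_lia.
have I1 := @wseq_law K n.+1 s.+3 nz ltac:(nat_lia) ltac:(nat_lia) ltac:(nat_lia).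
have I2 := @wseq_law K n.+1 s.+2 nz ltac:(nat_lia) ltac:(nat_lia) ltac:(nat_lia).
have I3 := @wseq_law K n.+1 s.+1 nz ltac:(nat_lia) ltac:(nat_lia) ltac:(nat_lia).
rewrite (_ : n.+1 + s.+3 = x.+4)%N in I1; last by nat_lia.
rewrite Ex in I2.
rewrite (_ : n.+1 + s.+1 = x.+2)%N in I3; last by nat_lia.
rewrite Ex Ey; rewrite Ey in I2.
rewrite (_ : 2 * n.+1 + s.+3 = (2 * n + s).+4.+1)%N in I1; last by nat_lia.
rewrite (_ : 2 * n.+1 + s.+1 = (2 * n + s).+3)%N in I3; last by nat_lia.
set y := (2 * n + s)%N in I1 I2 I3 Ey *.
have W1 : W y.+4.+1 * W y.+3 = e y.+4 * W y.+4 ^+ 2 by apply: wmul; apply: nz; nat_lia.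
have W2 : W s.+3 * W s.+1 = e s.+2 * W s.+2 ^+ 2 by apply: wmul; apply: nz; nat_lia.
have W3 : W x.+4 * W x.+2 = e x.+3 * W x.+3 ^+ 2 by apply: wmul; apply: nz; nat_lia.
have St := @eseq_step K x.+1 (e n.+1) nz ltac:(nat_lia).
have nzx : W x.+3 != 0 by apply: nz; nat_lia.
have nzn : W n.+1 != 0 by apply: nz; nat_lia.
apply: (mulIf (_ : W x.+3 ^+ 4 * W n.+1 ^+ 4 != 0)); first by rewrite mulf_neq0 ?expf_neq0.
transitivity (e y.+4 * e s.+2 * (W x.+3 ^+ 2 * W n.+1 ^+ 2 * (e x.+3 - e n.+1)) ^+ 2); first by ring.
rewrite -I2 -St.
transitivity ((e y.+4 * W y.+4 ^+ 2) * (e s.+2 * W s.+2 ^+ 2)); first by ring.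
rewrite -W1 -W2.
transitivity ((W y.+4.+1 * W s.+3) * (W y.+3 * W s.+1)); first by ring.
rewrite I1 I3.
transitivity ((W x.+4 * W x.+2) ^+ 2 * W n.+1 ^+ 4 *
   ((e x.+4 - e n.+1) * (e x.+2 - e n.+1))); first by ring.
by rewrite W3; ring.
Qed.

(** Since g = 1 - d^2, the discriminant of [biquad] at x, as a quadratic in the other variable, is
    -16 times this cubic, whose roots are the abscissae of the points of order two. *)
Definition cubic (x : F) := x ^+ 3 - x ^+ 2 - 2 * d * x - 1.

Lemma eseq_gap K n : wnz K -> (n.+2 < K)%N ->
  (e n.+2 ^+ 2 * (e n.+3 - e n.+1)) ^+ 2 = - 16 * cubic (e n.+2).
Proof.
move=> nz nK; have S := eseq_sum nz nK; have P := eseq_prod nz nK.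
transitivity ((e n.+2 ^+ 2 * (e n.+3 + e n.+1)) ^+ 2
   - 4 * e n.+2 ^+ 2 * (e n.+2 ^+ 2 * (e n.+3 * e n.+1))); first by ring.
by rewrite S P /cubic gd; ring.
Qed.

Lemma wseq_even K n : wnz K -> (2 * n.+2 <= K.+1)%N ->
  W (2 * n.+2) * 2 = W n.+3 ^+ 2 * W n.+1 ^+ 2 * (e n.+3 - e n.+1).
Proof.
move=> nz nK; have := @wseq_law K n.+1 2 nz ltac:(nat_lia) ltac:(nat_lia) ltac:(nat_lia).
by rewrite (_ : 2 * n.+1 + 2 = 2 * n.+2)%N ?addn2 //; nat_lia.
Qed.

Lemma wseq_odd K n : wnz K -> (2 * n.+1 + 1 <= K.+1)%N ->
  W (2 * n.+1 + 1) = W n.+2 ^+ 2 * W n.+1 ^+ 2 * (e n.+2 - e n.+1).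
Proof.
move=> nz nK; have := @wseq_law K n.+1 1 nz ltac:(nat_lia) ltac:(nat_lia) ltac:(nat_lia).
by rewrite wseq1 mulr1 [(n.+1 + 1)%N]addn1.
Qed.

Lemma eseq_dup K n : wnz K -> (1 < n)%N -> (2 * n <= K)%N ->
  e (2 * n) * (4 * cubic (e n)) = biquad (e n) (e n).
Proof.
move=> nz; case: n => [|[|n]] // _ nK.
have I1 := @wseq_odd K n.+1 nz ltac:(nat_lia); have I2 := @wseq_odd K n nz ltac:(nat_lia).
have I3 := @wseq_even K n nz ltac:(nat_lia).
have W1 : W (2 * n.+2 + 1) * W (2 * n.+1 + 1) = e (2 * n.+2) * W (2 * n.+2) ^+ 2.
  have [y Ey] : exists y, (2 * n.+2 = y.+2)%N by exists (2 * n.+1)%N; nat_lia.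
  rewrite Ey addn1 (_ : 2 * n.+1 + 1 = y.+1)%N; last by nat_lia.
  by apply: wmul; apply: nz; nat_lia.
rewrite I1 I2 in W1.
have G := @eseq_gap K n nz ltac:(nat_lia).
have St := @eseq_step K n (e n.+2) nz ltac:(nat_lia).
have nz1 : W n.+1 != 0 by apply: nz; nat_lia.
have nz2 : W n.+2 != 0 by apply: nz; nat_lia.
have nz3 : W n.+3 != 0 by apply: nz; nat_lia.
have Wn : W n.+3 * W n.+1 = e n.+2 * W n.+2 ^+ 2 by apply: wmul.
apply: (mulIf (_ : (W n.+3 * W n.+1) ^+ 4 != 0)); first by rewrite expf_neq0 // mulf_neq0.
apply: (mulIf (_ : (-4 : F) != 0)); first by rewrite oppr_eq0 pnatr_eq0.
transitivity (e (2 * n.+2) * (- 16 * cubic (e n.+2)) * (W n.+3 * W n.+1) ^+ 4); first by ring.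
rewrite -G -St.
transitivity (e (2 * n.+2) * (W n.+3 ^+ 2 * W n.+1 ^+ 2 * (e n.+3 - e n.+1)) ^+ 2 * e n.+2 ^+ 4).
  by ring.
rewrite -I3.
transitivity (e (2 * n.+2) * W (2 * n.+2) ^+ 2 * 4 * e n.+2 ^+ 4); first by ring.
rewrite -W1.
transitivity (- 4 * e n.+2 ^+ 2 * (W n.+3 * W n.+1) ^+ 2 * (e n.+2 * W n.+2 ^+ 2) ^+ 2 *
  ((e n.+3 - e n.+2) * (e n.+1 - e n.+2))); first by ring.
by rewrite -Wn; ring.
Qed.

(* [2 (k P) - P] : the abscissa of [(2 k - 1) P] is a function of the pair [e k, e (k - 1)]. *)
Lemma eseq_odd_dup K k (P := e k.+3 * e k.+2) (S := e k.+3 + e k.+2) :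
  wnz K -> (2 * k.+2 + 1 <= K)%N ->
  e (2 * k.+2 + 1) * (e k.+3 - e k.+2) ^+ 2 =
    - (P * (P + 2 * d) ^+ 2 + 2 * (P + 2 * d) * S + 4).
Proof.
move=> nz kK.
have I1 := @wseq_even K k.+1 nz ltac:(nat_lia); have I2 := @wseq_even K k nz ltac:(nat_lia).
have I3 := @wseq_odd K k.+1 nz ltac:(nat_lia).
have W1 : W (2 * k.+3) * W (2 * k.+2) = e (2 * k.+2 + 1) * W (2 * k.+2 + 1) ^+ 2.
  rewrite (_ : 2 * k.+3 = (2 * k.+2 + 1).+1)%N; last by nat_lia.
  by rewrite addn1 wmul1 //; apply: nz; nat_lia.
have S1 := @eseq_sum K k nz ltac:(nat_lia); have S2 := @eseq_sum K k.+1 nz ltac:(nat_lia).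
have nz1 : W k.+1 != 0 by apply: nz; nat_lia.
have nz2 : W k.+2 != 0 by apply: nz; nat_lia.
have nz3 : W k.+3 != 0 by apply: nz; nat_lia.
have nz4 : W k.+4 != 0 by apply: nz; nat_lia.
have Wn : W k.+3 * W k.+1 = e k.+2 * W k.+2 ^+ 2 by apply: wmul.
have Wm : W k.+4 * W k.+2 = e k.+3 * W k.+3 ^+ 2 by apply: wmul.
apply: (mulIf (_ : (W k.+3 ^+ 2 * W k.+2 ^+ 2) ^+ 2 * 4 != 0)).
  by rewrite mulf_neq0 ?pnatr_eq0 // expf_neq0 // mulf_neq0 // expf_neq0.
transitivity (e (2 * k.+2 + 1) * (W k.+3 ^+ 2 * W k.+2 ^+ 2 * (e k.+3 - e k.+2)) ^+ 2 * 4).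
  by ring.
rewrite -I3 -W1.
transitivity ((W (2 * k.+3) * 2) * (W (2 * k.+2) * 2)); first by ring.
rewrite I1 I2.
transitivity ((W k.+4 * W k.+2) ^+ 2 * (W k.+3 * W k.+1) ^+ 2 *
  ((e k.+4 - e k.+2) * (e k.+3 - e k.+1))); first by ring.
rewrite Wn Wm.
have E1 : e k.+2 ^+ 2 * (e k.+3 - e k.+1) = 2 * e k.+2 ^+ 2 * e k.+3 + (4 * d * e k.+2 + 4).
  transitivity (2 * e k.+2 ^+ 2 * e k.+3 - (e k.+2 ^+ 2 * (e k.+3 + e k.+1))); first by ring.
  by rewrite S1; ring.
have E2 : e k.+3 ^+ 2 * (e k.+4 - e k.+2) = - (2 * e k.+3 ^+ 2 * e k.+2 + (4 * d * e k.+3 + 4)).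
  transitivity (e k.+3 ^+ 2 * (e k.+4 + e k.+2) - 2 * e k.+3 ^+ 2 * e k.+2); first by ring.
  by rewrite S2; ring.
transitivity (W k.+3 ^+ 4 * W k.+2 ^+ 4 * ((e k.+3 ^+ 2 * (e k.+4 - e k.+2)) *
   (e k.+2 ^+ 2 * (e k.+3 - e k.+1)))); first by ring.
by rewrite E1 E2 /P /S; ring.
Qed.

Lemma eseq_inj_lt K n s : wnz K -> (0 < n)%N -> (0 < s)%N -> (2 * n + s <= K)%N ->
  e (n + s) != e n.
Proof.
move=> nz n0 s0 nK; have L := @wseq_law K n s nz n0 s0 (leqW nK).
have : W (2 * n + s) * W s != 0 by rewrite mulf_neq0 ?nz //; nat_lia.
by rewrite L; apply: contra_neq => ->; rewrite subrr mulr0.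
Qed.

End EllipticSequence.

Section InverseCoordinate.
Variables (F : realFieldType) (g d : F).

(** In the coordinate 1/e the origin of the curve is 0, and the numerators are 1 plus terms that
    vanish there. *)
Lemma biquad_inv (r r' : F) : r != 0 -> r' != 0 ->
  biquad g d r^-1 r'^-1 = (1 + 4 * d * (r * r') + 4 * (r * r') * (r + r')
    - 4 * g * (r * r') ^+ 2) / (r * r') ^+ 2.
Proof. by move=> r0 r'0; rewrite /biquad; field; rewrite r0 r'0. Qed.

Lemma cubic_inv (r : F) : r != 0 ->
  cubic d r^-1 = (1 - (r + 2 * d * r ^+ 2 + r ^+ 3)) / r ^+ 3.
Proof. by move=> r0; rewrite /cubic; field. Qed.

End InverseCoordinate.

(** * Multiples of the point at the prime 2 *)

Section TwoAdic.
Variables (F : realFieldType) (v : nonarch F).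
Hypotheses (v2 : v 2 = 2^-1) (v_odd : forall i, odd i -> v i%:R = 1).
Hypothesis v_residue : forall t, v t = 1 -> v (t - 1) < 1.
Variables (g d : F).
Hypothesis gd : g = 1 - d ^+ 2.
Local Notation e := (eseq g d).
Local Notation W := (wseq g d).

Let v4 : v 4 = 4^-1.
Proof. by rewrite (_ : 4 = 2 * 2); [rewrite pabsM v2 invfM | ring]. Qed.

Let half_lt1 : 2^-1 < 1 :> F. Proof. by rewrite invf_lt1 ?ltr0n ?ltr1n. Qed.
Let quarter_lt1 : 4^-1 < 1 :> F. Proof. by rewrite invf_lt1 ?ltr0n ?ltr1n. Qed.

Variable rho : F.
Hypotheses (rho1 : rho <= 1) (rhod : v (2 * d) * rho ^+ 2 < 1) (rhog : v (4 * g) * rho ^+ 4 < 1).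

Lemma two_adic_biquad_unit r r' : v r <= rho -> v r' <= rho ->
  v (1 + 4 * d * (r * r') + 4 * (r * r') * (r + r') - 4 * g * (r * r') ^+ 2) = 1.
Proof.
move=> hr hr'; have r0 := pabs_ge0 v r; have r'0 := pabs_ge0 v r'.
have rr : v (r * r') <= rho ^+ 2 by rewrite expr2 pabsM_le.
have rr1 : v (r * r') <= 1 by rewrite pabsM_le1 ?(le_trans _ rho1).
rewrite -[X in v X]addrA -[X in v X]addrA pabsDl ?pabs1 //.
apply: pabsD_lt; [|apply: pabsB_lt].
- rewrite (_ : 4 * d = 2 * (2 * d)); last by ring.
  rewrite -mulrA pabsM v2; apply: le_lt_trans (_ : v (2 * d * (r * r')) < 1).
    by rewrite ler_piMl ?pabs_ge0 ?(ltW half_lt1).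
  apply: le_lt_trans rhod; rewrite pabsM ler_wpM2l ?pabs_ge0 //.
- apply: le_lt_trans quarter_lt1; rewrite -mulrA pabsM v4 ler_piMr ?invr_ge0 ?ler0n //.
  by rewrite pabsM_le1 // pabsD_le // (le_trans _ rho1).
- rewrite pabsM; apply: le_lt_trans rhog; rewrite ler_wpM2l ?pabs_ge0 //.
  by rewrite pabsX (_ : rho ^+ 4 = (rho ^+ 2) ^+ 2) ?lerXn2r ?nnegrE ?pabs_ge0 ?sqr_ge0 -?exprM.
Qed.

Lemma two_adic_cubic_unit r : v r <= rho ->
  v (1 - (r + 2 * d * r ^+ 2 + r ^+ 3)) = 1.
Proof.
move=> hr; have r0 := pabs_ge0 v r; have r1 := le_trans hr rho1.
rewrite pabsBl ?pabs1 // (_ : r + 2 * d * r ^+ 2 + r ^+ 3 =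
   2 * d * r ^+ 2 + r * (1 + r ^+ 2)); last by ring.
apply: pabsD_lt.
  rewrite pabsM pabsX; apply: le_lt_trans rhod.
  by rewrite ler_wpM2l ?pabs_ge0 // lerXn2r ?nnegrE ?(le_trans r0).
have [r2|r2] := ltP (v r) 1.
  rewrite pabsM; apply: le_lt_trans r2; rewrite ler_piMr //.
  by rewrite pabsD_le ?pabs1 // pabsX_le1.
(* A unit r can occur when rho = 1. Then r + r^3 is still small, because 1 + r^2 = 2 r + (r - 1)^2
   and units are 1 modulo 2. *)
have re : v r = 1 by apply/eqP; rewrite eq_le r1 r2.
rewrite pabsM re mul1r (_ : 1 + r ^+ 2 = 2 * r + (r - 1) ^+ 2); last by ring.
apply: pabsD_lt; first by rewrite pabsM re v2 mulr1.
by rewrite pabsX exprn_ilt1 ?pabs_ge0 // v_residue.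
Qed.

(** A formal group parameter z with z^2 close to 1/e satisfies z(i N) ~ i z(N), whence |1/e(i N)| =
    rho |i|^2. Written as a product equal to 1, the law includes that e(i N) is nonzero. *)
Definition two_adic_law N i := v (e (i * N)) * (rho * v i%:R ^+ 2) = 1.

Lemma two_adic_law_neq0 N i : two_adic_law N i -> e (i * N) != 0.
Proof. by rewrite /two_adic_law; apply: contra_eq_neq => ->; rewrite pabs0 mul0r eq_sym oner_eq0. Qed.

Lemma two_adic_law_inv N i : two_adic_law N i -> v ((e (i * N))^-1) = rho * v i%:R ^+ 2.
Proof.
move=> h; have e0 := two_adic_law_neq0 h; rewrite pabsV.
by apply: (mulfI (_ : v (e (i * N)) != 0)); rewrite ?pabs_eq0 // h divff ?pabs_eq0.
Qed.

Lemma two_adic_law_inv_le N i : 0 <= rho -> two_adic_law N i -> v ((e (i * N))^-1) <= rho.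
Proof.
move=> r0 h; rewrite (two_adic_law_inv h) ler_piMr // exprn_ile1 ?pabs_ge0 //.
exact: pabs_nat_le1.
Qed.

Lemma v_even i : ~~ odd i -> v i%:R <= 2^-1.
Proof.
move=> oi; have -> : i = (2 * i./2)%N by nat_lia.
by rewrite natrM pabsM v2 ler_piMr ?invr_ge0 ?ler0n ?pabs_nat_le1.
Qed.

(** Exactly one of j and j + 1 is odd, and the inverse at that index has the strictly larger size
    rho. *)
Lemma two_adic_diff N j : 0 < rho -> two_adic_law N j -> two_adic_law N j.+1 ->
  v ((e (j.+1 * N))^-1 - (e (j * N))^-1) = rho.
Proof.
move=> r0 h1 h2; have [oj|oj] := boolP (odd j).
  have E1 := two_adic_law_inv h1; rewrite v_odd // expr1n mulr1 in E1.
  rewrite -pabsN opprB pabsBl // E1 (two_adic_law_inv h2) -[X in _ < X]mulr1 ltr_pM2l //.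
  by rewrite exprn_ilt1 ?pabs_ge0 // (le_lt_trans (v_even _)) //= ?oj ?half_lt1.
have E2 := two_adic_law_inv h2; rewrite v_odd // expr1n mulr1 in E2.
rewrite pabsBl // E2 (two_adic_law_inv h1) -[X in _ < X]mulr1 ltr_pM2l //.
by rewrite exprn_ilt1 ?pabs_ge0 // (le_lt_trans (v_even _)) ?half_lt1.
Qed.

Variable N : nat.
Hypotheses (g0 : g != 0) (N23 : (N == 2) || (N == 3)).
Let N_gt1 : (1 < N)%N. Proof. by case/orP: N23 => /eqP->. Qed.
Let N0 : (0 < N)%N. Proof. exact: ltnW N_gt1. Qed.
Hypothesis rhoE : v (e N) * rho = 1.
Hypothesis rhog1 : N = 3 -> v g * rho < 1.

Let rho_gt0 : 0 < rho.
Proof.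
rewrite lt_neqAle; apply/andP; split.
  by apply/eqP=> r0; move: rhoE; rewrite -r0 mulr0 => /eqP; rewrite eq_sym oner_eq0.
have : 0 < v (e N) * rho by rewrite rhoE.
by rewrite ltNge => h; rewrite leNgt; apply: contra h => h; rewrite mulr_ge0_le0 ?pabs_ge0 // ltW.
Qed.

Definition two_adic_upto K := wnz g d K /\ forall i, (0 < i)%N -> (i * N < K)%N -> two_adic_law N i.

(** In r = 1/e(i N) duplication reads 4 e(2 i N) c r = u with units c and u; the factor 4 accounts
    for |2|^2. *)
Lemma two_adic_double K i : wnz g d K -> (0 < i)%N -> (2 * (i * N) <= K)%N ->
  two_adic_law N i -> two_adic_law N (2 * i).
Proof.
move=> nz i0 iK h; have e0 := two_adic_law_neq0 h.
have iN : (1 < i * N)%N by rewrite (leq_trans N_gt1) ?leq_pmull.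
have D := eseq_dup gd nz iN iK; rewrite -[e (i * N)]invrK in D.
move: D; rewrite biquad_inv ?invr_eq0 // cubic_inv ?invr_eq0 //.
have rle := two_adic_law_inv_le (ltW rho_gt0) h.
set r := (e (i * N))^-1 in rle *; have r0 : r != 0 by rewrite invr_eq0.
have U := two_adic_biquad_unit rle rle; have C := two_adic_cubic_unit rle.
move: U C; set u := 1 + _ + _ - _; set c := 1 - _ => U C D.
have E : 4 * e (2 * (i * N)) * c * r = u.
  apply: (mulIf (_ : (r ^+ 4)^-1 != 0)); first by rewrite invr_eq0 expf_neq0.
  transitivity (e (2 * (i * N)) * (4 * (c / r ^+ 3))); first by field.
  by rewrite D; field.
have Er : v r = rho * v i%:R ^+ 2 := two_adic_law_inv h.
have {}E := congr1 v E; move: E; rewrite pabsM pabsM pabsM v4 C U mulr1 Er => E.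
rewrite /two_adic_law -mulnA natrM pabsM v2 -[RHS]E.
by field.
Qed.

(** Adding j N and (j + 1) N, whose difference is N, makes e((2 j + 1) N) e(N) (r' - r)^2 a unit,
    while |r' - r| = rho = 1 / |e(N)|. *)
Lemma two_adic_odd K j : wnz g d K -> (0 < j)%N -> ((2 * j + 1) * N <= K)%N ->
  two_adic_law N 1 -> two_adic_law N j -> two_adic_law N j.+1 -> two_adic_law N (2 * j + 1).
Proof.
move=> nz j0 jK h1 hj hj1.
have jN : (0 < j * N)%N by rewrite muln_gt0 j0.
have jNK : (2 * (j * N) + N <= K)%N by rewrite mulnA -mulSnr -addn1.
have D := eseq_sym_prod nz jN N0 jNK.
rewrite -mulSnr mulnA -mulSnr -[(2 * j).+1]addn1 in D.
have ej := two_adic_law_neq0 hj; have ej1 := two_adic_law_neq0 hj1.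
have rj := two_adic_law_inv_le (ltW rho_gt0) hj.
have rj1 := two_adic_law_inv_le (ltW rho_gt0) hj1.
have U := two_adic_biquad_unit rj1 rj; have Df := two_adic_diff rho_gt0 hj hj1.
rewrite -[e (j.+1 * N)]invrK -[e (j * N)]invrK in D.
move: D; rewrite biquad_inv ?invr_eq0 //.
move: U Df; set r := (e (j * N))^-1; set r' := (e (j.+1 * N))^-1; set u := 1 + _ + _ - _.
move=> U Df D; have r0 : r != 0 by rewrite invr_eq0.
have r'0 : r' != 0 by rewrite invr_eq0.
have E : e ((2 * j + 1) * N) * e N * (r' - r) ^+ 2 = u.
  apply: (mulIf (_ : ((r' * r) ^+ 2)^-1 != 0)); first by rewrite invr_eq0 expf_neq0 // mulf_neq0.
  by rewrite -D; field; rewrite r0.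
have {}E := congr1 v E; move: E; rewrite pabsM pabsM pabsX Df U => E.
rewrite /two_adic_law v_odd; last by rewrite oddD oddM.
by rewrite expr1n mulr1 -[RHS]E -[LHS]mulr1 -{1}rhoE; ring.
Qed.

(** The identities up to K presuppose nonvanishing of W up to K, and that of W (K + 1) comes from
    the size law, so the two advance together. *)
Lemma two_adic_step K : (N < K)%N -> (3 < K)%N || (N == 2) -> two_adic_upto K -> two_adic_upto K.+1.
Proof.
move=> NK K3 [nz law].
have h1 : two_adic_law N 1 by apply: law; rewrite ?mul1n.
have lawK i : (0 < i)%N -> (i * N <= K)%N -> two_adic_law N i.
  move=> i0; rewrite leq_eqVlt => /orP[/eqP EK|]; last exact: law.
  have i1 : (1 < i)%N by case: i i0 EK => [|[|i]] //; nat_lia.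
  have lawi j : (0 < j < i)%N -> two_adic_law N j.
    by case/andP=> j0 ji; apply: law => //; rewrite -EK ltn_mul2r N0.
  have [oi|ei] := boolP (odd i).
    have [j Ej] : exists j, i = (2 * j + 1)%N by exists i./2; nat_lia.
    rewrite Ej; apply: (two_adic_odd nz) => //; rewrite -?Ej ?EK //; try nat_lia.
      by apply: lawi; nat_lia.
    by apply: lawi; nat_lia.
  have [j Ej] : exists j, i = (2 * j)%N by exists i./2; nat_lia.
  rewrite Ej; apply: (two_adic_double nz); first by nat_lia.
    by rewrite mulnA -Ej EK.
  by apply: lawi; nat_lia.
split; last first.
  by move=> i i0; rewrite ltnS; apply: lawK.
move=> k /andP[k0]; rewrite leq_eqVlt => /orP[/eqP -> {k k0}|kK]; last by apply: nz; rewrite k0.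
have Kgt : (2 < K)%N by case/orP: N23 NK => /eqP->; nat_lia.
have [k EK] : exists k, K = k.+2 by exists K.-2; nat_lia.
(* In the first case W (K + 1) vanishes only with e(i N). In the second, halving i N leaves either a
   difference of inverses of size rho or a unit value of the cubic. In the third, the law with n = 2
   leaves e(3 i) - e_2, nonzero because e_2 = g and |g| rho < 1. *)
have [i cases] : exists i, [\/ K = (i * N)%N, K.+1 = (i * N)%N | K = (i * N + 1)%N /\ N = 3].
  case/orP: N23 => /eqP EN; rewrite EN.
    by case: (boolP (odd K)) => oK; exists (uphalf K); [constructor 2 | constructor 1]; nat_lia.
  have [r0|[r1|r2]] : (K %% 3 = 0 \/ K %% 3 = 1 \/ K %% 3 = 2)%N by nat_lia.
  - by exists (K %/ 3)%N; constructor 1; nat_lia.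
  - by exists (K %/ 3)%N; constructor 3; split=> //; nat_lia.
  - by exists (K %/ 3).+1; constructor 2; nat_lia.
case: cases => [Ei|Ei|[Ei N3]].
- rewrite EK wseqS !mulf_neq0 ?expf_neq0 ?invr_eq0 ?nz //; try nat_lia.
  by rewrite -EK Ei; apply: two_adic_law_neq0; apply: lawK; nat_nia.
- have i1 : (1 < i)%N by case: i Ei => [|[|i]] //; nat_lia.
  have [oi|ei] := boolP (odd i).
    have [j Ej] : exists j, i = (2 * j + 1)%N by exists i./2; nat_lia.
    have j0 : (0 < j)%N by nat_lia.
    have lj : two_adic_law N j by apply: law; nat_nia.
    have lj1 : two_adic_law N j.+1 by apply: law; nat_nia.
    have := @wseq_law _ g d K (j * N) N nz ltac:(rewrite muln_gt0 j0 N0; done) N0 ltac:(nat_nia).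
    rewrite (_ : 2 * (j * N) + N = K.+1)%N; last by nat_nia.
    rewrite (_ : j * N + N = j.+1 * N)%N; last by nat_lia.
    move=> L; suff : W K.+1 * W N != 0 by rewrite mulf_eq0 => /norP[].
    rewrite L !mulf_neq0 ?expf_neq0 ?nz //; try nat_nia.
    apply/eqP=> /eqP; rewrite subr_eq0 => /eqP E.
    have := two_adic_diff rho_gt0 lj lj1; rewrite E subrr pabs0 => z.
    by move: rho_gt0; rewrite -z ltxx.
  have [j Ej] : exists j, i = (2 * j)%N by exists i./2; nat_lia.
  have j0 : (0 < j)%N by nat_lia.
  have [n En] : exists n, (j * N = n.+2)%N by exists (j * N).-2; case/orP: N23 => /eqP->; nat_lia.
  have lj : two_adic_law N j by apply: law; nat_nia.
  have -> : (K.+1 = 2 * n.+2)%N by nat_nia.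
  have L := @wseq_even _ g d K n nz ltac:(nat_nia).
  have G := @eseq_gap _ g d gd K n nz ltac:(nat_nia).
  suff : W (2 * n.+2) * 2 != 0 by rewrite mulf_eq0 => /norP[].
  rewrite L !mulf_neq0 ?expf_neq0 ?nz //; try nat_nia.
  apply/eqP=> E; move: G; rewrite E mulr0 expr0n => /esym/eqP.
  rewrite mulf_eq0 oppr_eq0 pnatr_eq0 /= -En -[e (j * N)]invrK cubic_inv ?invr_eq0 ?two_adic_law_neq0 //.
  have U := two_adic_cubic_unit (two_adic_law_inv_le (ltW rho_gt0) lj).
  rewrite mulf_eq0 -(pabs_eq0 v) U oner_eq0 /= invr_eq0 expf_eq0 /=.
  by rewrite invr_eq0 (negPf (two_adic_law_neq0 lj)).
- have i0 : (0 < i)%N by nat_lia.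
  have [s Es] : exists s, (i * N = s.+3)%N by exists (i * N - 3)%N; nat_nia.
  have L := @wseq_law _ g d K 2 s.+1 nz isT isT ltac:(nat_lia).
  suff : W K.+1 * W s.+1 != 0 by rewrite mulf_eq0 => /norP[].
  rewrite (_ : K.+1 = 2 * 2 + s.+1)%N; last by nat_lia.
  rewrite L (_ : 2 + s.+1 = i * N)%N; last by nat_lia.
  rewrite !mulf_neq0 ?expf_neq0 ?nz //; try nat_lia.
  have li : two_adic_law N i by apply: law; nat_lia.
  rewrite subr_eq0; apply/eqP=> E; have := two_adic_law_inv_le (ltW rho_gt0) li.
  have g1 : 0 < v g by apply: pabs_gt0.
  rewrite E eseq2 pabsV leNgt => /negP; apply.
  by rewrite -div1r ltr_pdivlMr // mulrC rhog1.
Qed.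

Lemma two_adic_all : e N != 0 -> forall K, wnz g d K.
Proof.
move=> eN0; have base : two_adic_upto N.+1.
  split; last first.
    move=> i i0 iN; have -> : i = 1%N by case: i i0 iN => [|[|i]] // _; nat_nia.
    by rewrite /two_adic_law mul1n pabs1 expr1n mulr1.
  have w3 : W 3 != 0 by rewrite wseqS eseq2 wseq1 divr1 wseq2 mulf_neq0 // expf_neq0 // pnatr_eq0.
  have w2 : W 2 != 0 by rewrite wseq2 pnatr_eq0.
  move=> k; case/orP: N23 => /eqP EN; rewrite EN; case: k => [|[|[|[|[|k]]]]] // _.
  - by rewrite wseq1 oner_eq0.
  - by rewrite wseq1 oner_eq0.
  - have e3 : e 3 != 0 by rewrite EN in eN0.
    rewrite wseqS; apply: mulf_neq0; last by rewrite invr_eq0.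
    by apply: mulf_neq0 => //; apply: expf_neq0.
have up K : (N < K)%N -> two_adic_upto K.
  elim: K => // K IH; rewrite ltnS leq_eqVlt => /orP[/eqP <- //|NK].
  apply: two_adic_step => //; last exact: IH.
  by case/orP: N23 NK => /eqP->; rewrite ?orbT // => ->.
move=> K; apply: (@wnzW _ _ _ (K + N.+1)); first exact: leq_addr.
by have [] := up (K + N.+1)%N ltac:(nat_lia).
Qed.

Lemma two_adic_law_all : e N != 0 -> forall i, (0 < i)%N -> two_adic_law N i.
Proof.
move=> eN0; have nz := two_adic_all eN0.
have h1 : two_adic_law N 1 by rewrite /two_adic_law mul1n pabs1 expr1n mulr1.
move=> i; have [m] := ubnP i; elim: m i => // m IH i im i0.
case: (ltnP 1 i) => i1; last by have -> : i = 1%N by nat_lia.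
have [oi|ei] := boolP (odd i).
  have [j Ej] : exists j, i = (2 * j + 1)%N by exists i./2; nat_lia.
  by rewrite Ej; apply: (two_adic_odd (nz _)) => //; try nat_lia; apply: IH; nat_lia.
have [j Ej] : exists j, i = (2 * j)%N by exists i./2; nat_lia.
by rewrite Ej; apply: (two_adic_double (nz _)); [nat_lia | | apply: IH; nat_lia].
Qed.

End TwoAdic.

(** * Multiples of a point of infinite order near the origin *)

Section InfiniteOrder.
Variables (F : realFieldType) (g d : F).
Hypothesis gd : g = 1 - d ^+ 2.
Local Notation e := (eseq g d).
Local Notation biquad := (biquad g d).
Hypothesis nz : forall K, wnz g d K.

Lemma e_neq0 k : (1 < k)%N -> e k != 0.
Proof. by move=> k1; apply: (eseq_neq0 (@nz k.+1)); rewrite k1 /=. Qed.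

Lemma e_inj m n : (0 < m)%N -> (0 < n)%N -> e m = e n -> m = n.
Proof.
have lt a b : (0 < a)%N -> (a < b)%N -> e b != e a.
  move=> a0 ab; have -> : b = (a + (b - a))%N by nat_lia.
  by apply: (eseq_inj_lt (@nz (2 * a + (b - a)))) => //; nat_lia.
move=> m0 n0 E; case: (ltngtP m n) => // mn.
  by have := lt _ _ m0 mn; rewrite E eqxx.
by have := lt _ _ n0 mn; rewrite E eqxx.
Qed.

Lemma e_biquad k : (0 < k)%N -> biquad (e k) (e k.+1) = 0.
Proof. by move=> k0; apply: (biquad_eseq (@nz k.+1)); rewrite k0 /=. Qed.

Lemma e_prod k : (1 < k)%N -> e k ^+ 2 * (e k.+1 * e k.-1) = 4 * (e k - g).
Proof. by case: k => [|[|k]] // _; apply: (eseq_prod (@nz k.+3)). Qed.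

Lemma e_sym_prod m n : (0 < n)%N -> (n < m)%N ->
  e (m + n) * e (m - n) * (e m - e n) ^+ 2 = biquad (e m) (e n).
Proof.
move=> n0 nm; have := @eseq_sym_prod _ g d (m + n) n (m - n) (@nz _) n0.
rewrite (_ : 2 * n + (m - n) = m + n)%N; last by nat_lia.
by rewrite (_ : n + (m - n) = m)%N; [apply; nat_lia | nat_lia].
Qed.

Lemma e_dup n : (1 < n)%N -> e (2 * n) * (4 * cubic d (e n)) = biquad (e n) (e n).
Proof. by move=> n1; apply: (eseq_dup gd (@nz (2 * n))). Qed.

Lemma e_odd_dup k (P := e k.+1 * e k) (S := e k.+1 + e k) : (1 < k)%N ->
  e (2 * k + 1) * (e k.+1 - e k) ^+ 2 =
    - (P * (P + 2 * d) ^+ 2 + 2 * (P + 2 * d) * S + 4).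
Proof. by rewrite /P /S; case: k {P S} => [|[|k]] // _; apply: (eseq_odd_dup (@nz (2 * k.+2 + 1))). Qed.

Section Valued.
Variable v : nonarch F.

Section SmallMultiples.
Variable N : nat.
Hypothesis N1 : (1 < N)%N.
Local Notation r i := (e (i * N))^-1.
Local Notation rho := (v (e N)^-1).
Hypotheses (rho1 : rho < 1) (rhod : v d * rho ^+ 2 < 1) (rhog : v g * rho ^+ 4 < 1).

Let N0 : (0 < N)%N. Proof. exact: ltnW. Qed.
Let eN0 : e N != 0. Proof. exact: e_neq0. Qed.
Let r0 i : (0 < i)%N -> r i != 0.
Proof. by move=> i0; rewrite invr_eq0 e_neq0 // (leq_trans N1) ?leq_pmull. Qed.
Let rho_gt0 : 0 < rho. Proof. by rewrite pabs_gt0 ?invr_eq0. Qed.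

Let cst_biquad (x y : F) := 4 * d * (x * y) + 4 * (x * y) * (x + y) - 4 * g * (x * y) ^+ 2.
Let cst_cubic (x : F) := x + 2 * d * x ^+ 2 + x ^+ 3.

Lemma inv_dup i : (0 < i)%N ->
  r (2 * i) * (1 + cst_biquad (r i) (r i)) = 4 * r i * (1 - cst_cubic (r i)).
Proof.
move=> i0; have x0 := r0 i0; have y0 : r (2 * i) != 0 by rewrite r0 ?muln_gt0.
have iN : (1 < i * N)%N by rewrite (leq_trans N1) ?leq_pmull.
have E := e_dup iN; rewrite mulnA -[e (i * N)]invrK -[e (2 * i * N)]invrK in E.
move: E; rewrite biquad_inv // cubic_inv //.
move: (r i) (r (2 * i)) x0 y0 => x y x0 y0 E.
rewrite /cst_biquad /cst_cubic.
transitivity (y * x ^+ 4 * ((1 + 4 * d * (x * x) + 4 * (x * x) * (x + x) - 4 * g * (x * x) ^+ 2) / (x * x) ^+ 2)).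
  by field.
by rewrite -E; field; rewrite x0 y0.
Qed.

Lemma inv_odd i : (0 < i)%N ->
  r (2 * i + 1) * (1 + cst_biquad (r i.+1) (r i)) = (r i.+1 - r i) ^+ 2 / (e N)^-1.
Proof.
move=> i0; have x0 := r0 i0; have y0 : r i.+1 != 0 by rewrite r0.
have z0 : r (2 * i + 1) != 0 by rewrite r0 ?addn1.
have iN : (0 < i * N)%N by rewrite muln_gt0 i0.
have iN1 : (i * N < i.+1 * N)%N by rewrite ltn_mul2r N0 ltnSn.
have E := e_sym_prod iN iN1.
rewrite -mulnDl (_ : i.+1 + i = 2 * i + 1)%N in E; last by nat_lia.
rewrite (_ : i.+1 * N - i * N = N)%N in E; last by rewrite mulSnr addKn.
rewrite -[e (i * N)]invrK -[e (i.+1 * N)]invrK -[e ((2 * i + 1) * N)]invrK -[e N]invrK in E.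
have w0 : (e N)^-1 != 0 by rewrite invr_eq0.
move: E; rewrite biquad_inv //.
move: (r i) (r i.+1) (r (2 * i + 1)) ((e N)^-1) x0 y0 z0 w0 => x y z w x0 y0 z0 w0 E.
rewrite /cst_biquad.
transitivity (z * (y * x) ^+ 2 * ((1 + 4 * d * (y * x) + 4 * (y * x) * (y + x) -
  4 * g * (y * x) ^+ 2) / (y * x) ^+ 2)); first by field; rewrite x0 y0.
by rewrite -E; field; rewrite x0 y0 z0 w0.
Qed.

Let v4 : v 4 <= 1. Proof. exact: pabs_nat_le1. Qed.
Let v2 : v 2 <= 1. Proof. exact: pabs_nat_le1. Qed.

Lemma cst_biquad_lt1 (x y : F) : v x <= rho -> v y <= rho -> v (cst_biquad x y) < 1.
Proof.
move=> hx hy; have xy : v (x * y) <= rho ^+ 2 by rewrite expr2 pabsM_le.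
have xy1 : v (x * y) < 1 by apply: le_lt_trans xy _; rewrite exprn_ilt1 ?pabs_ge0.
have le4 z : v z < 1 -> v (4 * z) < 1.
  by move=> z1; rewrite pabsM; apply: le_lt_trans z1; rewrite ler_piMl ?pabs_ge0.
rewrite /cst_biquad -!mulrA; apply: pabsB_lt; first apply: pabsD_lt; apply: le4.
- rewrite pabsM; apply: le_lt_trans rhod; rewrite ler_wpM2l ?pabs_ge0 //.
- rewrite mulrA pabsM; apply: le_lt_trans xy1; rewrite ler_piMr ?pabs_ge0 //.
  by rewrite pabsD_le // (le_trans _ (ltW rho1)).
- rewrite pabsM; apply: le_lt_trans rhog; rewrite ler_wpM2l ?pabs_ge0 // pabsX.
  by rewrite (_ : rho ^+ 4 = (rho ^+ 2) ^+ 2) ?lerXn2r ?nnegrE ?pabs_ge0 ?sqr_ge0 // -exprM.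
Qed.

Lemma cst_cubic_lt1 (x : F) : v x <= rho -> v (cst_cubic x) < 1.
Proof.
move=> hx; have x1 := le_lt_trans hx rho1; rewrite /cst_cubic.
apply: pabsD_lt; first apply: pabsD_lt => //.
  rewrite -mulrA pabsM pabsM pabsX; apply: le_lt_trans rhod.
  apply: le_trans (_ : v d * v x ^+ 2 <= _).
    by rewrite ler_piMl ?mulr_ge0 ?exprn_ge0 ?pabs_ge0.
  by rewrite ler_wpM2l ?pabs_ge0 // lerXn2r ?nnegrE ?pabs_ge0.
by rewrite pabsX exprn_ilt1 ?pabs_ge0.
Qed.

Lemma pabs_1D (x : F) : v x < 1 -> v (1 + x) = 1.
Proof. by move=> x1; rewrite pabsDl pabs1. Qed.

(** Being close to the origin is stable under addition: duplication multiplies r by 4 and units, and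
    the odd formula gives a size at most rho^2 / rho. *)
Lemma small_multiples i : (0 < i)%N -> v (r i) <= rho.
Proof.
have [m] := ubnP i; elim: m i => // m IH i im i0.
case: (ltnP 1 i) => i1; last by (have -> : i = 1%N by nat_lia); rewrite mul1n.
have [oi|ei] := boolP (odd i).
  have [j Ej] : exists j, i = (2 * j + 1)%N by exists i./2; nat_lia.
  have j0 : (0 < j)%N by nat_lia.
  have hj := IH j ltac:(nat_lia) j0; have hj1 := IH j.+1 ltac:(nat_lia) isT.
  have := congr1 v (inv_odd j0); rewrite -Ej pabsM pabs_1D ?cst_biquad_lt1 // mulr1 => ->.
  rewrite pabsM pabsX pabsV ler_pdivrMr // -expr2 lerXn2r ?nnegrE ?pabs_ge0 //.
  by rewrite pabsB_le.
have [j Ej] : exists j, i = (2 * j)%N by exists i./2; nat_lia.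
have j0 : (0 < j)%N by nat_lia.
have hj := IH j ltac:(nat_lia) j0.
have := congr1 v (inv_dup j0); rewrite -Ej pabsM pabs_1D ?cst_biquad_lt1 // mulr1 => ->.
rewrite pabsM [v (1 - _)]pabs_1D ?pabsN ?cst_cubic_lt1 // mulr1 pabsM.
by apply: le_trans hj; rewrite ler_piMl ?pabs_ge0.
Qed.

(* The formal group law: [z (m N) = m z (N) + ...] for a parameter [z] with [z ^ 2 ~ r]. *)
Lemma multiples_ratio m : v d <= 1 -> v g <= 1 -> (0 < m)%N ->
  v (r m * e N - m%:R ^+ 2) <= rho.
Proof.
move=> d1 g1.
have B (x y : F) : v x <= rho -> v y <= rho -> v (cst_biquad x y) <= rho.
  move=> hx hy; have x1 := le_trans hx (ltW rho1); have y1 := le_trans hy (ltW rho1).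
  have le4 z : v z <= rho -> v (4 * z) <= rho.
    by move=> z1; rewrite pabsM; apply: le_trans z1; rewrite ler_piMl ?pabs_ge0.
  have xy : v (x * y) <= rho by rewrite pabsM; apply: le_trans hy; rewrite ler_piMl ?pabs_ge0.
  rewrite /cst_biquad -!mulrA; apply: pabsB_le; first apply: pabsD_le; apply: le4.
  - by rewrite pabsM; apply: le_trans xy; rewrite ler_piMl ?pabs_ge0.
  - by rewrite mulrA pabsM; apply: le_trans xy; rewrite ler_piMr ?pabs_ge0 ?pabsD_le.
  - rewrite pabsM pabsX; apply: le_trans xy; rewrite -[X in _ <= X]mul1r ler_pM ?exprn_ge0 ?pabs_ge0 //.
    by rewrite expr2 ler_piMl ?pabs_ge0 // pabsM mulr_ile1 ?pabs_ge0.
have C (x : F) : v x <= rho -> v (cst_cubic x) <= rho.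
  move=> hx; have x1 := le_trans hx (ltW rho1); rewrite /cst_cubic.
  have x2 : v (x ^+ 2) <= v x by rewrite pabsX expr2 ler_piMl ?pabs_ge0.
  apply: pabsD_le; first apply: pabsD_le => //; apply: le_trans hx; apply: le_trans x2.
    by rewrite pabsM ler_piMl ?pabs_ge0 // pabsM_le1.
  by rewrite !pabsX ler_wiXn2l ?pabs_ge0.
have s1 i : (0 < i)%N -> v (r i * e N) <= 1.
  move=> i0; rewrite pabsM; have -> : v (e N) = rho^-1 by rewrite pabsV invrK.
  rewrite ler_pdivrMr ?mul1r //.
  exact: small_multiples.
have [n] := ubnP m; elim: n m => // n IH m mn m0.
case: (ltnP 1 m) => m1; last first.
  by (have -> : m = 1%N by nat_lia); rewrite mul1n mulVf // expr1n subrr pabs0 ltW.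
have [om|em] := boolP (odd m).
  have [j Ej] : exists j, m = (2 * j + 1)%N by exists m./2; nat_lia.
  have j0 : (0 < j)%N by nat_lia.
  have hj := IH j ltac:(nat_lia) j0; have hj1 := IH j.+1 ltac:(nat_lia) isT.
  have E := inv_odd j0; rewrite -Ej in E.
  set s := r m * e N; set a := r j * e N in hj; set b := r j.+1 * e N in hj1.
  have Es : s + s * cst_biquad (r j.+1) (r j) = (b - a) ^+ 2.
    rewrite -[X in X + _]mulr1 -mulrDr /s mulrAC E /a /b.
    by move: (r j) (r j.+1) (e N) eN0 => x y w w0; field.
  have -> : s - m%:R ^+ 2 = - (s * cst_biquad (r j.+1) (r j)) +
    ((b - j.+1%:R ^+ 2) - (a - j%:R ^+ 2)) * (b - a + (2 * j + 1)%:R).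
    have Es' : s = (b - a) ^+ 2 - s * cst_biquad (r j.+1) (r j) by rewrite -Es addrK.
    by rewrite {1}Es' Ej natrD natrM -[j.+1]addn1 natrD; ring.
  apply: pabsD_le; rewrite ?pabsN pabsM.
    rewrite -[X in _ <= X]mul1r ler_pM ?pabs_ge0 ?s1 // B //; apply: small_multiples => //.
  rewrite -[X in _ <= X]mulr1 ler_pM ?pabs_ge0 //; first exact: pabsB_le.
  by rewrite pabsD_le ?pabs_nat_le1 // pabsB_le ?s1.
have [j Ej] : exists j, m = (2 * j)%N by exists m./2; nat_lia.
have j0 : (0 < j)%N by nat_lia.
have hj := IH j ltac:(nat_lia) j0.
have E := inv_dup j0; rewrite -Ej in E.
set s := r m * e N; set a := r j * e N in hj.
have Es : s + s * cst_biquad (r j) (r j) = 4 * a * (1 - cst_cubic (r j)).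
  by rewrite -[X in X + _]mulr1 -mulrDr /s mulrAC E /a; ring.
have -> : s - m%:R ^+ 2 = - (s * cst_biquad (r j) (r j)) +
   (4 * (a - j%:R ^+ 2) - 4 * a * cst_cubic (r j)).
  have Es' : s = 4 * a * (1 - cst_cubic (r j)) - s * cst_biquad (r j) (r j) by rewrite -Es addrK.
  by rewrite {1}Es' Ej natrM; ring.
have rj := small_multiples j0.
apply: pabsD_le; rewrite ?pabsN.
  by rewrite pabsM -[X in _ <= X]mul1r ler_pM ?pabs_ge0 ?s1 // B.
apply: pabsB_le; rewrite pabsM -[X in _ <= X]mul1r ler_pM ?pabs_ge0 //; last exact: C.
by rewrite pabsM_le1 ?s1.
Qed.

End SmallMultiples.
End Valued.
End InfiniteOrder.

(** * Multiples close to the origin *)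

Section Recurrence.
Variables (F : realFieldType) (g d : F).
Hypotheses (gd : g = 1 - d ^+ 2) (g0 : g != 0).
Local Notation e := (eseq g d).
Local Notation biquad := (biquad g d).
Hypothesis nz : forall K, wnz g d K.
Variable v : nonarch F.

Section Bounded.
Variable M : F.
Hypotheses (M1 : 1 <= M) (dM : v d <= M) (gM : v g <= M).

Let Mge0 : 0 <= M. Proof. exact: le_trans ler01 M1. Qed.
Let Mgt0 : 0 < M. Proof. exact: lt_le_trans ltr01 M1. Qed.

Let MX i j : (i <= j)%N -> M ^+ i <= M ^+ j.
Proof. exact: ler_weXn2l. Qed.

Let natM i k : v k%:R <= M ^+ i.
Proof. by apply: le_trans (pabs_nat_le1 _ _) _; rewrite exprn_ege1. Qed.

Let mulM i j x y : v x <= M ^+ i -> v y <= M ^+ j -> v (x * y) <= M ^+ (i + j).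
Proof. by move=> hx hy; rewrite exprD pabsM_le. Qed.

Let expM i x : v x <= M -> v (x ^+ i) <= M ^+ i.
Proof. by move=> hx; rewrite pabsX lerXn2r ?nnegrE ?pabs_ge0. Qed.

Let m1 x : v x <= M -> v x <= M ^+ 1. Proof. by rewrite expr1. Qed.

Let upM i j x : v x <= M ^+ i -> (i <= j)%N -> v x <= M ^+ j.
Proof. by move=> hx ij; apply: le_trans hx (MX ij). Qed.

Section Close.
Variables (N : nat).
Hypothesis N1 : (1 < N)%N.
Local Notation r := (e N)^-1.
Hypothesis rsmall : v r * M ^+ 12 < 1.

Let eN0 : e N != 0. Proof. exact: (e_neq0 nz). Qed.
Let r0 : r != 0. Proof. by rewrite invr_eq0. Qed.
Let rM i : (i <= 12)%N -> v r * M ^+ i < 1.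
Proof.
by move=> i12; apply: le_lt_trans rsmall; rewrite ler_wpM2l ?pabs_ge0 // MX.
Qed.
Let r1 : v r <= 1. Proof. by have := @rM 0 isT; rewrite expr0 mulr1 => /ltW. Qed.

(** When N P is close to the origin, (N + j) P and (N - j) P are close to j P and its opposite,
    which share their abscissa. The estimate is the addition formula divided by e_N^2. *)
Lemma sym_prod_close j : (0 < j)%N -> (j < N)%N -> v (e j) <= M ->
  v (e (N + j) * e (N - j) - e j ^+ 2) <= v r * M ^+ 4.
Proof.
move=> j0 jN xM; have E := e_sym_prod nz j0 jN.
move: (e (N + j) * e (N - j)) (e j) xM E => P x xM E.
have h1 : v (1 - x * r) = 1.
  rewrite pabsBl pabs1 // pabsM mulrC; apply: le_lt_trans (@rM 1 isT).
  by rewrite ler_wpM2l ?pabs_ge0.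
have {}E : (P - x ^+ 2) * (1 - x * r) ^+ 2 =
    r * (4 * d * x + 4 + 4 * x * r - 4 * g * r + 2 * x ^+ 3 - x ^+ 4 * r).
  move: E; rewrite /biquad; move: (e N) eN0 => w w0 E.
  transitivity ((P * (w - x) ^+ 2 - x ^+ 2 * (w - x) ^+ 2) / w ^+ 2); first by field.
  by rewrite E; field.
have := congr1 v E; rewrite pabsM pabsX h1 expr1n mulr1 => ->.
rewrite pabsM ler_wpM2l ?pabs_ge0 //.
have rr i x' : v x' <= M ^+ i -> v (x' * r) <= M ^+ i.
  by move=> h; rewrite pabsM -[X in _ <= X]mulr1 ler_pM ?pabs_ge0.
have h4 i : v 4 <= M ^+ i := natM i 4.
apply: pabsB_le; last exact/rr/expM.
apply: pabsD_le; last by apply: (@upM 3) => //; apply: (mulM (natM 0 2)); apply: expM.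
apply: pabsB_le; last by apply/rr/(@upM 1) => //; apply: (mulM (h4 0)).
apply: pabsD_le; last by apply/rr/(@upM 1) => //; apply: (mulM (h4 0)).
apply: pabsD_le => //; apply: (@upM 2) => //.
apply: (@mulM 1 1); last by rewrite expr1.
by apply: (mulM (h4 0)).
Qed.

Variable k : nat.
Hypotheses (k1 : (1 < k)%N) (kN : (k.+1 < N)%N).
Hypotheses (xM : v (e k) <= M) (xpM : v (e k.+1) <= M) (xmM : v (e k.-1) <= M).
Hypothesis giM : 1 <= v (16 * g) * M.

(** Let X, Y be e(N + k), e(N - k) and x = e_k. The product X Y is close to x^2, and multiplying the
    relations for e_(m+1) e_(m-1) at m = N + k and m = N - k brings X + Y close to 2 x. Thus X is a
    root of a quadratic close to (T - x)^2, which bounds only the square of X - x. *)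
Lemma eseq_close : v (e (N + k) - e k) ^+ 2 <= v r * M ^+ 12.
Proof.
have k0 : (0 < k)%N by nat_lia.
have C0 := @sym_prod_close k k0 ltac:(nat_lia) xM.
have Cp := @sym_prod_close k.+1 isT kN xpM.
have Cm := @sym_prod_close k.-1 ltac:(nat_lia) ltac:(nat_lia) xmM.
have E1 := @e_prod _ g d nz (N + k) ltac:(nat_lia).
have E2 := @e_prod _ g d nz (N - k) ltac:(nat_lia).
have E3 := e_prod nz k1.
rewrite (_ : (N + k).+1 = N + k.+1)%N in E1; last by nat_lia.
rewrite (_ : (N + k).-1 = N + k.-1)%N in E1; last by nat_lia.
rewrite (_ : (N - k).+1 = N - k.-1)%N in E2; last by nat_lia.
rewrite (_ : (N - k).-1 = N - k.+1)%N in E2; last by nat_lia.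
set eta := v r * M ^+ 4 in C0 Cp Cm.
have eta0 : 0 <= eta by rewrite mulr_ge0 ?pabs_ge0 ?exprn_ge0.
have eta1 : eta <= 1 by rewrite ltW // rM.
move: (e k) (e k.+1) (e k.-1) (e (N + k)) (e (N - k)) (e (N + k.+1)) (e (N - k.+1))
  (e (N + k.-1)) (e (N - k.-1)) xM xpM xmM C0 Cp Cm E1 E2 E3
  => x xp xm X Y Xp Ym Xm Yp hx hxp hxm C0 Cp Cm E1 E2 E3.
have P2 a P : v (P - a ^+ 2) <= eta -> v a <= M -> v P <= M ^+ 2.
  move=> h ha; rewrite -[P](subrK (a ^+ 2)) pabsD_le ?expM //.
  by apply: le_trans h (le_trans eta1 _); rewrite exprn_ege1.
have hP := P2 _ _ C0 hx; have hPp := P2 _ _ Cp hxp; have hPm := P2 _ _ Cm hxm.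
have mulE i a b : v a <= eta -> v b <= M ^+ i -> v (a * b) <= eta * M ^+ i.
  by move=> ha hb; rewrite pabsM_le.
have upE i j a : v a <= eta * M ^+ i -> (i <= j)%N -> v a <= eta * M ^+ j.
  by move=> h ij; apply: le_trans h _; rewrite ler_wpM2l // MX.
set S := X + Y - 2 * x.
have ES : 16 * g * S = 16 * (X * Y - x ^+ 2) -
   ((X * Y - x ^+ 2) * ((X * Y + x ^+ 2) * ((Xp * Ym) * (Xm * Yp)))
    + (Xp * Ym - xp ^+ 2) * (x ^+ 4 * (Xm * Yp)) + (Xm * Yp - xm ^+ 2) * (x ^+ 4 * xp ^+ 2)).
  have E12 : (X * Y) ^+ 2 * ((Xp * Ym) * (Xm * Yp)) = 16 * ((X - g) * (Y - g)).
    transitivity ((X ^+ 2 * (Xp * Xm)) * (Y ^+ 2 * (Yp * Ym))); first by ring.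
    by rewrite E1 E2; ring.
  have E33 : x ^+ 4 * (xp ^+ 2 * xm ^+ 2) = 16 * (x - g) ^+ 2.
    transitivity ((x ^+ 2 * (xp * xm)) ^+ 2); first by ring.
    by rewrite E3; ring.
  transitivity (16 * (X * Y - x ^+ 2) -
    ((X * Y) ^+ 2 * ((Xp * Ym) * (Xm * Yp)) - x ^+ 4 * (xp ^+ 2 * xm ^+ 2))); last by ring.
  by rewrite E12 E33 /S; ring.
have hES : v (16 * g * S) <= eta * M ^+ 6.
  rewrite ES; apply: pabsB_le.
    rewrite mulrC; apply: (@upE 0) => //; apply: mulE => //; exact: natM 0 16.
  apply: pabsD_le; first apply: pabsD_le; apply: mulE => //.
  - apply: (@mulM 2 4); first by apply: pabsD_le => //; apply: expM.
    exact: (@mulM 2 2).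
  - by apply: (@mulM 4 2) => //; apply: expM.
  - by apply: (@mulM 4 2); apply: expM.
have hS : v S <= eta * M ^+ 7.
  apply: le_trans (_ : v (16 * g * S) * M <= _).
    by rewrite pabsM mulrAC -[X in X <= _]mul1r ler_wpM2r ?pabs_ge0.
  by rewrite exprSr mulrA ler_wpM2r.
have hp : v ((X - x) * (Y - x)) <= eta * M ^+ 8.
  have -> : (X - x) * (Y - x) = (X * Y - x ^+ 2) - S * x by rewrite /S; ring.
  apply: pabsB_le; first by apply: (@upE 0) => //; rewrite expr0 mulr1.
  by rewrite exprSr mulrA pabsM_le.
have d8 : eta * M ^+ 8 = v r * M ^+ 12 by rewrite /eta -mulrA -exprD.
rewrite -d8; set dl := eta * M ^+ 8.
have dl1 : dl < 1 by rewrite /dl d8.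
have dl0 : 0 <= dl by rewrite mulr_ge0 ?exprn_ge0.
have hS' : v S <= dl by apply: (@upE 7).
have : v ((X - x) ^+ 2) <= Num.max (v (X - x) * dl) dl.
  have -> : (X - x) ^+ 2 = (X - x) * S - (X - x) * (Y - x) by rewrite /S; ring.
  apply: pabsB_le; rewrite le_max ?hp ?orbT //.
  by rewrite pabsM ler_wpM2l ?pabs_ge0.
rewrite le_max pabsX => /orP[|//] h.
have [u0|u0] := eqVneq (v (X - x)) 0; first by rewrite u0 expr0n.
have ugt : 0 < v (X - x) by rewrite lt_neqAle eq_sym u0 pabs_ge0.
have ud : v (X - x) <= dl by rewrite expr2 ler_pM2l in h.
apply: le_trans h _; rewrite -[X in _ <= X]mul1r ler_wpM2r //.
by apply: le_trans ud (ltW dl1).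
Qed.

End Close.

(** The discriminant of [cubic]; the curve is nonsingular when it is nonzero. *)
Definition cubic_disc := 32 * d ^+ 3 + 4 * d ^+ 2 - 36 * d - 31.

(* Two close values [e a], [e b] make [cubic] and its derivative nearly vanish together at
   [e b], by the duplication formula [4 c(x) x(2P) = c'(x) ^ 2 - 4 c(x) (2 x - 1)]. *)
Lemma bounded_gap (be : F) (a b : nat) : (1 < b)%N -> (b.+1 < a)%N ->
  0 < be -> be <= 1 -> be <= v g ^+ 2 -> be * M ^+ 2 <= v (4 * g) ->
  (forall k, (1 < k)%N -> (k <= a + b)%N -> v (e k) <= M) ->
  v (e a - e b) <= 1 -> v (4 * cubic_disc) ^+ 4 * be ^+ 2 <= v (e a - e b) * M ^+ 20.
Proof.
move=> b1 ba be0 be1 beg bem bd dl1.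
have dl0 := pabs_ge0 v (e a - e b).
have E1 := @e_sym_prod _ g d nz a b ltac:(nat_lia) ltac:(nat_lia).
have E2 := e_dup gd nz b1.
have E3 := @e_prod _ g d nz (2 * b) ltac:(nat_lia).
have h1 := bd a ltac:(nat_lia) ltac:(nat_lia).
have h2 := bd b ltac:(nat_lia) ltac:(nat_lia).
have h3 := bd (a + b)%N ltac:(nat_lia) ltac:(nat_lia).
have h4 := bd (a - b)%N ltac:(nat_lia) ltac:(nat_lia).
have h5 := bd (2 * b).+1 ltac:(nat_lia) ltac:(nat_lia).
have h6 := bd (2 * b).-1 ltac:(nat_lia) ltac:(nat_lia).
move: (e a) (e b) (e (a + b)) (e (a - b)) (e (2 * b)) (e (2 * b).+1) (e (2 * b).-1)
  dl1 dl0 E1 E2 E3 h1 h2 h3 h4 h5 h6 => x y s t z zp zm dl1 dl0 E1 E2 E3 hx hy hs ht hzp hzm.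
set dl := v (x - y) in dl0 dl1 *.
(* If |z| < |g|, the relation z^2 zp zm = 4 (z - g) and the bound M give |z|^2 >= |4 g| / M^2. *)
have hz : be <= v z ^+ 2.
  have [zg|gz] := ltP (v z) (v g); last first.
    by apply: le_trans beg _; rewrite lerXn2r ?nnegrE ?pabs_ge0.
  have zg' : v (4 * (z - g)) = v (4 * g) by rewrite pabsM pabsBC pabsBl // -pabsM.
  have E3' := congr1 v E3; rewrite zg' pabsM pabsX in E3'.
  have M2 : 0 < M ^+ 2 by rewrite exprn_gt0.
  rewrite -(ler_pM2r M2); apply: le_trans bem _; rewrite -E3'.
  by rewrite ler_wpM2l ?exprn_ge0 ?pabs_ge0 // expr2 pabsM_le.
(* By the addition formula biquad x y is s t (x - y)^2, and replacing x by y costs a multiple of x -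
   y. *)
have hQ : v (biquad y y) <= dl * M ^+ 3.
  have -> : biquad y y = s * t * (x - y) ^+ 2 -
     (x - y) * ((x + y) * y ^+ 2 + 4 * d * y + 4) by rewrite E1 /biquad; ring.
  apply: pabsB_le.
    rewrite expr2 mulrA mulrC [v _]pabsM ler_wpM2l // pabsM -[X in _ <= X]mulr1.
    by rewrite ler_pM ?pabs_ge0 // (@upM 2) //; apply: (@mulM 1 1); rewrite expr1.
  rewrite pabsM ler_wpM2l //; apply: pabsD_le; last exact: natM 3 4.
  apply: pabsD_le; last first.
    apply: (@upM 2) => //; apply: (@mulM 1 1); last exact: m1.
    exact: mulM (natM 0 4) (m1 dM).
  by apply: (@mulM 1 2); [rewrite expr1 pabsD_le | apply: expM].
set C := v (4 * cubic d y).
have C0 : 0 <= C by apply: pabs_ge0.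
have hC : C ^+ 2 * be <= dl * M ^+ 6.
  apply: le_trans (_ : v (biquad y y) ^+ 2 <= _).
    rewrite -E2 [v (z * _)]pabsM -/C exprMn mulrC ler_wpM2r ?exprn_ge0 //.
  apply: le_trans (_ : (dl * M ^+ 3) ^+ 2 <= _).
    by rewrite lerXn2r ?nnegrE ?pabs_ge0 // mulr_ge0 ?exprn_ge0.
  rewrite exprMn -exprM ler_wpM2r ?exprn_ge0 //.
  by rewrite expr2 ler_piMl.
pose cp := 3 * y ^+ 2 - 2 * y - 2 * d.
set D := v cp; have D0 : 0 <= D by apply: pabs_ge0.
have hD : D ^+ 4 * be <= dl * M ^+ 8.
  have h : D ^+ 2 <= Num.max (dl * M ^+ 3) (C * M).
    have e2 : cp ^+ 2 = biquad y y + 4 * cubic d y * (2 * y - 1).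
      by rewrite /cp /biquad /cubic gd; ring.
    rewrite -pabsX e2; apply: pabsD_le; rewrite le_max ?hQ // orbC.
    rewrite pabsM ler_wpM2l //; apply: pabsB_le; last by rewrite pabs1.
    by rewrite pabsM; apply: le_trans hy; rewrite ler_piMl ?pabs_ge0 ?pabs_nat_le1.
  rewrite (_ : D ^+ 4 = (D ^+ 2) ^+ 2); last by rewrite -exprM.
  move: h; rewrite le_max => /orP[] h.
    apply: le_trans (_ : (dl * M ^+ 3) ^+ 2 * 1 <= _).
      by rewrite ler_pM ?exprn_ge0 ?(ltW be0) // lerXn2r ?nnegrE ?exprn_ge0 ?mulr_ge0 ?exprn_ge0.
    rewrite mulr1 exprMn -exprM ler_pM ?exprn_ge0 ?MX //.
    by rewrite expr2 ler_piMl.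
  apply: le_trans (_ : (C * M) ^+ 2 * be <= _).
    by rewrite ler_wpM2r ?(ltW be0) // lerXn2r ?nnegrE ?exprn_ge0 ?mulr_ge0.
  rewrite exprMn mulrAC (_ : M ^+ 8 = M ^+ 6 * M ^+ 2); last by rewrite -exprD.
  by rewrite mulrA ler_wpM2r ?exprn_ge0.
(* A Bezout relation: 4 times the discriminant is a combination of the cubic and its derivative,
   with coefficients polynomial in d and y. *)
have hDel : v (4 * cubic_disc) <= Num.max (C * M ^+ 2) (D * M ^+ 3).
  have -> : 4 * cubic_disc = 4 * cubic d y * (31 + 30 * d - (6 + 36 * d) * y) +
     cp * (4 * (3 - 2 * d - 16 * d ^+ 2 - (11 + 14 * d) * y + (2 + 12 * d) * y ^+ 2)).
    by rewrite /cubic_disc /cubic /cp; ring.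
  have nd k : v (k%:R * d) <= M ^+ 1 by exact: mulM (natM 0 k) (m1 dM).
  have ud k k' : v (k%:R + k'%:R * d) <= M ^+ 1.
    by apply: pabsD_le; [exact: natM | exact: nd].
  apply: pabsD_le; rewrite le_max pabsM ler_wpM2l ?orbT //.
    apply: pabsB_le; first exact: (@upM 1).
    by apply: (@mulM 1 1); rewrite ?expr1.
  apply: (@mulM 0 3); first exact: natM.
  apply: pabsD_le; last by apply: (@mulM 1 2) => //; apply: expM.
  apply: pabsB_le; last by apply: (@upM 2) => //; apply: (@mulM 1 1); rewrite ?expr1.
  apply: pabsB_le; last by apply: (@upM 2) => //; apply: (mulM (natM 0 16)); apply: expM.
  by apply: pabsB_le; [exact: natM | exact: (@upM 1)].
move: hDel; rewrite le_max => /orP[] h.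
  apply: le_trans (_ : (C * M ^+ 2) ^+ 4 * be ^+ 2 <= _).
    by rewrite ler_wpM2r ?exprn_ge0 ?(ltW be0) // lerXn2r ?nnegrE ?pabs_ge0 // mulr_ge0 ?exprn_ge0.
  rewrite (_ : _ * _ = (C ^+ 2 * be) ^+ 2 * M ^+ 8); last by ring.
  rewrite (_ : M ^+ 20 = M ^+ 12 * M ^+ 8); last by rewrite -exprD.
  rewrite mulrA ler_wpM2r ?exprn_ge0 //.
  apply: le_trans (_ : (dl * M ^+ 6) ^+ 2 <= _).
    by rewrite lerXn2r ?nnegrE // !mulr_ge0 ?exprn_ge0 ?(ltW be0).
  by rewrite exprMn -exprM ler_wpM2r ?exprn_ge0 // expr2 ler_piMl.
apply: le_trans (_ : (D * M ^+ 3) ^+ 4 * be <= _).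
  apply: ler_pM; rewrite ?exprn_ge0 ?pabs_ge0 ?(ltW be0) //; last first.
    by rewrite expr2 ler_piMl // (ltW be0).
  by rewrite lerXn2r ?nnegrE ?pabs_ge0 // mulr_ge0 ?exprn_ge0.
rewrite exprMn -exprM mulrAC (_ : M ^+ 20 = M ^+ 8 * M ^+ 12); last by rewrite -exprD.
by rewrite mulrA ler_wpM2r ?exprn_ge0.
Qed.

End Bounded.

(** Total boundedness of balls, in a form that supplies the length K before the sequence is
    given. *)
Definition pigeonhole := forall B eps : F, 0 < eps -> exists K : nat,
  forall x : nat -> F, (forall k, (k < K)%N -> v (x k) <= B) ->
  exists m n, [/\ (m < n)%N, (n < K)%N & v (x n - x m) < eps].

(** If a long stretch of e were bounded, two of its terms would be too close for [bounded_gap]. *)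
Lemma eseq_unbounded (B : F) : pigeonhole -> cubic_disc != 0 ->
  exists N, (1 < N)%N /\ B < v (e N).
Proof.
move=> pig disc0; pose M := 1 + `|B| + v d + v g.
have B0 := normr_ge0 B; have vd0 := pabs_ge0 v d; have vg0 := pabs_ge0 v g.
have M1 : 1 <= M by rewrite /M; lra.
have dM : v d <= M by rewrite /M; lra.
have gM : v g <= M by rewrite /M; lra.
have BM : `|B| <= M by rewrite /M; lra.
have Mgt0 : 0 < M by apply: lt_le_trans M1.
have gpos : 0 < v g by apply: pabs_gt0.
have g4 : 0 < v (4 * g) by rewrite pabs_gt0 // mulf_neq0 ?pnatr_eq0.
pose be := Num.min 1 (Num.min (v g ^+ 2) (v (4 * g) / M ^+ 2)).
have be0 : 0 < be by rewrite !lt_min ltr01 exprn_gt0 //= divr_gt0 // exprn_gt0.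
have be1 : be <= 1 by rewrite ge_min lexx.
have beg : be <= v g ^+ 2 by rewrite !ge_min lexx orbT.
have bem : be * M ^+ 2 <= v (4 * g).
  by rewrite -ler_pdivlMr ?exprn_gt0 // !ge_min lexx !orbT.
have D0 : 0 < v (4 * cubic_disc) by rewrite pabs_gt0 // mulf_neq0 ?pnatr_eq0.
pose eps := Num.min 1 (v (4 * cubic_disc) ^+ 4 * be ^+ 2 / M ^+ 20).
have eps0 : 0 < eps.
  by rewrite lt_min ltr01 divr_gt0 ?mulr_gt0 ?exprn_gt0.
have [K HK] := pig M eps eps0.
have [/hasP[N]|/hasPn hn] := boolP (has (fun k => (1 < k)%N && (M < v (e k))) (iota 0 (8 * K + 8))).
  move=> _ /andP[N1 MN]; exists N; split=> //.
  by apply: le_lt_trans (le_trans (ler_norm B) BM) MN.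
have bd k : (1 < k)%N -> (k < 8 * K + 8)%N -> v (e k) <= M.
  move=> k1 kK; have := hn k; rewrite mem_iota add0n kK => /(_ isT).
  by rewrite k1 /= -leNgt.
(* Even indices from 2 on keep the two chosen indices at distance at least 2, so that their
   difference avoids the index 1. *)
have [m [n [mn nK close]]] := HK (fun k => e (2 * k + 2)) ltac:(move=> k kK; apply: bd; nat_lia).
have d1 : v (e (2 * n + 2) - e (2 * m + 2)) <= 1.
  by apply/ltW/(lt_le_trans close); rewrite ge_min lexx.
have : v (4 * cubic_disc) ^+ 4 * be ^+ 2 <= v (e (2 * n + 2) - e (2 * m + 2)) * M ^+ 20.
  apply: (bounded_gap M1 dM _ _ be0 be1 beg bem _ d1); try nat_lia.
  by move=> k k1 kab; apply: bd => //; nat_lia.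
rewrite leNgt -ltr_pdivlMr ?exprn_gt0 //.
by rewrite (lt_le_trans close) // ge_min lexx orbT.
Qed.

Lemma small_period (dl : F) : pigeonhole -> cubic_disc != 0 -> 0 < dl ->
  exists N, (0 < N)%N /\ forall i, (0 < i)%N -> v (e (i * N))^-1 < dl.
Proof.
move=> pig disc0 dl0; pose B := 1 + dl^-1 + v d + v g.
have vd := pabs_ge0 v d; have vg := pabs_ge0 v g.
have di0 : 0 < dl^-1 by rewrite invr_gt0.
have [N [N1 BN]] := eseq_unbounded B pig disc0.
have B1 : 1 < B by rewrite /B; lra.
have B0 : 0 < B by lra.
have rB : v (e N)^-1 < B^-1 by rewrite pabsV ltf_pV2 // posrE (lt_trans B0).
have r0 := pabs_ge0 v (e N)^-1.
have Bi1 : B^-1 < 1 by rewrite invf_lt1.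
have Bi0 : 0 < B^-1 by rewrite invr_gt0.
have BB : B * B^-1 = 1 by rewrite divff ?gt_eqF.
have r1 : v (e N)^-1 < 1 by lra.
have rX j : v (e N)^-1 ^+ j.+2 <= B^-1 * B^-1.
  apply: le_trans (_ : v (e N)^-1 ^+ 2 <= _).
    by rewrite ler_wiXn2l // ltW.
  by rewrite expr2 ler_pM // ltW.
have dB : v d <= B by rewrite /B; lra.
have gB : v g <= B by rewrite /B; lra.
have rd : v d * v (e N)^-1 ^+ 2 < 1.
  apply: le_lt_trans (_ : B * (B^-1 * B^-1) < 1); first by rewrite ler_pM ?exprn_ge0.
  by rewrite mulrA BB mul1r.
have rg : v g * v (e N)^-1 ^+ 4 < 1.
  apply: le_lt_trans (_ : B * (B^-1 * B^-1) < 1); first by rewrite ler_pM ?exprn_ge0.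
  by rewrite mulrA BB mul1r.
exists N; split; first exact: ltnW.
move=> i i0; apply: le_lt_trans (small_multiples gd nz N1 r1 rd rg i0) _.
apply: lt_le_trans rB _; rewrite -[X in _ <= X]invrK lef_pV2 ?posrE // /B; lra.
Qed.

Lemma eseq_close_lim k eps : (1 < k)%N -> 0 < eps -> exists2 dl, 0 < dl &
  forall N, (k.+1 < N)%N -> v (e N)^-1 < dl -> v (e (N + k) - e k) < eps.
Proof.
move=> k1 eps0; pose M := 1 + v d + v g + v (e k) + v (e k.+1) + v (e k.-1) + (v (16 * g))^-1.
have g16 : 0 < v (16 * g) by rewrite pabs_gt0 // mulf_neq0 ?pnatr_eq0.
have gi : 0 < (v (16 * g))^-1 by rewrite invr_gt0.
have h1 := pabs_ge0 v d; have h2 := pabs_ge0 v g; have h3 := pabs_ge0 v (e k).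
have h4 := pabs_ge0 v (e k.+1); have h5 := pabs_ge0 v (e k.-1).
have M1 : 1 <= M by rewrite /M; lra.
have dM : v d <= M by rewrite /M; lra.
have gM : v g <= M by rewrite /M; lra.
have m1 : v (e k) <= M by rewrite /M; lra.
have m2 : v (e k.+1) <= M by rewrite /M; lra.
have m3 : v (e k.-1) <= M by rewrite /M; lra.
have m4 : 1 <= v (16 * g) * M.
  by rewrite mulrC -ler_pdivrMr // mul1r /M; lra.
have Mgt0 : 0 < M by apply: lt_le_trans M1.
have MX0 : 0 < M ^+ 12 by rewrite exprn_gt0.
exists (Num.min 1 (eps ^+ 2) / M ^+ 12).
  by rewrite divr_gt0 // lt_min ltr01 exprn_gt0.
move=> N kN; rewrite ltr_pdivlMr // lt_min => /andP[r1 re].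
have N1 : (1 < N)%N by nat_lia.
have C := eseq_close M1 dM gM N1 r1 k1 kN m1 m2 m3 m4.
rewrite -(ltr_pXn2r (_ : 0 < 2)%N) ?nnegrE ?pabs_ge0 ?(ltW eps0) //.
exact: le_lt_trans C re.
Qed.

End Recurrence.

(** * Continuity of c and phi in a pair of consecutive terms *)

Section Continuity.
Variables (F : realFieldType) (v : nonarch F).

Definition vcont (f : F -> F -> F) := forall x y eps, 0 < eps ->
  exists2 dl, 0 < dl & forall x' y',
    v (x' - x) < dl -> v (y' - y) < dl -> v (f x' y' - f x y) < eps.

Lemma vcont_cst c : vcont (fun _ _ => c).
Proof. by move=> x y eps eps0; exists 1 => // x' y' _ _; rewrite subrr pabs0. Qed.

Lemma vcont_fst : vcont (fun x _ => x).
Proof. by move=> x y eps eps0; exists eps. Qed.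

Lemma vcont_snd : vcont (fun _ y => y).
Proof. by move=> x y eps eps0; exists eps. Qed.

Lemma vcontD f h : vcont f -> vcont h -> vcont (fun x y => f x y + h x y).
Proof.
move=> cf ch x y eps eps0; have [d1 d10 H1] := cf x y eps eps0.
have [d2 d20 H2] := ch x y eps eps0; exists (Num.min d1 d2); first by rewrite lt_min d10.
move=> x' y'; rewrite !lt_min => /andP[x1 x2] /andP[y1 y2].
have -> : f x' y' + h x' y' - (f x y + h x y) = (f x' y' - f x y) + (h x' y' - h x y) by ring.
by apply: pabsD_lt; [apply: H1 | apply: H2].
Qed.

Lemma vcontM f h : vcont f -> vcont h -> vcont (fun x y => f x y * h x y).
Proof.
move=> cf ch x y eps eps0; pose M := 1 + v (f x y) + v (h x y).
have vf := pabs_ge0 v (f x y); have vh := pabs_ge0 v (h x y).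
have M0 : 0 < M by rewrite /M; lra.
pose eta := Num.min 1 (eps / M).
have eta0 : 0 < eta by rewrite lt_min ltr01 divr_gt0.
have etaM : eta * M <= eps by rewrite -ler_pdivlMr // ge_min lexx orbT.
have eta1 : eta <= 1 by rewrite ge_min lexx.
have [d1 d10 H1] := cf x y eta eta0; have [d2 d20 H2] := ch x y eta eta0.
exists (Num.min d1 d2); first by rewrite lt_min d10.
move=> x' y'; rewrite !lt_min => /andP[x1 x2] /andP[y1 y2].
have h1 := H1 x' y' x1 y1; have h2 := H2 x' y' x2 y2.
set a := f x' y' - _ in h1; set b := h x' y' - _ in h2.
have va := pabs_ge0 v a; have vb := pabs_ge0 v b.
have -> : f x' y' * h x' y' - f x y * h x y = a * b + f x y * b + a * h x y.
  by rewrite /a /b; ring.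
have eM : eta * 1 + eta * v (f x y) + eta * v (h x y) <= eps.
  by apply: le_trans etaM; rewrite /M !mulrDr.
have ef : 0 <= eta * v (f x y) by rewrite mulr_ge0 // ltW.
have eh : 0 <= eta * v (h x y) by rewrite mulr_ge0 // ltW.
apply: pabsD_lt; first apply: pabsD_lt; rewrite pabsM.
- apply: le_lt_trans (_ : eta * v b < _); first by rewrite ler_wpM2r // ltW.
  apply: lt_le_trans (_ : eta * eta <= _); first by rewrite ltr_pM2l.
  have : eta * eta <= eta by rewrite ler_piMr // ltW.
  lra.
- apply: le_lt_trans (_ : v (f x y) * eta < _); first by rewrite ler_wpM2l // ltW.
  by rewrite mulrC; lra.
- apply: le_lt_trans (_ : eta * v (h x y) < _); first by rewrite ler_wpM2r // ltW.
  by lra.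
Qed.

Lemma vcont_prod : vcont (fun x y => x * y / 4).
Proof.
apply: (@vcontM (fun x y => x * y) (fun _ _ => 4^-1)); last exact: vcont_cst.
by apply: (@vcontM (fun x _ => x) (fun _ y => y)); [apply: vcont_fst | apply: vcont_snd].
Qed.

Lemma vcont_sum a : vcont (fun x y => a - (x + y) / 4).
Proof.
move=> x y eps eps0.
have [dl dl0 H] := @vcontM (fun x y => x + y) (fun _ _ => 4^-1)
  (vcontD vcont_fst vcont_snd) (@vcont_cst _) x y eps eps0.
exists dl => // x' y' hx hy; rewrite opprD addrACA subrr add0r -opprD pabsN.
exact: H.
Qed.

End Continuity.

(** * Total boundedness of p-adic balls *)

Section PadicPigeonhole.
Variable q : nat.
Hypothesis qp : prime q.

Let q0 : 0 < (q%:R : rat). Proof. by rewrite ltr0n prime_gt0. Qed.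
Let q1 : 1 < (q%:R : rat). Proof. by rewrite ltr1n prime_gt1. Qed.

Lemma padic_pX j : padic q (q%:R ^+ j) = (q%:R ^+ j)^-1.
Proof. by rewrite pabsX pabs_p // exprVn. Qed.

Lemma padic_digits j (x : rat) : padic q x <= 1 ->
  exists m : 'I_(q ^ j), padic q (x - m%:R) <= (q%:R ^+ j)^-1.
Proof.
move=> x1; elim: j => [|j [m Hm]].
  by exists (Ordinal (isT : (0 < q ^ 0)%N)); rewrite subr0 expr0 invr1.
have qj0 : 0 < (q%:R ^+ j : rat) by rewrite exprn_gt0.
pose y := (x - m%:R) / q%:R ^+ j.
have y1 : padic q y <= 1.
  by rewrite pabsM pabsV padic_pX invrK -ler_pdivlMr // div1r.
have [m' m'q Hm'] := pabs_residue qp y1.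
have lt : (m + q ^ j * m' < q ^ j.+1)%N.
  have := ltn_ord m; rewrite expnS => mq.
  apply: leq_trans (_ : q ^ j * m'.+1 <= _)%N; first by rewrite mulnS ltn_add2r.
  by rewrite mulnC leq_mul2r m'q orbT.
exists (Ordinal lt); rewrite -[nat_of_ord (Ordinal lt)]/(m + q ^ j * m')%N natrD natrM natrX.
have -> : x - (m%:R + q%:R ^+ j * m'%:R) = q%:R ^+ j * (y - m'%:R).
  by rewrite /y; field; rewrite gt_eqF.
rewrite pabsM padic_pX exprSr invfM ler_wpM2l ?invr_ge0 ?(ltW qj0) //.
exact: pabs_lt1_le.
Qed.

(** Scaling by q^b moves the ball into the unit ball, where there are only q^j residues modulo
    q^j. *)
Lemma padic_pigeonhole : pigeonhole (padic q).
Proof.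
move=> B eps eps0; pose B' := Num.max B 1.
have B'0 : 0 < B'^-1 by rewrite invr_gt0 lt_max ltr01 orbT.
have [b Hb] := exists_exprz_lt qp B'0.
have Bb : B <= q%:R ^+ b.
  move: Hb; rewrite ltf_pV2 ?posrE ?exprn_gt0 //; last by rewrite -invr_gt0.
  by rewrite gt_max => /andP[/ltW].
have qb0 : 0 < (q%:R ^+ b : rat) by rewrite exprn_gt0.
have [j Hj] := exists_exprz_lt qp (divr_gt0 eps0 qb0).
exists (q ^ j).+1 => x xB.
have /fin_all_exists[f Hf] : forall k : 'I_(q ^ j).+1, exists m : 'I_(q ^ j),
    padic q (x k * q%:R ^+ b - m%:R) <= (q%:R ^+ j)^-1.
  move=> k; apply: padic_digits; rewrite pabsM padic_pX ler_pdivrMr // mul1r.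
  exact: le_trans (xB _ (ltn_ord k)) Bb.
have [|k [k' kk' fkk']] := injectivePn f _.
  apply/negP=> /injectiveP/leq_card; rewrite !card_ord.
  by rewrite ltnn.
have close : padic q (x k - x k') < eps.
  have -> : x k - x k' = ((x k * q%:R ^+ b - (f k)%:R) - (x k' * q%:R ^+ b - (f k')%:R)) / q%:R ^+ b.
    by rewrite fkk'; field; rewrite gt_eqF.
  rewrite pabsM pabsV padic_pX invrK -ltr_pdivlMr //.
  by apply: le_lt_trans Hj; apply: pabsB_le.
case: (ltngtP k k') => kk; last by case/eqP: kk'; apply: val_inj.
  by exists k, k'; split=> //; rewrite pabsBC.
by exists k', k; split.
Qed.

End PadicPigeonhole.

Section ThreeAdic.
Variables (F : realFieldType) (v : nonarch F).
Hypothesis v_unit : forall k, ~~ (3 %| k)%N -> v k%:R = 1.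
Hypothesis v_residue : forall t, v t <= 1 -> exists2 m : nat, (m < 3)%N & v (t - m%:R) < 1.

(** The discriminant has no zero already at the prime 3: for |d| > 1 its leading term dominates, and
    at d = 0, 1, 2 its values -31, -31, 169 are units. *)
Lemma cubic_disc_neq0_of_nonarch (d : F) : cubic_disc d != 0.
Proof.
have n1 k : v k%:R <= 1 := pabs_nat_le1 v k.
suff : 1 <= v (cubic_disc d).
  by apply: contraTneq => ->; rewrite pabs0 -ltNge ltr01.
have [d1|d1] := leP (v d) 1; last first.
  have E : cubic_disc d = 32%:R * d ^+ 3 + (4%:R * d ^+ 2 - 36%:R * d - 31%:R).
    by rewrite /cubic_disc; ring.
  have d0 := ltW d1; have d00 := pabs_ge0 v d.
  have E3 : v (32%:R * d ^+ 3) = v d ^+ 3 by rewrite pabsM v_unit // mul1r pabsX.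
  rewrite E pabsDl E3; first by rewrite exprn_ege1.
  apply: pabsB_lt; first apply: pabsB_lt.
  - rewrite pabsM pabsX; apply: le_lt_trans (_ : v d ^+ 2 < _).
      by rewrite ler_piMl ?exprn_ge0.
    by rewrite ltr_eXn2l.
  - rewrite pabsM; apply: le_lt_trans (_ : v d < _); first by rewrite ler_piMl.
    by rewrite -[X in X < _]expr1 ltr_eXn2l.
  - by apply: le_lt_trans (n1 _) _; rewrite exprn_egt1.
have [m m3 Hm] := v_residue d1.
have -> : cubic_disc d = cubic_disc m%:R + (d - m%:R) * (32%:R * (d ^+ 2 + d * m%:R + m%:R ^+ 2)
   + 4%:R * (d + m%:R) - 36%:R) by rewrite /cubic_disc; ring.
have u : v (cubic_disc m%:R) = 1.
  case: m m3 {Hm} => [|[|[|//]]] _.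
  - rewrite (_ : cubic_disc 0%:R = - 31%:R); last by rewrite /cubic_disc; ring.
    by rewrite pabsN v_unit.
  - rewrite (_ : cubic_disc 1%:R = - 31%:R); last by rewrite /cubic_disc; ring.
    by rewrite pabsN v_unit.
  - rewrite (_ : cubic_disc 2%:R = 169%:R); last by rewrite /cubic_disc; ring.
    by rewrite v_unit.
have m1 : v m%:R <= 1 := n1 m.
rewrite pabsDl u // pabsM; apply: le_lt_trans Hm.
rewrite ler_piMr ?pabs_ge0 //; apply: pabsB_le => //; apply: pabsD_le; apply: pabsM_le1 => //.
  by apply: pabsD_le; rewrite ?pabsX_le1 // pabsD_le ?pabsX_le1 // pabsM_le1.
by rewrite pabsD_le.
Qed.

End ThreeAdic.

Lemma cubic_disc_neq0 (d : rat) : cubic_disc d != 0.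
Proof.
apply: (@cubic_disc_neq0_of_nonarch _ (padic 3)) => [k|t]; first exact: pabs_nat_eq1.
exact: pabs_residue.
Qed.

(** * The curve attached to gamma *)

Section Family.
Variables (F : realFieldType) (gamma : F).
Definition gpar := 4 * gamma * (1 - gamma).
Definition dpar := 2 * gamma - 1.
Local Notation e := (eseq gpar dpar).

Lemma gpar_dpar : gpar = 1 - dpar ^+ 2.
Proof. by rewrite /gpar /dpar; ring. Qed.

Definition cpt k := - (e k * e k.-1) / 4.
Definition phipt k := gamma - (e k + e k.-1) / 4.

Hypotheses (gamma0 : gamma != 0) (gamma1 : gamma != 1).

Lemma gpar_neq0 : gpar != 0.
Proof. by rewrite !mulf_neq0 ?pnatr_eq0 // subr_eq0 eq_sym. Qed.

Variable v : nonarch F.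
Hypotheses (v2 : v 2 = 2^-1) (v_odd : forall i, odd i -> v i%:R = 1).
Hypothesis v_residue : forall t, v t = 1 -> v (t - 1) < 1.
Hypothesis v_discrete : forall t, v t < 1 -> v t <= 2^-1.

Let v4 : v 4 = 4^-1.
Proof. by rewrite (_ : 4 = 2 * 2); [rewrite pabsM v2 invfM | ring]. Qed.

Section Integral.
Hypothesis int2 : v gamma <= 1.

Lemma gpar_abs2_le : v gpar <= 8^-1.
Proof.
rewrite /gpar -mulrA pabsM v4 (_ : 8^-1 = 4^-1 * 2^-1); last by field.
rewrite ler_wpM2l ?invr_ge0 ?ler0n //.
have lt : v (gamma * (1 - gamma)) < 1.
  have [g1|g1] := ltP (v gamma) 1.
    by rewrite pabsM; apply: le_lt_trans g1; rewrite ler_piMr ?pabs_ge0 // pabsB_le ?pabs1.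
  have ge : v gamma = 1 by apply/eqP; rewrite eq_le int2.
  by rewrite pabsM ge mul1r pabsBC v_residue.
exact: v_discrete lt.
Qed.

Lemma dpar_abs2_le : v dpar <= 1.
Proof. by rewrite /dpar pabsB_le ?pabs1 // pabsM_le1 ?pabs_nat_le1. Qed.

Lemma one_gd_abs2 : v (1 + gpar * dpar) = 1.
Proof.
rewrite pabsDl pabs1 // pabsM; apply: le_lt_trans (_ : 8^-1 * 1 < 1); last by lra.
by rewrite ler_pM ?pabs_ge0 ?gpar_abs2_le ?dpar_abs2_le.
Qed.

Lemma e3E : e 3 = - 4 * (1 + gpar * dpar) / gpar ^+ 2.
Proof. by rewrite eseqS eseq2 eseq1; field; exact: gpar_neq0. Qed.

Lemma e3_abs2 : v (e 3) * (4 * v gpar ^+ 2) = 1.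
Proof.
have g0 : v gpar != 0 by rewrite pabs_eq0 gpar_neq0.
rewrite e3E pabsM pabsV pabsX pabsM one_gd_abs2 pabsN v4; by field.
Qed.

End Integral.

Section Polar.
Hypothesis pole2 : 1 < v gamma.

Lemma gamma_abs2_ge2 : 2 <= v gamma.
Proof.
have h : v gamma^-1 < 1 by rewrite pabsV invf_lt1 // (lt_trans ltr01).
have := v_discrete h; rewrite pabsV => h'.
by move: h'; rewrite lef_pV2 ?posrE ?ltr0n // (lt_trans ltr01).
Qed.

Lemma gpar_abs2_polar : v gpar = v gamma ^+ 2 / 4.
Proof. by rewrite /gpar !pabsM v4 [v (1 - _)]pabsBC pabsBl ?pabs1 //; field. Qed.

Lemma dpar_abs2_polar : v dpar <= v gamma / 2.
Proof.
have := gamma_abs2_ge2; rewrite /dpar => h; apply: pabsB_le; rewrite ?pabs1.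
  by rewrite pabsM v2 mulrC.
by lra.
Qed.

End Polar.

(** Here e_2 = g is small, but |1/e_3| = 4 |g|^2 is at most 1/16, so 3 P is the multiple that starts
    the induction. *)
Lemma two_adic_integral : v gamma <= 1 -> (forall K, wnz gpar dpar K) /\
  forall i, (0 < i)%N -> two_adic_law v gpar dpar (4 * v gpar ^+ 2) 3 i.
Proof.
move=> int2; have gd := gpar_dpar; have g0 := gpar_neq0.
have gle := gpar_abs2_le int2; have dle := dpar_abs2_le int2.
have gge := pabs_ge0 v gpar; have dge := pabs_ge0 v dpar.
have E3 := e3_abs2 int2.
have e30 : e 3 != 0.
  by apply: contra_eq_neq E3 => ->; rewrite pabs0 mul0r eq_sym oner_eq0.
move: E3; set rho : F := 4 * v gpar ^+ 2 => E3.
have g2 : v gpar ^+ 2 <= 8^-1 ^+ 2 by rewrite lerXn2r ?nnegrE ?invr_ge0 ?ler0n.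
have g20 : 0 <= v gpar ^+ 2 by rewrite exprn_ge0.
have rho0 : 0 <= rho by rewrite /rho; lra.
have rhole : rho <= 16^-1 by rewrite /rho; lra.
have rX i : 0 <= rho ^+ i <= 1 by rewrite exprn_ge0 // exprn_ile1 //; lra.
have rho1 : rho <= 1 by lra.
have rhod : v (2 * dpar) * rho ^+ 2 < 1 by rewrite pabsM v2; have := rX 2; nra.
have rhog : v (4 * gpar) * rho ^+ 4 < 1 by rewrite pabsM v4; have := rX 4; nra.
have rhog1 : 3 = 3%N :> nat -> v gpar * rho < 1 by move=> _; nra.
split; first exact: (two_adic_all v2 v_odd v_residue gd rho1 rhod rhog g0 _ E3).
exact: (two_adic_law_all v2 v_odd v_residue gd rho1 rhod rhog g0 _ E3).
Qed.

(** A pole at 2 makes |g| = |gamma|^2 / 4 at least 1, so 2 P already starts the induction; rho = 1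
    occurs for |gamma| = 2. *)
Lemma two_adic_polar : 1 < v gamma -> (forall K, wnz gpar dpar K) /\
  forall i, (0 < i)%N -> two_adic_law v gpar dpar (4 / v gamma ^+ 2) 2 i.
Proof.
move=> pole2; have gd := gpar_dpar; have g0 := gpar_neq0.
have tge := gamma_abs2_ge2 pole2; have gE := gpar_abs2_polar pole2.
have dle := dpar_abs2_polar pole2.
set t := v gamma in tge gE dle *.
have t0 : 0 < t by apply: lt_le_trans tge.
have ti : t^-1 <= 2^-1 by rewrite lef_pV2 ?posrE ?ltr0n.
have ti0 : 0 <= t^-1 by rewrite invr_ge0 ltW.
have tX i : t^-1 ^+ i <= 2^-1 ^+ i by rewrite lerXn2r ?nnegrE ?invr_ge0 ?ler0n ?(ltW t0).
rewrite -exprVn; set rho : F := 4 * t^-1 ^+ 2.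
have tn0 : t != 0 by rewrite gt_eqF.
have t2 := tX 2; have t3 := tX 3; have t6 := tX 6.
have rho1 : rho <= 1 by rewrite /rho; lra.
have rhod : v (2 * dpar) * rho ^+ 2 < 1.
  rewrite pabsM v2; apply: le_lt_trans (_ : 2^-1 * (t / 2) * rho ^+ 2 < 1).
    by rewrite ler_wpM2r ?sqr_ge0 // ler_wpM2l ?invr_ge0 ?ler0n.
  by rewrite (_ : _ * _ = 4 * t^-1 ^+ 3); [lra | rewrite /rho; field].
have rhog : v (4 * gpar) * rho ^+ 4 < 1.
  by rewrite pabsM v4 gE (_ : _ * _ = 16 * t^-1 ^+ 6); [lra | rewrite /rho; field].
have E2 : v (e 2) * rho = 1 by rewrite eseq2 gE /rho; field.
have rhog1 : 2 = 3%N :> nat -> v gpar * rho < 1 by [].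
have e20 : e 2 != 0 by rewrite eseq2.
split; first exact: (two_adic_all v2 v_odd v_residue gd rho1 rhod rhog g0 _ E2).
exact: (two_adic_law_all v2 v_odd v_residue gd rho1 rhod rhog g0 _ E2).
Qed.

Lemma wnz_gamma K : wnz gpar dpar K.
Proof.
by have [/two_adic_integral|/two_adic_polar] := leP (v gamma) 1; case.
Qed.

Hypothesis nz : forall K, wnz gpar dpar K.

Lemma cpt_rel k : (1 < k)%N ->
  [/\ (cpt k - gamma) ^+ 2 + cpt k = phipt k,
      ((cpt k - gamma) ^+ 2 + cpt k - gamma) ^+ 2 + cpt k = ((e k - e k.-1) / 4) ^+ 2
    & (e k - e k.-1) / 4 != 0].
Proof.
case: k => [|[|k]] // _; rewrite /cpt /phipt /=.
have B := e_biquad nz (isT : (0 < k.+1)%N).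
have ne : e k.+2 - e k.+1 != 0.
  by rewrite subr_eq0; apply/eqP=> /(e_inj nz); nat_lia.
move: (e k.+1) (e k.+2) B ne => x y B ne.
have E1 : (- (y * x) / 4 - gamma) ^+ 2 + - (y * x) / 4 = gamma - (y + x) / 4.
  apply/eqP; rewrite -subr_eq0 -(mulrI_eq0 _ (lregP (_ : 16 != 0 :> F))) ?pnatr_eq0 //.
  rewrite -[X in _ == X]B /biquad /gpar /dpar; apply/eqP; by field.
split; rewrite ?E1 ?mulf_neq0 ?invr_eq0 ?pnatr_eq0 //.
by field.
Qed.

(** The value c determines phi, hence the sum and the product of the two consecutive terms. As e is
    injective, the only other possibility is an exchange, m = n - 1 and n = m - 1, which is
    absurd. *)
Lemma cpt_inj m n : (1 < m)%N -> (1 < n)%N -> cpt m = cpt n -> m = n.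
Proof.
move=> m1 n1 E.
have [P1 _ _] := cpt_rel m1; have [P2 _ _] := cpt_rel n1.
have S : e m + e m.-1 = e n + e n.-1.
  have : phipt m = phipt n by rewrite -P1 -P2 E.
  rewrite /phipt => /addrI/oppr_inj/(mulIf _); apply.
  by rewrite invr_eq0 pnatr_eq0.
have P : e m * e m.-1 = e n * e n.-1.
  apply: oppr_inj; move: E; rewrite /cpt => /(mulIf _); apply.
  by rewrite invr_eq0 pnatr_eq0.
have : (e m - e n) * (e m - e n.-1) = 0.
  transitivity (e m ^+ 2 - e m * (e n + e n.-1) + e n * e n.-1); first by ring.
  by rewrite -S -P; ring.
move/eqP; rewrite mulf_eq0 !subr_eq0 => /orP[] /eqP Em.
  by apply: (e_inj nz _ _ Em); nat_lia.
have {}Em : m = n.-1 by apply: (e_inj nz _ _ Em); nat_lia.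
have En : e m.-1 = e n.
  by move: S; rewrite Em [RHS]addrC => /addrI.
have : m.-1 = n by apply: (e_inj nz _ _ En); nat_lia.
nat_lia.
Qed.

End Family.

Section RationalFamily.
Variable gamma : rat.
Hypotheses (gamma0 : gamma != 0) (gamma1 : gamma != 1).
Local Notation g := (gpar gamma).
Local Notation d := (dpar gamma).
Local Notation e := (eseq g d).

Lemma wnz_rat K : wnz g d K.
Proof.
apply: (@wnz_gamma _ _ gamma0 gamma1 (padic 2)); first exact: pabs2_2.
- by move=> i oi; apply: pabs_nat_eq1 => //; rewrite dvdn2 oi.
- exact: pabs2_unit.
- exact: pabs_lt1_le.
Qed.

Local Notation cpt := (cpt gamma).
Local Notation phipt := (phipt gamma).

Lemma small_period_rat q (dl : rat) : prime q -> 0 < dl -> exists N, (0 < N)%N /\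
  forall i, (0 < i)%N -> padic q (e (i * N))^-1 < dl.
Proof.
move=> qp; apply: (small_period (gpar_dpar gamma) (gpar_neq0 gamma0 gamma1) wnz_rat).
  exact: padic_pigeonhole.
exact: cubic_disc_neq0.
Qed.

(* A nonsquare polynomial value at [k P] stays a nonsquare at [(k + i N) P]. *)
Lemma nonsquare_recurs k (f : rat -> rat -> rat) : (2 < k)%N ->
  (forall q, vcont (padic q) f) ->
  nonsquare (f (e k) (e k.-1)) -> exists N, (0 < N)%N /\
  forall i, (0 < i)%N -> (k.+1 < i * N)%N -> nonsquare (f (e (i * N + k)) (e (i * N + k).-1)).
Proof.
move=> k2 cont /nonsquare_local[q qp [eps eps0 near]].
have [dl dl0 Hf] := cont q (e k) (e k.-1) eps eps0.
have g0 := gpar_neq0 gamma0 gamma1; have gd := gpar_dpar gamma.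
have k1 : (1 < k)%N by nat_lia.
have k11 : (1 < k.-1)%N by nat_lia.
have [d1 d10 H1] := eseq_close_lim g0 wnz_rat (padic q) k1 dl0.
have [d2 d20 H2] := eseq_close_lim g0 wnz_rat (padic q) k11 dl0.
have dd0 : 0 < Num.min d1 d2 by rewrite lt_min d10.
have [N [N0 HN]] := small_period_rat qp dd0.
exists N; split=> // i i0 kiN; apply: near; apply: Hf.
  by apply: H1 => //; apply: lt_le_trans (HN i i0) _; rewrite ge_min lexx.
rewrite (_ : (i * N + k).-1 = i * N + k.-1)%N; last by nat_lia.
by apply: H2; [nat_lia | apply: lt_le_trans (HN i i0) _; rewrite ge_min lexx orbT].
Qed.

Lemma inS3_of_good_point k : (1 < k)%N -> nonsquare (- cpt k) -> nonsquare (phipt k) ->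
  nonsquare (- cpt k * phipt k) -> inS3 gamma (cpt k).
Proof.
move=> k1 n1 n2 n3; have [E1 E2 y0] := cpt_rel wnz_rat k1.
by apply: inS3_of_square y0 E2 n1 _ _; rewrite E1.
Qed.

Theorem infinite_of_good_point k : (2 < k)%N -> nonsquare (- cpt k) -> nonsquare (phipt k) ->
  nonsquare (- cpt k * phipt k) -> forall s : seq rat, exists c, c \notin s /\ inS3 gamma c.
Proof.
move=> k2 n1 n2 n3 s.
pose f1 x y : rat := x * y / 4.
pose f2 x y : rat := gamma - (x + y) / 4.
have c1 q : vcont (padic q) f1 by apply: vcont_prod.
have c2 q : vcont (padic q) f2 by apply: vcont_sum.
have c3 q : vcont (padic q) (fun x y => f1 x y * f2 x y) := vcontM (c1 q) (c2 q).
have E1 j : - cpt j = f1 (e j) (e j.-1) by rewrite /cpt mulNr opprK.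
have E2 j : phipt j = f2 (e j) (e j.-1) by [].
have [N1 [N10 H1]] := nonsquare_recurs k2 c1 (eq_ind _ nonsquare n1 _ (E1 k)).
have [N2 [N20 H2]] := nonsquare_recurs k2 c2 (eq_ind _ nonsquare n2 _ (E2 k)).
have n3' : nonsquare (f1 (e k) (e k.-1) * f2 (e k) (e k.-1)) by rewrite -E1 -E2.
have [N3 [N30 H3]] := nonsquare_recurs k2 c3 n3'.
(* A common multiple of three periods, which may belong to three different primes; the factor k + 2
   keeps its multiples beyond k + 1. *)
pose T := (k.+2 * (N1 * N2 * N3))%N.
have T0 : (0 < N1 * N2 * N3)%N by rewrite !muln_gt0 N10 N20 N30.
have kT i : (k.+1 < i.+1 * T)%N.
  by apply: (@leq_trans T); [rewrite leq_pmulr | rewrite leq_pmull].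
have good i : inS3 gamma (cpt (i.+1 * T + k)).
  apply: inS3_of_good_point; first by nat_lia.
  - rewrite E1; have eT : (i.+1 * T = (i.+1 * k.+2 * (N2 * N3)) * N1)%N by rewrite /T -!mulnA [(N1 * _)%N]mulnC !mulnA.
    rewrite eT.
    apply: H1; first by rewrite !muln_gt0 N20 ?N20 ?N30.
    by rewrite -eT kT.
  - rewrite E2; have eT : (i.+1 * T = (i.+1 * k.+2 * (N1 * N3)) * N2)%N by rewrite /T -!mulnA [(N2 * _)%N]mulnC !mulnA.
    rewrite eT.
    apply: H2; first by rewrite !muln_gt0 N10 ?N20 ?N30.
    by rewrite -eT kT.
  - rewrite E1 E2; have eT : (i.+1 * T = (i.+1 * k.+2 * (N1 * N2)) * N3)%N by rewrite /T !mulnA.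
    rewrite eT.
    apply: H3; first by rewrite !muln_gt0 N10 ?N20 ?N30.
    by rewrite -eT kT.
pose l := [seq cpt (i.+1 * T + k) | i <- iota 0 (size s).+1].
have ul : uniq l.
  rewrite map_inj_uniq ?iota_uniq // => i j /(cpt_inj wnz_rat) E.
  have /eqP : (i.+1 * T + k = j.+1 * T + k)%N by apply: E; nat_lia.
  rewrite eqn_add2r eqn_pmul2r; last by rewrite /T muln_gt0.
  by move=> /eqP [].
have [/allP sub|/allPn[c]] := boolP (all (mem s) l).
  by have := uniq_leq_size ul sub; rewrite size_map size_iota ltnn.
by case/mapP=> i _ -> cs; exists (cpt (i.+1 * T + k)).
Qed.

End RationalFamily.

(** * Numerators with an odd prime factor *)

(** P = x y satisfies P^2 + (4 d + 4/x) P = 4 (g - x). The hypotheses say that the Newton polygon of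
    this quadratic has a single slope, so both roots have size |4 x|^(1/2). *)
Lemma biquad_newton (F : realFieldType) (v : nonarch F) (g d x y : F) :
  biquad g d x y = 0 -> x != 0 -> v g < v x ->
  v (4 * d) ^+ 2 < v (4 * x) -> v (4 / x) ^+ 2 < v (4 * x) ->
  v (x * y) ^+ 2 = v (4 * x).
Proof.
move=> B x0 gx h1 h2; set P := x * y.
have E : P ^+ 2 + (4 * d + 4 / x) * P = 4 * (g - x).
  have -> : P ^+ 2 + (4 * d + 4 / x) * P = biquad g d x y + 4 * (g - x).
    by rewrite /P /biquad; field.
  by rewrite B add0r.
have Q : v (4 * (g - x)) = v (4 * x) by rewrite pabsM pabsBC pabsBl // -pabsM.
set A := 4 * d + 4 / x in E.
have hA : v A ^+ 2 < v (4 * x).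
  have : v A <= Num.max (v (4 * d)) (v (4 / x)) by apply: pabsD.
  rewrite le_max => /orP[] h; [apply: le_lt_trans h1 | apply: le_lt_trans h2];
    by rewrite lerXn2r ?nnegrE ?pabs_ge0.
have A0 := pabs_ge0 v A; have P0 := pabs_ge0 v P.
have vE : v (P ^+ 2 + A * P) = v (4 * x) by rewrite E.
have [lt|gt|//] := ltgtP (v P ^+ 2) (v (4 * x)).
  have : v (P ^+ 2 + A * P) < v (4 * x).
    apply: pabsD_lt; rewrite ?pabsX // pabsM.
    rewrite -(ltr_pXn2r (_ : 0 < 2)%N) ?nnegrE ?mulr_ge0 ?pabs_ge0 //.
    rewrite exprMn [X in _ < X]expr2; apply: ltr_pM; rewrite ?sqr_ge0 //.
  by rewrite vE ltxx.
have AP : v (A * P) < v (P ^+ 2).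
  rewrite pabsM pabsX -(ltr_pXn2r (_ : 0 < 2)%N) ?nnegrE ?mulr_ge0 ?sqr_ge0 //.
  have P1 : 0 < v P ^+ 2 by apply: le_lt_trans gt; apply: pabs_ge0.
  rewrite exprMn [X in _ < X]expr2 ltr_pM2r //.
  exact: lt_trans hA gt.
by move: vE; rewrite pabsDl // pabsX => E'; move: gt; rewrite E' ltxx.
Qed.

Section OddPrime.
Variables (F : realFieldType) (gamma : F) (v : nonarch F).
Local Notation g := (gpar gamma).
Local Notation d := (dpar gamma).
Local Notation e := (eseq g d).
Local Notation t := (v gamma).
Hypothesis nz : forall K, wnz g d K.
Hypotheses (v2 : v 2 = 1) (g0 : gamma != 0) (t1 : t < 1).

Let t0 : 0 < t. Proof. exact: pabs_gt0. Qed.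
Let v4 : v 4 = 1.
Proof. by rewrite (_ : 4 = 2 * 2); [rewrite pabsM v2 mulr1 | ring]. Qed.
Let gd := gpar_dpar gamma.

Lemma gpar_pabs : v g = t.
Proof. by rewrite /gpar !pabsM v4 mul1r pabsBl pabs1 ?mulr1. Qed.

Lemma dpar_pabs : v d <= 1.
Proof. by rewrite /dpar pabsB_le ?pabs1 // pabsM v2 mul1r ltW. Qed.

Let gd_lt1 : v (g * d) <= t.
Proof. by rewrite pabsM gpar_pabs ler_piMr ?pabs_ge0 ?dpar_pabs. Qed.

Lemma one_gd_pabs : v (1 + g * d) = 1.
Proof. by rewrite pabsDl pabs1 // (le_lt_trans gd_lt1). Qed.

Lemma e3_inv_pabs : v (e 3)^-1 = t ^+ 2.
Proof.
have gn0 : g != 0 by rewrite -(pabs_eq0 v) gpar_pabs gt_eqF.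
have E : e 3 * g ^+ 2 = - 4 * (1 + g * d).
  by rewrite eseqS eseq2 eseq1; field.
have := congr1 v E; rewrite pabsM pabsX gpar_pabs pabsM one_gd_pabs mulr1 pabsN v4 => E'.
have t2 : t ^+ 2 != 0 by rewrite expf_neq0 // gt_eqF.
by rewrite pabsV; apply: (mulIf (invr_neq0 t2)); rewrite -invfM E' invr1 divff //.
Qed.

Let rho1 : v (e 3)^-1 < 1. Proof. by rewrite e3_inv_pabs exprn_ilt1 ?(ltW t0). Qed.
Let rhod : v d * v (e 3)^-1 ^+ 2 < 1.
Proof.
apply: le_lt_trans (_ : v (e 3)^-1 ^+ 2 < 1); last by rewrite exprn_ilt1 ?pabs_ge0.
by rewrite ler_piMl ?exprn_ge0 ?pabs_ge0 ?dpar_pabs.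
Qed.
Let rhog : v g * v (e 3)^-1 ^+ 4 < 1.
Proof.
apply: le_lt_trans (_ : v (e 3)^-1 ^+ 4 < 1); last by rewrite exprn_ilt1 ?pabs_ge0.
by rewrite ler_piMl ?exprn_ge0 ?pabs_ge0 // gpar_pabs ltW.
Qed.

Lemma e_mul3_pabs n : (0 < n)%N -> v (e (n * 3))^-1 <= t ^+ 2.
Proof. by move=> n0; rewrite -e3_inv_pabs; apply: small_multiples. Qed.

Lemma e_adj3_pabs n y : (0 < n)%N -> biquad g d (e (n * 3)) y = 0 ->
  v y ^+ 2 = v (e (n * 3))^-1.
Proof.
move=> n0 B; have x0 : e (n * 3) != 0 by apply: (e_neq0 nz); nat_lia.
have xs := e_mul3_pabs n0; have xp : 0 < v (e (n * 3))^-1 by rewrite pabs_gt0 ?invr_eq0.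
have tt : t ^+ 2 < 1 by rewrite exprn_ilt1 ?(ltW t0).
have x1 : v (e (n * 3))^-1 < 1 by apply: le_lt_trans tt.
have x1' : 1 < v (e (n * 3)) by move: x1; rewrite pabsV invf_lt1 // -invr_gt0 -pabsV.
have N : v (e (n * 3) * y) ^+ 2 = v (4 * e (n * 3)).
  apply: biquad_newton B x0 _ _ _.
  - by rewrite gpar_pabs (lt_trans t1).
  - rewrite !pabsM v4 !mul1r; apply: le_lt_trans x1'.
    by rewrite exprn_ile1 ?pabs_ge0 ?dpar_pabs.
  - rewrite pabsM v4 mul1r [v (4 * _)]pabsM v4 mul1r; apply: le_lt_trans x1'.
    by rewrite exprn_ile1 ?pabs_ge0 // ltW.
have vx0 : v (e (n * 3)) != 0 by rewrite pabs_eq0.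
apply: (mulfI (_ : v (e (n * 3)) ^+ 2 != 0)); first by rewrite expf_neq0.
by rewrite -exprMn -pabsM N pabsM v4 mul1r pabsV expr2 mulfK.
Qed.

Variable n : nat.
Hypothesis n0 : (0 < n)%N.
Local Notation k := (n * 3).+2.
Local Notation P := (e k * e k.-1).
Local Notation r := (e (2 * k.-1 + 1))^-1.
Local Notation y := ((e k - e k.-1) / 4).

(** With k = 3 n + 2 the indices k - 1 and k are adjacent to 3 n and 3 (n + 1), where 1/e is at most
    t^2; each of the two terms is therefore at most t. *)
Lemma P_small : v P <= t ^+ 2.
Proof.
have E1 : v (e k.-1) ^+ 2 = v (e (n * 3))^-1.
  by apply: e_adj3_pabs => //; apply: (e_biquad nz); rewrite muln_gt0 n0.
have E2 : v (e k) ^+ 2 = v (e (n.+1 * 3))^-1.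
  apply: e_adj3_pabs => //; rewrite biquadC.
  have := e_biquad nz (isT : (0 < k)%N).
  by rewrite (_ : k.+1 = n.+1 * 3)%N //; nat_lia.
rewrite -(ler_pXn2r (_ : 0 < 2)%N) ?nnegrE ?exprn_ge0 ?pabs_ge0 //.
rewrite pabsM exprMn E1 E2 [X in _ <= X]expr2.
by rewrite ler_pM ?pabs_ge0 ?e_mul3_pabs.
Qed.

Let P1 : v P <= 1.
Proof. by apply: le_trans P_small _; rewrite exprn_ile1 ?pabs_ge0 // ltW. Qed.

(** The formula for e_(2k-1) reads e_(2k-1) (e_k - e_(k-1))^2 = -4 up to terms of size t, once the
    sum of the two terms is eliminated by [biquad]. *)
Lemma y_sqr_near : v (4 * y ^+ 2 + r) <= v r * t.
Proof.
have k1 : (1 < k.-1)%N by nat_lia.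
have E := e_odd_dup nz k1.
have B := e_biquad nz (isT : (0 < k.-1)%N); rewrite -/k in B.
have r0 : e (2 * k.-1 + 1) != 0 by apply: (e_neq0 nz); nat_lia.
have small := P_small; have P1' := P1.
rewrite [k.-1.+1]/= in E B.
move: (e k) (e k.-1) (e (2 * k.-1 + 1)) E B r0 small P1' => x z w E B r0 small P1'.
pose st := (x * z + 2 * d) ^+ 2 + 2 * g - 2 * (x * z + 2 * d) * (d + x * z / 4).
have Ew : 4 * ((x - z) / 4) ^+ 2 + w^-1 = - (w^-1 * (g * d + x * z * st / 4)).
  have S : x + z = g - d * (x * z) - (x * z) ^+ 2 / 4.
    apply: (mulfI (_ : (4 : F) != 0)); first by rewrite pnatr_eq0.
    apply/eqP; rewrite -subr_eq0 -[X in _ == X]B /biquad; apply/eqP; by field.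
  rewrite S in E.
  apply: (mulfI r0); rewrite mulrDr divff // mulrN [w * (w^-1 * _)]mulrA divff // mul1r.
  have -> : w * (4 * ((x - z) / 4) ^+ 2) = w * (x - z) ^+ 2 / 4 by field.
  by rewrite E /st; field.
rewrite Ew pabsN pabsM ler_wpM2l ?pabs_ge0 //; apply: pabsD_le => //.
have n1 i : v i%:R <= 1 := pabs_nat_le1 v i.
have dle := dpar_pabs.
have st1 : v st <= 1.
  have h1 : v (x * z + 2 * d) <= 1 by apply: pabsD_le => //; apply: pabsM_le1 => //; apply: n1.
  rewrite /st; apply: pabsB_le.
    by apply: pabsD_le; [apply: pabsX_le1 | apply: pabsM_le1; [apply: n1|rewrite gpar_pabs ltW]].
  apply: pabsM_le1; first by apply: pabsM_le1 => //; apply: n1.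
  by apply: pabsD_le => //; rewrite pabsM pabsV v4 invr1 mulr1.
rewrite pabsM pabsV v4 invr1 mulr1 pabsM; apply: le_trans (_ : v (x * z) <= t).
  by rewrite ler_piMr ?pabs_ge0.
by apply: le_trans small _; rewrite expr2 ler_piMr ?pabs_ge0 // ltW.
Qed.

(** Eliminating the sum of the two terms leaves a polynomial in gamma and p = P / 4; as p is of size
    t^2, only y^2 and 2 gamma^3 survive below order 4. *)
Lemma phi_near : v (phipt gamma k - (y ^+ 2 + 2 * gamma ^+ 3)) <= t ^+ 4.
Proof.
have B := e_biquad nz (isT : (0 < k.-1)%N); rewrite -/k in B.
have small := P_small; rewrite /phipt [k.-1.+1]/= in B *.
move: (e k) (e k.-1) B small => x z B small.
set p := x * z / 4; have vp : v p <= t ^+ 2 by rewrite /p pabsM pabsV v4 invr1 mulr1.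
have tp : v (gamma + p) <= t.
  rewrite pabsD_le //; apply: le_trans vp _.
  by rewrite expr2 ler_piMr ?pabs_ge0 // ltW.
have S : x + z = g - d * (x * z) - (x * z) ^+ 2 / 4.
  apply: (mulfI (_ : (4 : F) != 0)); first by rewrite pnatr_eq0.
  apply/eqP; rewrite -subr_eq0 -[X in _ == X]B /biquad; apply/eqP; by field.
have -> : gamma - (x + z) / 4 - (((x - z) / 4) ^+ 2 + 2 * gamma ^+ 3) =
    2 * p * (3 * gamma ^+ 2 + 3 * gamma * p + p ^+ 2) - (gamma + p) ^+ 4.
  have -> : ((x - z) / 4) ^+ 2 = (x + z) ^+ 2 / 16 - p by rewrite /p; field.
  by rewrite S /p /gpar /dpar; field.
have t4 : t ^+ 4 = t ^+ 2 * t ^+ 2 by rewrite -exprD.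
apply: pabsB_le; last by rewrite pabsX lerXn2r ?nnegrE ?pabs_ge0.
rewrite t4 pabsM; apply: ler_pM; rewrite ?pabs_ge0 //.
  by rewrite pabsM v2 mul1r.
have n3 : v 3 <= 1 := pabs_nat_le1 v 3.
have tp1 : v p <= t by apply: le_trans vp _; rewrite expr2 ler_piMr ?pabs_ge0 // ltW.
apply: pabsD_le; last by rewrite pabsX lerXn2r ?nnegrE ?pabs_ge0.
apply: pabsD_le.
  by rewrite pabsM pabsX ler_piMl ?exprn_ge0 ?pabs_ge0.
rewrite pabsM pabsM expr2; apply: ler_pM; rewrite ?mulr_ge0 ?pabs_ge0 //.
by rewrite ler_piMl ?pabs_ge0.
Qed.

End OddPrime.

Section Tower.
Variables (F : realFieldType) (gamma : F) (v : nonarch F).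
Local Notation g := (gpar gamma).
Local Notation d := (dpar gamma).
Local Notation e := (eseq g d).
Local Notation t := (v gamma).
Hypothesis nz : forall K, wnz g d K.
Hypotheses (v2 : v 2 = 1) (g0 : gamma != 0) (t1 : t < 1).
Variable p : nat.
Hypothesis p0 : (0 < p)%N.
Local Notation pi := (v p%:R).
Hypotheses (pi0 : 0 < pi) (pi1 : pi < 1) (tpi : t <= pi).

Let t0 : 0 < t. Proof. exact: pabs_gt0. Qed.
Let gd := gpar_dpar gamma.
Let d1 : v d <= 1. Proof. exact: dpar_pabs. Qed.
Let vg1 : v g <= 1. Proof. by rewrite gpar_pabs ?ltW. Qed.

Lemma tower_hyps N : v (e N)^-1 <= t ^+ 2 ->
  [/\ v (e N)^-1 < 1, v d * v (e N)^-1 ^+ 2 < 1 & v g * v (e N)^-1 ^+ 4 < 1].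
Proof.
move=> le; have tt : t ^+ 2 < 1 by rewrite exprn_ilt1 ?(ltW t0).
have lt := le_lt_trans le tt.
have X i : (0 < i)%N -> v (e N)^-1 ^+ i < 1.
  by move=> i0; rewrite exprn_ilt1 ?pabs_ge0 // -lt0n.
split=> //; first apply: le_lt_trans (X 2 isT); last apply: le_lt_trans (X 4 isT).
  by rewrite ler_piMl ?exprn_ge0 ?pabs_ge0.
by rewrite ler_piMl ?exprn_ge0 ?pabs_ge0.
Qed.

Local Notation R i := (v (e (p ^ i * 3))^-1).

Let pi0N i : (1 < p ^ i * 3)%N.
Proof. by have : (0 < p ^ i)%N; [rewrite expn_gt0 p0 | nat_lia]. Qed.

(** Multiplication by p multiplies 1/e by p^2 up to an error of size t^2, which is at most |p|^2.
    For t < |p| the term p^2 dominates and equality holds. *)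
Lemma tower_le i : R i <= t ^+ 2 * pi ^+ (2 * i).
Proof.
elim: i => [|i IH]; first by rewrite muln0 expr0 mulr1 mul1n e3_inv_pabs.
have pX : pi ^+ (2 * i) <= 1 by rewrite exprn_ile1 ?pabs_ge0 // ltW.
have le2 : R i <= t ^+ 2.
  by apply: le_trans IH _; rewrite ler_piMr ?exprn_ge0 ?(ltW t0).
have [h1 h2 h3] := tower_hyps le2.
have := multiples_ratio gd nz (pi0N i) h1 h2 h3 d1 vg1 p0.
rewrite mulnA -expnS; set x := _^-1; set z := e (p ^ i * 3) => le.
have z0 : z != 0 by apply: (e_neq0 nz).
have tp2 : t ^+ 2 <= pi ^+ 2 by rewrite lerXn2r ?nnegrE ?pabs_ge0.
have hx : v (x * z) <= pi ^+ 2.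
  rewrite (_ : x * z = (x * z - p%:R ^+ 2) + p%:R ^+ 2); last by ring.
  apply: pabsD_le; last by rewrite pabsX.
  exact: le_trans (le_trans le le2) tp2.
have -> : v x = v z^-1 * v (x * z) by rewrite -pabsM; congr (v _); field.
have -> : t ^+ 2 * pi ^+ (2 * i.+1) = t ^+ 2 * pi ^+ (2 * i) * pi ^+ 2.
  by rewrite mulnS exprD; ring.
by apply: ler_pM; rewrite ?pabs_ge0.
Qed.

Lemma tower_eq i : t < pi -> R i = t ^+ 2 * pi ^+ (2 * i).
Proof.
move=> ltp; elim: i => [|i IH]; first by rewrite muln0 expr0 mulr1 mul1n e3_inv_pabs.
have pX : pi ^+ (2 * i) <= 1 by rewrite exprn_ile1 ?pabs_ge0 // ltW.
have le2 : R i <= t ^+ 2 by rewrite IH ler_piMr ?exprn_ge0 ?(ltW t0).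
have [h1 h2 h3] := tower_hyps le2.
have := multiples_ratio gd nz (pi0N i) h1 h2 h3 d1 vg1 p0.
rewrite mulnA -expnS; set x := _^-1; set z := e (p ^ i * 3) => le.
have z0 : z != 0 by apply: (e_neq0 nz).
have tp2 : t ^+ 2 < pi ^+ 2 by rewrite ltrXn2r // ?nnegrE ?pabs_ge0.
have hx : v (x * z) = pi ^+ 2.
  rewrite (_ : x * z = (x * z - p%:R ^+ 2) + p%:R ^+ 2); last by ring.
  rewrite pabsDr pabsX //; exact: le_lt_trans (le_trans le le2) tp2.
have -> : v x = v z^-1 * v (x * z) by rewrite -pabsM; congr (v _); field.
by rewrite hx IH mulnS exprD; ring.
Qed.

Variables (n j i : nat).
Hypotheses (n0 : (0 < n)%N) (nE : (2 * n + 1 = p ^ i * j)%N).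
Local Notation k := (n * 3).+2.
Local Notation y := ((e k - e k.-1) / 4).

Let j0 : (0 < j)%N. Proof. by case: (j) nE => // ; rewrite muln0 addn1. Qed.
Let kE : (2 * k.-1 + 1 = j * (p ^ i * 3))%N.
Proof. by rewrite mulnA [(j * _)%N]mulnC -nE /=; nat_lia. Qed.

(** As 2 k - 1 = 3 p^i j, the size of y^2 is below t^3, so 2 gamma^3 dominates phi. *)
Lemma phi_pabs_odd : t ^+ 2 * pi ^+ (2 * i) < t ^+ 3 -> v (phipt gamma k) = t ^+ 3.
Proof.
move=> lt3; have le2 : R i <= t ^+ 2.
  apply: le_trans (tower_le i) _; rewrite ler_piMr ?exprn_ge0 ?(ltW t0) //.
  by rewrite exprn_ile1 ?pabs_ge0 // ltW.
have [h1 h2 h3] := tower_hyps le2.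
have rle := small_multiples gd nz (pi0N i) h1 h2 h3 j0; rewrite -kE in rle.
have yn := y_sqr_near nz v2 g0 t1 n0; have pn := phi_near nz v2 g0 t1 n0.
set r := (e (2 * _ + 1))^-1 in rle yn.
have rlt : v r < t ^+ 3 by apply: le_lt_trans rle (le_lt_trans (tower_le i) lt3).
have v4 : v 4 = 1 by rewrite (_ : 4 = 2 * 2); [rewrite pabsM v2 mulr1 | ring].
have ylt : v (y ^+ 2) < t ^+ 3.
  have -> : v (y ^+ 2) = v (4 * y ^+ 2) by rewrite [RHS]pabsM v4 mul1r.
  rewrite (_ : 4 * y ^+ 2 = (4 * y ^+ 2 + r) - r); last by ring.
  apply: pabsB_lt => //; apply: le_lt_trans yn (le_lt_trans _ rlt).
  by rewrite ler_piMr ?pabs_ge0 // ltW.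
have t43 : t ^+ 4 < t ^+ 3 by rewrite ltr_iXn2l.
rewrite (_ : phipt gamma k = 2 * gamma ^+ 3 +
   (y ^+ 2 + (phipt gamma k - (y ^+ 2 + 2 * gamma ^+ 3)))); last by ring.
have E3 : v (2 * gamma ^+ 3) = t ^+ 3 by rewrite pabsM v2 mul1r pabsX.
rewrite pabsDl E3 //; apply: pabsD_lt => //.
exact: le_lt_trans pn t43.
Qed.

(* Here [y1] is the value of [y] at the index with [j = 1]; the residue class of
   [phi / y1 ^ 2] is then a translate of the square [j ^ 2]. *)
Lemma phi_residue_even y1 : t < pi -> t ^+ 2 * pi ^+ (2 * i) = t ^+ 3 ->
  v (4 * y1 ^+ 2 + (e (p ^ i * 3))^-1) <= t ^+ 4 ->
  [/\ y1 != 0, v (2 * gamma ^+ 3 / y1 ^+ 2) = 1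
    & v (phipt gamma k / y1 ^+ 2 - (j%:R ^+ 2 + 2 * gamma ^+ 3 / y1 ^+ 2)) <= t].
Proof.
move=> ltp eq3 hy1.
have R3 : R i = t ^+ 3 by rewrite tower_eq.
have le2 : R i <= t ^+ 2 by rewrite R3 exprS ler_piMl ?exprn_ge0 // ltW.
have [h1 h2 h3] := tower_hyps le2.
have ratio := multiples_ratio gd nz (pi0N i) h1 h2 h3 d1 vg1 j0.
have rle := small_multiples gd nz (pi0N i) h1 h2 h3 j0; rewrite -kE in ratio rle.
have yn := y_sqr_near nz v2 g0 t1 n0; have pn := phi_near nz v2 g0 t1 n0.
have Mn0 : e (p ^ i * 3) != 0 by apply: (e_neq0 nz).
set r := (e (2 * _ + 1))^-1 in rle yn ratio.
set z := e (p ^ i * 3) in ratio rle Mn0 hy1 R3 *.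
have v4 : v 4 = 1 by rewrite (_ : 4 = 2 * 2); [rewrite pabsM v2 mulr1 | ring].
have t43 : t ^+ 4 < t ^+ 3 by rewrite ltr_iXn2l.
have V1 : v (y1 ^+ 2) = t ^+ 3.
  have -> : v (y1 ^+ 2) = v (4 * y1 ^+ 2) by rewrite [RHS]pabsM v4 mul1r.
  rewrite (_ : 4 * y1 ^+ 2 = (4 * y1 ^+ 2 + z^-1) - z^-1); last by ring.
  by rewrite pabsBC pabsBl R3 //; apply: le_lt_trans hy1 t43.
have y1n : y1 != 0.
  by rewrite -sqrf_eq0 -(pabs_eq0 v) V1 expf_eq0 gt_eqF.
have t3 : t ^+ 3 != 0 by rewrite expf_neq0 // gt_eqF.
split=> //.
  by rewrite pabsM pabsV V1 pabsM v2 mul1r pabsX divff.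
have t4E : t ^+ 4 = t * t ^+ 3 by rewrite exprS.
have -> : phipt gamma k / y1 ^+ 2 - (j%:R ^+ 2 + 2 * gamma ^+ 3 / y1 ^+ 2) =
  ((phipt gamma k - (y ^+ 2 + 2 * gamma ^+ 3)) + ((4 * y ^+ 2 + r) / 4
   - (r - j%:R ^+ 2 * z^-1) / 4 - j%:R ^+ 2 * (4 * y1 ^+ 2 + z^-1) / 4)) / y1 ^+ 2.
  by field; rewrite y1n Mn0.
rewrite pabsM pabsV V1 ler_pdivrMr ?exprn_gt0 // -t4E.
have div4 x : v (x / 4) = v x by rewrite pabsM pabsV v4 invr1 mulr1.
apply: pabsD_le => //; apply: pabsB_le; first apply: pabsB_le; rewrite div4.
- apply: le_trans yn _; rewrite t4E mulrC ler_wpM2l ?(ltW t0) //.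
  by rewrite -R3.
- rewrite (_ : r - _ = z^-1 * (r * z - j%:R ^+ 2)); last by field.
  rewrite pabsM R3; apply: le_trans (_ : t ^+ 3 * t ^+ 3 <= _).
    by rewrite ler_wpM2l ?exprn_ge0 ?(ltW t0) // -R3.
  by rewrite t4E ler_wpM2r ?exprn_ge0 ?(ltW t0) // exprS ler_piMr ?exprn_ile1 ?ltW.
- rewrite pabsM -[X in _ <= X]mul1r ler_pM ?pabs_ge0 //.
  by rewrite pabsX_le1 ?pabs_nat_le1.
Qed.

End Tower.

(** * Sizes of c and phi at the prime 2 *)

Section TwoAdicPoint.
Variables (F : realFieldType) (gamma : F) (v : nonarch F).
Local Notation g := (gpar gamma).
Local Notation d := (dpar gamma).
Local Notation e := (eseq g d).
Hypotheses (gamma0 : gamma != 0) (gamma1 : gamma != 1).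
Hypotheses (v2 : v 2 = 2^-1) (v_odd : forall i, odd i -> v i%:R = 1).
Hypothesis v_residue : forall t, v t = 1 -> v (t - 1) < 1.
Hypothesis v_discrete : forall t, v t < 1 -> v t <= 2^-1.

Let v4 : v 4 = 4^-1.
Proof. by rewrite (_ : 4 = 2 * 2); [rewrite pabsM v2 invfM | ring]. Qed.
Let g0 : g != 0. Proof. exact: gpar_neq0. Qed.
Let vg0 : 0 < v g. Proof. exact: pabs_gt0. Qed.

Lemma phi_gap c : v c < v gamma ^+ 2 -> v gamma <= 1 ->
  v ((c - gamma) ^+ 2 + c) = v gamma ^+ 2.
Proof.
move=> lt g1; have lt1 : v c < 1 by apply: lt_le_trans lt _; rewrite exprn_ile1 ?pabs_ge0.
have -> : (c - gamma) ^+ 2 + c = gamma ^+ 2 + (c ^+ 2 + (1 - 2 * gamma) * c) by ring.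
rewrite pabsDl pabsX //; apply: pabsD_lt; apply: le_lt_trans lt.
  by rewrite pabsX expr2 ler_piMr ?pabs_ge0 // ltW.
rewrite pabsM ler_piMl ?pabs_ge0 //.
by rewrite pabsB_le ?pabs1 // pabsM v2; have := pabs_ge0 v gamma; lra.
Qed.

(** A neighbour of e(3 i) has size |g| |i|. Using i = n, a unit, and i = n + 1, of size 1/2, the
    product e_k e_(k-1) carries a single factor 1/2 besides |g|^2, so the exponent of |c| is odd. *)
Lemma point_abs2_integral n : (0 < n)%N -> v gamma <= 1 -> v n%:R = 1 -> v n.+1%:R = 2^-1 ->
  v (cpt gamma (n * 3).+2) = 2 * v g ^+ 2 /\ v (phipt gamma (n * 3).+2) = v gamma ^+ 2.
Proof.
move=> n0 int2 vn vn1; have [nz law] := two_adic_integral gamma0 gamma1 v2 v_odd v_residue v_discrete int2.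
have gle := gpar_abs2_le v2 v_residue v_discrete int2; have dle := dpar_abs2_le int2.
have g2le : v g ^+ 2 <= 64^-1.
  have : v g ^+ 2 <= 8^-1 ^+ 2 by rewrite lerXn2r ?nnegrE ?invr_ge0 ?ler0n // ltW.
  by lra.
have adj i y : (0 < i)%N -> biquad g d (e (i * 3)) y = 0 -> v y ^+ 2 = v g ^+ 2 * v i%:R ^+ 2.
  move=> i0 B; have x0 : e (i * 3) != 0 by apply: (e_neq0 nz); nat_lia.
  have vi0 : 0 < v i%:R by apply: pabs_gt0; rewrite pnatr_eq0 -lt0n.
  have vi1 : v i%:R <= 1 := pabs_nat_le1 v i.
  have rinv := two_adic_law_inv (law i i0); rewrite pabsV in rinv.
  have vx0 : 0 < v (e (i * 3)) by apply: pabs_gt0.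
  have i2 : v i%:R ^+ 2 <= 1 by rewrite exprn_ile1 ?pabs_ge0.
  have i20 : 0 < v i%:R ^+ 2 by rewrite exprn_gt0.
  have xinv : (v (e (i * 3)))^-1 <= 16^-1.
    by rewrite rinv; apply: le_trans (_ : 4 * v g ^+ 2 * 1 <= _); [rewrite ler_wpM2l ?mulr_ge0 ?ler0n ?exprn_ge0 ?(ltW vg0) | lra].
  have xinv0 : 0 <= (v (e (i * 3)))^-1 by rewrite invr_ge0 ltW.
  have xge : 16 <= v (e (i * 3)) by rewrite -lef_pV2 ?posrE ?ltr0n.
  have N : v (e (i * 3) * y) ^+ 2 = v (4 * e (i * 3)).
    apply: biquad_newton B x0 _ _ _.
    - by lra.
    - rewrite [v (4 * d)]pabsM [v (4 * e _)]pabsM v4.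
      have : (4^-1 * v d) ^+ 2 <= (4^-1) ^+ 2.
        by rewrite lerXn2r ?nnegrE ?mulr_ge0 ?pabs_ge0 ?invr_ge0 ?ler0n //; lra.
      by lra.
    - rewrite [v (4 / _)]pabsM pabsV [v (4 * e _)]pabsM v4.
      have : (4^-1 * (v (e (i * 3)))^-1) ^+ 2 <= (4^-1) ^+ 2.
        by rewrite lerXn2r ?nnegrE ?mulr_ge0 ?pabs_ge0 ?invr_ge0 ?ler0n //; lra.
      by lra.
  rewrite pabsM exprMn pabsM v4 in N.
  have -> : v y ^+ 2 = 4^-1 * (v (e (i * 3)))^-1.
    apply: (mulfI (_ : v (e (i * 3)) ^+ 2 != 0)); first by rewrite expf_neq0 // gt_eqF.
    by rewrite N; field; rewrite gt_eqF.
  by rewrite rinv; field.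
set k := (n * 3).+2.
have B1 : biquad g d (e (n * 3)) (e k.-1) = 0 by apply: (e_biquad nz); nat_lia.
have B2 : biquad g d (e (n.+1 * 3)) (e k) = 0.
  by rewrite biquadC -[(n.+1 * 3)%N]/(k.+1); apply: (e_biquad nz).
have E1 := adj _ _ n0 B1; have E2 := adj n.+1 _ isT B2.
have vc : v (cpt gamma k) = 2 * v g ^+ 2.
  rewrite /cpt pabsM pabsN pabsV v4 invrK.
  suff -> : v (e k * e k.-1) = v g ^+ 2 / 2 by field.
  apply/eqP; rewrite -(eqrXn2 (n := 2)) ?pabs_ge0 //; last by rewrite divr_ge0 ?ler0n ?exprn_ge0 ?pabs_ge0.
  by rewrite pabsM exprMn E1 E2 vn vn1; apply/eqP; field.
split=> //; have [|<- _ _] := @cpt_rel _ gamma nz k; first by [].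
have gE : v g = v gamma * v (1 - gamma) / 4.
  by rewrite /gpar pabsM [v (4 * _)]pabsM v4; ring.
have gam0 : 0 < v gamma by apply: pabs_gt0.
apply: phi_gap => //; rewrite vc.
have [lt1|ge1] := ltP (v gamma) 1.
  have -> : v g = v gamma / 4 by rewrite gE [v (1 - _)]pabsBl ?pabs1 ?mulr1.
  have : 0 < v gamma ^+ 2 by rewrite exprn_gt0.
  by rewrite expr_div_n; lra.
have -> : v gamma = 1 by apply/eqP; rewrite eq_le int2.
by rewrite expr1n; lra.
Qed.

(** Now k = 2 j is itself a multiple of N = 2, so |e_k| comes from the size law and |e_k e_(k-1)|^2
    = |4 e_k|. The resulting |c| exceeds |gamma|, and c^2 dominates phi. *)
Lemma point_abs2_polar j : (0 < j)%N -> 1 < v gamma -> v j%:R <= 2^-1 ->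
  v (cpt gamma (j * 2)) = v gamma / v j%:R /\
  v (phipt gamma (j * 2)) = (v gamma / v j%:R) ^+ 2.
Proof.
move=> j0 pole2 vj; have [nz law] := two_adic_polar gamma0 gamma1 v2 v_odd v_residue v_discrete pole2.
have tge := gamma_abs2_ge2 v_discrete pole2; have gE := gpar_abs2_polar v2 pole2.
have dle := dpar_abs2_polar v2 v_discrete pole2.
set t := v gamma in tge gE dle *.
have vj0 : 0 < v j%:R by apply: pabs_gt0; rewrite pnatr_eq0 -lt0n.
have rinv := two_adic_law_inv (law j j0); rewrite pabsV -/t in rinv.
have t0 : 0 < t by lra.
set k := (j * 2)%N in rinv *.
have k1 : (1 < k)%N by rewrite /k; nat_lia.
have x0 : e k != 0 := e_neq0 nz k1.
have vx0 : 0 < v (e k) by apply: pabs_gt0.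
have xE : v (e k) = (t / v j%:R) ^+ 2 / 4.
  by apply: invr_inj; rewrite rinv; field; rewrite !gt_eqF.
set q := t / v j%:R in xE *.
have qge : 2 * t <= q.
  by rewrite /q ler_pdivlMr // -mulrA mulrCA ler_piMr ?(ltW t0) //; lra.
have q0 : 0 < q by lra.
have q2 : 4 * t ^+ 2 <= q ^+ 2.
  have : (2 * t) ^+ 2 <= q ^+ 2 by rewrite lerXn2r ?nnegrE ?(ltW q0) //; lra.
  by rewrite exprMn; lra.
have t2 : 4 <= t ^+ 2.
  by have : 2 ^+ 2 <= t ^+ 2 by [rewrite lerXn2r ?nnegrE ?ler0n ?(ltW t0)]; lra.
have B : biquad g d (e k) (e k.-1) = 0.
  rewrite biquadC; have -> : e k = e k.-1.+1 by rewrite prednK // ltnW.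
  by apply: (e_biquad nz); nat_lia.
have N : v (e k * e k.-1) ^+ 2 = v (4 * e k).
  apply: biquad_newton B x0 _ _ _.
  - by rewrite xE gE; lra.
  - rewrite [v (4 * d)]pabsM [v (4 * e k)]pabsM v4 xE.
    have : (4^-1 * v d) ^+ 2 <= (t / 8) ^+ 2.
      by rewrite lerXn2r ?nnegrE ?mulr_ge0 ?divr_ge0 ?pabs_ge0 ?invr_ge0 ?ler0n ?(ltW t0) //; lra.
    by rewrite [(t / 8) ^+ 2]expr_div_n; lra.
  - rewrite [v (4 / e k)]pabsM pabsV [v (4 * e k)]pabsM v4 xE.
    have qi : (q ^+ 2 / 4)^-1 <= 1 by rewrite invf_le1; lra.
    have qi0 : 0 <= (q ^+ 2 / 4)^-1 by rewrite invr_ge0; lra.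
    have : (4^-1 * (q ^+ 2 / 4)^-1) ^+ 2 <= 4^-1 ^+ 2.
      by rewrite lerXn2r ?nnegrE ?mulr_ge0 ?invr_ge0 ?ler0n //; lra.
    by lra.
have vP : v (e k * e k.-1) = q / 4.
  apply/eqP; rewrite -(eqrXn2 (n := 2)) ?pabs_ge0 //; last by rewrite divr_ge0 ?ler0n ?(ltW q0).
  by rewrite N pabsM v4 xE; apply/eqP; field.
have vc : v (cpt gamma k) = q by rewrite /cpt pabsM pabsN pabsV v4 invrK vP; field.
split=> //; have [//|<- _ _] := @cpt_rel _ gamma nz k.
have E : v (cpt gamma k - gamma) = q by rewrite pabsBl vc // -/t; lra.
rewrite pabsDl pabsX E // vc expr2; rewrite -[X in X < _]mul1r ltr_pM2r //; lra.
Qed.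

End TwoAdicPoint.

(* Otherwise the squares of ['F_p] would be stable under translation by [h], hence everything. *)
Lemma exists_nonsquare_translate p (h : 'F_p) : prime p -> odd p -> h != 0 ->
  exists j : 'F_p, forall m, m ^+ 2 != j ^+ 2 + h.
Proof.
move=> pp op h0; case: (pickP (fun j : 'F_p => [forall m, m ^+ 2 != j ^+ 2 + h])).
  by move=> j /forallP H; exists j.
move=> none.
have sqD (j : 'F_p) : exists m, m ^+ 2 = j ^+ 2 + h.
  by move/negbT: (none j); rewrite negb_forall => /existsP[m]; rewrite negbK => /eqP; exists m.
have mult i : exists m : 'F_p, m ^+ 2 = h *+ i.
  elim: i => [|i [m Hm]]; first by exists 0; rewrite expr0n mulr0n.
  by have [m' Hm'] := sqD m; exists m'; rewrite Hm' Hm mulrSr.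
have surj (x : 'F_p) : exists m, m ^+ 2 = x.
  have [m Hm] := mult (val (x / h)); exists m.
  by rewrite Hm -mulr_natr natr_Zp mulrC divfK.
have /fin_all_exists[f Hf] := surj.
have bij : bijective (fun x : 'F_p => x ^+ 2).
  have inj : injective f by move=> x y E; rewrite -[x]Hf -[y]Hf E.
  have [f' fK f'K] := injF_bij inj.
  by exists f => x //; rewrite -[x in LHS]f'K Hf f'K.
have E : (1 : 'F_p) = -1 by apply: (bij_inj bij); rewrite sqrrN.
have : (2%:R : 'F_p) == 0 by rewrite mulr2n {2}E subrr.
rewrite -(dvdn_pcharf (pchar_Fp pp)) => /(@dvdn_leq _ 2 isT) p2.
have := prime_gt1 pp; rewrite leq_eqVlt => /orP[/eqP p2'|]; last by rewrite ltnNge p2.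
by rewrite -p2' in op.
Qed.

Lemma padic_natr_eq p (a b : nat) : prime p -> padic p (a%:R - b%:R) < 1 -> (a = b %[mod p])%N.
Proof.
move=> pp; have aux (c d : nat) : (d <= c)%N -> padic p (c%:R - d%:R) < 1 -> (c = d %[mod p])%N.
  move=> dc; rewrite -natrB // => lt; apply/eqP; rewrite eqn_mod_dvd //.
  by apply: contraLR lt => /(pabs_nat_eq1 pp) ->; rewrite ltxx.
case: (leqP b a) => [|/ltnW] ab; first exact: aux.
by rewrite pabsBC => /(aux _ _ ab) ->.
Qed.

Lemma nonsquare_residue p (theta : rat) : prime p -> odd p -> padic p theta = 1 ->
  exists j0 : nat, forall j : nat, (j = j0 %[mod p])%N ->
  forall x, padic p (x - (j%:R ^+ 2 + theta)) < 1 -> nonsquare x.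
Proof.
move=> pp op th1; have th1' : padic p theta <= 1 by rewrite th1.
have [h hp Hh] := pabs_residue pp th1'.
have h0 : (h%:R : 'F_p) != 0.
  rewrite -(dvdn_pcharf (pchar_Fp pp)); apply/negP=> /(pabs_nat_lt1 pp) hlt.
  have p1 : (p%:R : rat)^-1 < 1 by rewrite invf_lt1 ?ltr1n ?ltr0n ?prime_gt1 ?prime_gt0.
  have : padic p theta < 1.
    rewrite (_ : theta = (theta - h%:R) + h%:R); last by ring.
    by apply: pabsD_lt => //; apply: le_lt_trans hlt p1.
  by rewrite th1 ltxx.
have [j0 Hj] := exists_nonsquare_translate pp op h0.
exists (val j0) => j Ej x Hx s; apply/eqP=> xE.
have s1 : padic p s <= 1.
  have : padic p x <= 1.
    rewrite (_ : x = (x - (j%:R ^+ 2 + theta)) + (j%:R ^+ 2 + theta)); last by ring.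
    apply: pabsD_le; first exact: ltW.
    by apply: pabsD_le => //; apply: pabsX_le1; apply: pabs_nat_le1.
  by rewrite xE pabsX expr_le1 ?pabs_ge0.
have [m mp Hm] := pabs_residue pp s1.
have : padic p ((m ^ 2)%:R - (j ^ 2 + h)%:R) < 1.
  rewrite natrD !natrX.
  rewrite (_ : _ - _ = (x - (j%:R ^+ 2 + theta)) - (s - m%:R) * (s + m%:R) + (theta - h%:R)).
    apply: pabsD_lt => //; apply: pabsB_lt => //; rewrite pabsM.
    apply: le_lt_trans Hm; rewrite ler_piMr ?pabs_ge0 //.
    by apply: pabsD_le => //; apply: pabs_nat_le1.
  by rewrite xE; ring.
move=> /(padic_natr_eq pp) E.
have toF a b : (a = b %[mod p])%N -> (a%:R : 'F_p) = b%:R.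
  by move=> ab; apply: val_inj; rewrite /= !val_Fp_nat.
have := Hj m%:R; rewrite -[j0]natr_Zp -[nat_of_ord j0]/(val j0) -(toF _ _ Ej).
by rewrite -!natrX -natrD (toF _ _ E) eqxx.
Qed.

Section OddPrimeRat.
Variables (gamma : rat) (p : nat).
Hypotheses (gamma0 : gamma != 0) (gamma1 : gamma != 1).
Hypotheses (pp : prime p) (op : odd p) (plt : padic p gamma < 1).

Let p0 : (0 < p)%N. Proof. exact: prime_gt0. Qed.
Let v2 : padic p 2 = 1.
Proof.
apply: (pabs_nat_eq1 pp); apply/negP=> /(@dvdn_leq _ 2 isT) p2.
have := prime_gt1 pp; rewrite leq_eqVlt => /orP[/eqP p2'|]; last by rewrite ltnNge p2.
by have := op; rewrite -p2'.
Qed.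

(** Let s be the valuation of gamma. The size of y^2 is governed by the exponent 2 s + 2 i and that
    of gamma^3 by 3 s, so i is chosen near s / 2. *)
Lemma phi_nonsquare_class : exists i j0, forall n j, (0 < n)%N -> (2 * n + 1 = p ^ i * j)%N ->
  (j = j0 %[mod p])%N -> nonsquare (phipt gamma (n * 3).+2).
Proof.
have nz := wnz_rat gamma0 gamma1.
have q0 : 0 < (p%:R : rat) by rewrite ltr0n.
have q1 : 1 < (p%:R : rat) by rewrite ltr1n prime_gt1.
have qn0 : (p%:R : rat) != 0 by rewrite gt_eqF.
have piE : padic p p%:R = p%:R^-1 := pabs_p pp.
have pi0 : 0 < padic p p%:R by rewrite piE invr_gt0.
have pi1 : padic p p%:R < 1 by rewrite piE invf_lt1.
have tpi : padic p gamma <= padic p p%:R by rewrite piE; apply: pabs_lt1_le.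
have [z tE] := pabs_exprz pp gamma0.
have [s tE'] : exists s, padic p gamma = padic p p%:R ^+ s.
  case: z tE => s E; last first.
    by exists s.+1; rewrite E piE NegzE -exprnN exprVn.
  by move: plt; rewrite E -exprnP ltNge exprn_ege1 ?(ltW q1).
have s0 : (0 < s)%N by case: s tE' => // E; move: plt; rewrite E ltxx.
have piXlt a b : (b < a)%N -> padic p p%:R ^+ a < padic p p%:R ^+ b.
  by move=> ab; rewrite ltr_iXn2l.
have [os|es] := boolP (odd s).
  (* Here 2 s + 2 i > 3 s, so phi has the odd valuation 3 s. *)
  exists s.+1./2, 0%N => n j n0 nE _.
  have E : padic p (phipt gamma (n * 3).+2) = padic p gamma ^+ 3.
    apply: (phi_pabs_odd nz v2 gamma0 plt p0 pi1 tpi n0 nE).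
    by rewrite tE' -!exprM -exprD; apply: piXlt; nat_lia.
  suff E' : padic p (phipt gamma (n * 3).+2) = p%:R ^ (2 * (- ((s * 3).+1./2)%:Z) + 1).
    exact: nonsquare_pabs_odd E'.
  rewrite E tE' piE -exprM exprVn (_ : _ + 1 = - (s * 3)%:Z); first by rewrite -exprnN.
  by have := os; clear; nat_lia.
have ltp : padic p gamma < padic p p%:R by rewrite tE' -[X in _ < X]expr1 piXlt; nat_lia.
(* Here 2 s + 2 i = 3 s: y^2 and 2 gamma^3 have the same size, and phi / y1^2 has to be read modulo
   p. The index n1 belongs to j = 1. *)
pose i := s./2; pose n1 := (p ^ i)./2.
have i0 : (0 < i)%N by rewrite /i; nat_lia.
have pi3 : (3 <= p ^ i)%N.
  have : (p ^ 1 <= p ^ i)%N by rewrite leq_exp2l ?prime_gt1.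
  have : p != 2 by apply: contraTneq op => ->.
  have := prime_gt1 pp; rewrite expn1; clear; nat_lia.
have opi : odd (p ^ i) by rewrite oddX op orbT.
have n10 : (0 < n1)%N by rewrite /n1; clear - pi3; nat_lia.
have n1E : (2 * n1 + 1 = p ^ i)%N by rewrite /n1; clear - opi; nat_lia.
have eqE : padic p gamma ^+ 2 * padic p p%:R ^+ (2 * i) = padic p gamma ^+ 3.
  rewrite [RHS]exprSr; congr (_ * _); rewrite tE'; congr (_ ^+ _).
  by rewrite /i; clear - es; nat_lia.
pose k1 := (n1 * 3).+2; pose y1 := (eseq (gpar gamma) (dpar gamma) k1 - eseq (gpar gamma) (dpar gamma) k1.-1) / 4.
have hy1 : padic p (4 * y1 ^+ 2 + (eseq (gpar gamma) (dpar gamma) (p ^ i * 3))^-1) <= padic p gamma ^+ 4.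
  have := y_sqr_near nz v2 gamma0 plt n10.
  have -> : (2 * (n1 * 3).+2.-1 + 1 = p ^ i * 3)%N by rewrite -n1E /=; clear; nat_lia.
  by rewrite (tower_eq nz v2 gamma0 plt p0 pi1 i ltp) eqE -exprSr.
have [y1n th1 _] := phi_residue_even nz v2 gamma0 plt p0 pi1 n10 (esym (etrans (muln1 _) (esym n1E))) ltp eqE hy1.
have [j0 Hj] := nonsquare_residue pp op th1.
exists i, j0 => n j n0 nE jE.
have [_ _ near] := phi_residue_even nz v2 gamma0 plt p0 pi1 n0 nE ltp eqE hy1.
apply: (@nonsquareM _ y1^-1); first by rewrite invr_eq0.
by rewrite exprVn; apply: Hj jE _ _; apply: le_lt_trans near plt.
Qed.

End OddPrimeRat.

(** The unit group modulo 32 has exponent 8, so q^7 is the inverse of q there. *)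
Lemma pow8_mod32 q : odd q -> (q ^ 8 = 1 %[mod 32])%N.
Proof.
move=> oq; have qE : q = (2 * q./2 + 1)%N by move: oq; clear; nat_lia.
have [T TE] : exists T, (q ^ 2 = 8 * T + 1)%N.
  have [T TE] : exists T, (q./2 * (q./2 + 1) = 2 * T)%N.
    by exists (q./2 * (q./2 + 1))./2; rewrite mul2n halfK oddM oddD addbT andbN subn0.
  have sqE h : ((2 * h + 1) ^ 2 = 4 * (h * (h + 1)) + 1)%N by rewrite -!mulnn; clear; nat_lia.
  by exists T; rewrite [in LHS]qE sqE TE mulnA.
rewrite (expnM q 2 4) TE.
have -> : ((8 * T + 1) ^ 4 = (128 * T ^ 4 + 64 * T ^ 3 + 12 * T ^ 2 + T) * 32 + 1)%N by ring.
by rewrite modnMDl.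
Qed.

Lemma class_solution p i j0 C : prime p -> odd p -> odd C -> (2 < C)%N -> (C < 32)%N ->
  exists n j, [/\ (0 < n)%N, (2 * n + 1 = p ^ i * j)%N, (j = j0 %[mod p])%N
    & (2 * n + 1 = C %[mod 32])%N].
Proof.
move=> pp op oC C2 C32.
have cop : coprime p 32 by rewrite (@coprime_pexpr 5 p 2) // coprimen2.
pose j := chinese p 32 j0 (C * (p ^ i) ^ 7).
have E1 : (j = j0 %[mod p])%N by apply: chinese_modl.
have E2 : (p ^ i * j = C %[mod 32])%N.
  rewrite -modnMmr (chinese_modr cop) modnMmr mulnCA -expnS -modnMmr pow8_mod32 ?oddX ?op ?orbT //.
  by rewrite modnMmr muln1.
have Cm : (p ^ i * j %% 32 = C)%N by rewrite E2 modn_small.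
exists (p ^ i * j)./2, j.
have oX : odd (p ^ i * j) by have := oC; move: Cm; clear; nat_lia.
have X3 : (2 < p ^ i * j)%N by move: Cm C2; clear; nat_lia.
by split=> //; rewrite -?E2; move: X3 oX; clear; nat_lia.
Qed.

Section GoodPoint.
Variable gamma : rat.
Hypotheses (gamma0 : gamma != 0) (gamma1 : gamma != 1).

Lemma infinite_of_odd_abs2 k (z : int) (a : rat) : (2 < k)%N -> a != 0 ->
  padic 2 (cpt gamma k) = 2 ^ (2 * z + 1) -> padic 2 (phipt gamma k) = padic 2 a ^+ 2 ->
  nonsquare (phipt gamma k) -> forall s : seq rat, exists c, c \notin s /\ inS3 gamma c.
Proof.
move=> k2 a0 vc vphi ns; have [y aE] := pabs_exprz (isT : prime 2) a0.
apply: (infinite_of_good_point gamma0 gamma1 k2) => //.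
  by apply: (nonsquare_pabs_odd (isT : prime 2) (k := z)); rewrite pabsN.
apply: (nonsquare_pabs_odd (isT : prime 2) (k := z + y)).
rewrite pabsM pabsN vc vphi aE [_ ^+ 2]exprnP exprz_exp -expfzDr ?pnatr_eq0 //.
by congr (_ ^ _); ring.
Qed.

Lemma infinite_of_odd_prime p : prime p -> odd p -> padic p gamma < 1 ->
  forall s : seq rat, exists c, c \notin s /\ inS3 gamma c.
Proof.
move=> pp op plt; have [i [j0 H]] := phi_nonsquare_class gamma0 gamma1 pp op plt.
have v_odd i' : odd i' -> padic 2 i'%:R = 1.
  by move=> oi; apply: pabs_nat_eq1 => //; rewrite dvdn2 oi.
have v2k i' : padic 2 (2 * i'%:R) = 2^-1 * padic 2 i'%:R by rewrite pabsM pabs2_2.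
have disc (t : rat) : padic 2 t < 1 -> padic 2 t <= 2^-1 := @pabs_lt1_le 2 isT t.
have [int2|pole2] := leP (padic 2 gamma) 1.
  (* The class 3 gives n = 1 modulo 16: n is odd and n + 1 is twice an odd number. *)
  have [n [j [n0 nE jE n32]]] := @class_solution p i j0 3 pp op isT isT isT.
  have ns := H n j n0 nE jE.
  have [m nm] : exists m, n = (16 * m + 1)%N by exists (n %/ 16)%N; move: n32; clear; nat_lia.
  have vn : padic 2 n%:R = 1 by apply: v_odd; rewrite nm; clear; nat_lia.
  have vn1 : padic 2 n.+1%:R = 2^-1.
    have -> : n.+1 = (2 * (8 * m + 1))%N by rewrite nm; clear; nat_lia.
    by rewrite natrM v2k v_odd ?mulr1 //; clear; nat_lia.
  have [vc vphi] := point_abs2_integral gamma0 gamma1 pabs2_2 v_odd pabs2_unit disc n0 int2 vn vn1.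
  have [z gE] := pabs_exprz (isT : prime 2) (gpar_neq0 gamma0 gamma1).
  have vz : padic 2 (cpt gamma (n * 3).+2) = 2 ^ (2 * z + 1).
    by rewrite vc gE [_ ^+ 2]exprnP exprz_exp expfzDr ?pnatr_eq0 // mulrC [z * _]mulrC.
  have k2 : (2 < (n * 3).+2)%N by move: n0; clear; nat_lia.
  exact: infinite_of_odd_abs2 k2 gamma0 vz vphi ns.
have [m tE] := pabs_exprz (isT : prime 2) gamma0.
(* With |gamma| = 2^m, k = 2 l and |l| = 2^-(a+1), the size of c_k is 2^(m+a+1); a is chosen
   according to the parity of m. *)
have polar C a z : odd C -> (2 < C)%N -> (C < 32)%N ->
    (forall n, (2 * n + 1 = C %[mod 32])%N ->
      exists2 j, (n * 3).+2 = (j * 2)%N & (0 < j)%N /\ padic 2 j%:R = (2 ^+ a.+1)^-1) ->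
    m + a.+1%:Z = 2 * z + 1 ->
    forall s : seq rat, exists c, c \notin s /\ inS3 gamma c.
  move=> oC C2 C32 cls mE.
  have [n [j [n0 nE jE n32]]] := @class_solution p i j0 C pp op oC C2 C32.
  have ns := H n j n0 nE jE; have [l kE [l0 vl]] := cls n n32.
  have vl2 : padic 2 l%:R <= 2^-1.
    by rewrite vl lef_pV2 ?posrE ?exprn_gt0 ?ltr0n // exprS ler_pMr ?ltr0n // exprn_ege1 // ler1n.
  have [vc vphi] := point_abs2_polar gamma0 gamma1 pabs2_2 v_odd pabs2_unit disc l0 pole2 vl2.
  rewrite kE in ns; have k2 : (2 < l * 2)%N by rewrite -kE; move: n0; clear; nat_lia.
  have c0 : cpt gamma (l * 2) != 0.
    rewrite -(pabs_eq0 (padic 2)) vc mulf_neq0 ?pabs_eq0 // vl invr_eq0 invr_eq0.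
    by rewrite expf_neq0 // pnatr_eq0.
  have vz : padic 2 (cpt gamma (l * 2)) = 2 ^ (2 * z + 1).
    by rewrite vc tE vl invrK -mE expfzDr ?pnatr_eq0.
  rewrite -vc in vphi; exact: infinite_of_odd_abs2 k2 c0 vz vphi ns.
have [y /orP[/eqP my|/eqP my]] : exists y : int, (m == 2 * y) || (m == 2 * y + 1).
- exists (m %/ 2)%Z; have := modz_ge0 m (isT : 2 != 0 :> int).
  have := ltz_pmod m (isT : 0 < 2 :> int); have := divz_eq m 2; clear; lia.
(* The class 29 makes (3 n + 2) / 2 twice an odd number. *)
- apply: (@polar 29 0%N y) => //; last by rewrite my.
  move=> n n32; exists (((n * 3).+2)./2); first by move: n32; clear; nat_lia.
  split; first by [].
  have [u ->] : exists u, ((n * 3).+2)./2 = (2 * (2 * u + 1))%N.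
    by exists (((n * 3).+2) %/ 8)%N; move: n32; clear; nat_lia.
  by rewrite natrM v2k v_odd ?mulr1 ?expr1 //; clear; nat_lia.
(* The class 5 makes (3 n + 2) / 2 four times an odd number. *)
- apply: (@polar 5 1%N (y + 1)) => //; last by rewrite my; clear; lia.
  move=> n n32; exists (((n * 3).+2)./2); first by move: n32; clear; nat_lia.
  split; first by [].
  have [u ->] : exists u, ((n * 3).+2)./2 = (2 * (2 * (2 * u + 1)))%N.
    by exists (((n * 3).+2) %/ 16)%N; move: n32; clear; nat_lia.
  by rewrite natrM v2k natrM v2k v_odd ?mulr1 -?invfM //; clear; nat_lia.
Qed.

End GoodPoint.

(** * Numerators that are powers of two up to sign *)

Section Forms.
Variable R : comNzRingType.
Implicit Types a b : R.

(* For gamma = a / b and up to nonzero rational squares, [- c_3], [phi_3], [- c_4], [phi_4] are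
   [- a b (b - a) Kform], [M3form], [a b (b - a) Kform Hform], [M4form]; [A3form], [A4form] and
   [Bform] are truncated square roots of [M3form], [M4form] and [M3form * M4form]. *)
Definition Kform a b := b ^+ 3 - 4 * a * b ^+ 2 + 12 * a ^+ 2 * b - 8 * a ^+ 3.
Definition Hform a b := b ^+ 6 - 4 * a * b ^+ 5 + 12 * a ^+ 2 * b ^+ 4 + 8 * a ^+ 3 * b ^+ 3
  - 48 * a ^+ 4 * b ^+ 2 + 48 * a ^+ 5 * b - 16 * a ^+ 6.
Definition A3form a b := b ^+ 3 - 2 * a * b ^+ 2 + 4 * a ^+ 2 * b + 4 * a ^+ 3.
Definition M3form a b := A3form a b ^+ 2 + 16 * a ^+ 4 * (b * (b - 4 * a)).
Definition A4form a b := b ^+ 6 - 6 * a * b ^+ 5 + 24 * a ^+ 2 * b ^+ 4 - 28 * a ^+ 3 * b ^+ 3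
  + 8 * a ^+ 4 * b ^+ 2 + 48 * a ^+ 5 * b - 112 * a ^+ 6.
Definition G4form a b := - 3 * b ^+ 5 + 16 * a * b ^+ 4 - 16 * a ^+ 2 * b ^+ 3
  - 14 * a ^+ 3 * b ^+ 2 + 80 * a ^+ 4 * b - 96 * a ^+ 5.
Definition M4form a b := A4form a b ^+ 2 + 128 * a ^+ 7 * G4form a b.
Definition Bform a b := b ^+ 9 - 8 * a * b ^+ 8 + 40 * a ^+ 2 * b ^+ 7 - 96 * a ^+ 3 * b ^+ 6
  + 144 * a ^+ 4 * b ^+ 5 - 48 * a ^+ 5 * b ^+ 4 - 64 * a ^+ 6 * b ^+ 3 - 64 * a ^+ 7 * b ^+ 2
  - 352 * a ^+ 8 * b + 1984 * a ^+ 9.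
Definition Gform a b := 12 * b ^+ 8 - 88 * a * b ^+ 7 + 234 * a ^+ 2 * b ^+ 6
  - 288 * a ^+ 3 * b ^+ 5 - 124 * a ^+ 4 * b ^+ 4 + 312 * a ^+ 5 * b ^+ 3 + 127 * a ^+ 6 * b ^+ 2
  + 1348 * a ^+ 7 * b - 3840 * a ^+ 8.

Lemma M3M4form a b : M3form a b * M4form a b = Bform a b ^+ 2 + 1024 * a ^+ 10 * Gform a b.
Proof.
rewrite /M3form /M4form /A3form /A4form /G4form /Bform /Gform.
by ring.
Qed.

End Forms.

Section LowPoints.
Variables (F : realFieldType) (a b : F).
Hypotheses (a0 : a != 0) (b0 : b != 0) (ba0 : b - a != 0).
Local Notation gamma := (a / b).
Local Notation K := (Kform a b).
Local Notation e := (eseq (gpar gamma) (dpar gamma)).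

Let gE : gpar gamma = 4 * a * (b - a) / b ^+ 2.
Proof. by rewrite /gpar; field. Qed.
Let dE : dpar gamma = (2 * a - b) / b.
Proof. by rewrite /dpar; field. Qed.
Let e3F : e 3 = - (K * b) / (4 * a ^+ 2 * (b - a) ^+ 2).
Proof. by rewrite eseqS eseq2 eseq1 gE dE /Kform; field; rewrite a0 b0 ba0. Qed.

Lemma cpt3 : - cpt gamma 3 = - (a * b * (b - a) * K) * (2 * a * b * (b - a))^-1 ^+ 2.
Proof. by rewrite /cpt [3.-1]/= e3F eseq2 gE; field; rewrite a0 b0 ba0. Qed.

Lemma phipt3 : phipt gamma 3 = M3form a b * (4 * a * b * (b - a))^-1 ^+ 2.
Proof.
rewrite /phipt [3.-1]/= e3F eseq2 gE /M3form /A3form /Kform; field; by rewrite a0 b0 ba0.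
Qed.

Hypothesis K0 : K != 0.

Let e4F : e 4 = - 4 * a * (b - a) * Hform a b / (b ^+ 2 * K ^+ 2).
Proof.
rewrite eseqS e3F eseq2 gE dE; have -> : Hform a b = K * b ^+ 3 + 16 * a ^+ 3 * (b - a) ^+ 3.
  by rewrite /Hform /Kform; ring.
have -> : b ^+ 3 = K - (4 * a * (b - a) * (2 * a - b)) by rewrite /Kform; ring.
by field; rewrite K0 a0 b0 ba0.
Qed.

Lemma cpt4 : - cpt gamma 4 = a * b * (b - a) * (K * Hform a b) * (2 * a * b * (b - a) * K)^-1 ^+ 2.
Proof. rewrite /cpt [4.-1]/= e4F e3F; field; by rewrite a0 b0 ba0 K0. Qed.

Lemma phipt4 : phipt gamma 4 = M4form a b * (4 * a * b * (b - a) * K)^-1 ^+ 2.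
Proof.
have E : M4form a b = 16 * a ^+ 3 * b * (b - a) ^+ 2 * K ^+ 2
  + 16 * a ^+ 3 * (b - a) ^+ 3 * Hform a b + b ^+ 3 * K ^+ 3.
  by rewrite /M4form /A4form /G4form /Kform /Hform; ring.
by rewrite E /phipt [4.-1]/= e4F e3F; field; rewrite a0 b0 ba0 K0.
Qed.

End LowPoints.

Section FormMorphism.
Variables (R S : comNzRingType) (f : {rmorphism R -> S}) (a b : R).
Let fE := (rmorph_nat, rmorphXn, rmorphN, rmorphM, rmorphB, rmorphD).

Lemma rmorph_Kform : f (Kform a b) = Kform (f a) (f b).
Proof. by rewrite /Kform !fE. Qed.
Lemma rmorph_Hform : f (Hform a b) = Hform (f a) (f b).
Proof. by rewrite /Hform !fE. Qed.
Lemma rmorph_M3form : f (M3form a b) = M3form (f a) (f b).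
Proof. by rewrite /M3form /A3form !fE. Qed.
Lemma rmorph_M4form : f (M4form a b) = M4form (f a) (f b).
Proof. by rewrite /M4form /A4form /G4form !fE. Qed.
End FormMorphism.

Definition nonsquarez (n : int) := forall m : int, n != m ^+ 2.

Section Criterion.
Variables (gamma : rat) (a b : int).
Hypotheses (gE : gamma = a%:~R / b%:~R) (a0 : a != 0) (b0 : b != 0) (ba0 : b - a != 0).

Let aq : (a%:~R : rat) != 0. Proof. by rewrite intr_eq0. Qed.
Let bq : (b%:~R : rat) != 0. Proof. by rewrite intr_eq0. Qed.
Let baq : (b%:~R - a%:~R : rat) != 0. Proof. by rewrite -rmorphB intr_eq0. Qed.
Let gamma0 : gamma != 0. Proof. by rewrite gE mulf_neq0 ?invr_eq0. Qed.
Let gamma1 : gamma != 1.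
Proof.
rewrite gE; apply: contra_neq baq => E.
by rewrite (canRL (divfK bq) E) mul1r subrr.
Qed.

Lemma infinite_of_nonsquarez3 : nonsquarez (- (a * b * (b - a) * Kform a b)) ->
  nonsquarez (M3form a b) -> nonsquarez (- (a * b * (b - a) * Kform a b) * M3form a b) ->
  forall s : seq rat, exists c, c \notin s /\ inS3 gamma c.
Proof.
move=> n1 n2 n3.
have F1 : - (a%:~R * b%:~R * (b%:~R - a%:~R) * Kform a%:~R b%:~R) =
    (- (a * b * (b - a) * Kform a b))%:~R :> rat.
  by rewrite mulrNz !intrM rmorphB rmorph_Kform.
have E1 : exists2 u : rat, u != 0 & - cpt gamma 3 = (- (a * b * (b - a) * Kform a b))%:~R * u ^+ 2.
  by rewrite gE -F1; eexists; last exact: cpt3; rewrite invr_eq0 !mulf_neq0 // pnatr_eq0.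
have E2 : exists2 u : rat, u != 0 & phipt gamma 3 = (M3form a b)%:~R * u ^+ 2.
  rewrite gE rmorph_M3form; eexists; last exact: phipt3.
  by rewrite invr_eq0 !mulf_neq0 // pnatr_eq0.
have [u1 u10 {}E1] := E1; have [u2 u20 {}E2] := E2.
apply: (infinite_of_good_point gamma0 gamma1 (isT : (2 < 3)%N)); rewrite ?E1 ?E2.
- exact: nonsquare_intM u10 n1.
- exact: nonsquare_intM u20 n2.
- rewrite mulrACA -exprMn -intrM; exact: nonsquare_intM (mulf_neq0 u10 u20) n3.
Qed.

Lemma infinite_of_nonsquarez4 : Kform a b != 0 ->
  nonsquarez (a * b * (b - a) * (Kform a b * Hform a b)) -> nonsquarez (M4form a b) ->
  nonsquarez (a * b * (b - a) * (Kform a b * Hform a b) * M4form a b) ->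
  forall s : seq rat, exists c, c \notin s /\ inS3 gamma c.
Proof.
move=> K0 n1 n2 n3; have Kq : Kform (a%:~R : rat) b%:~R != 0 by rewrite -rmorph_Kform intr_eq0.
have F1 : a%:~R * b%:~R * (b%:~R - a%:~R) * (Kform a%:~R b%:~R * Hform a%:~R b%:~R) =
    (a * b * (b - a) * (Kform a b * Hform a b))%:~R :> rat.
  by rewrite !intrM rmorphB rmorph_Kform rmorph_Hform.
have E1 : exists2 u : rat, u != 0 & - cpt gamma 4 =
    (a * b * (b - a) * (Kform a b * Hform a b))%:~R * u ^+ 2.
  by rewrite gE -F1; eexists; last exact: cpt4; rewrite invr_eq0 !mulf_neq0 // pnatr_eq0.
have E2 : exists2 u : rat, u != 0 & phipt gamma 4 = (M4form a b)%:~R * u ^+ 2.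
  rewrite gE rmorph_M4form; eexists; last exact: phipt4.
  by rewrite invr_eq0 !mulf_neq0 // pnatr_eq0.
have [u1 u10 {}E1] := E1; have [u2 u20 {}E2] := E2.
apply: (infinite_of_good_point gamma0 gamma1 (isT : (2 < 4)%N)); rewrite ?E1 ?E2.
- exact: nonsquare_intM u10 n1.
- exact: nonsquare_intM u20 n2.
- rewrite mulrACA -exprMn -intrM; exact: nonsquare_intM (mulf_neq0 u10 u20) n3.
Qed.

End Criterion.

Lemma sqr_close (R : realDomainType) (z A D E : R) : 0 <= z -> 0 < A ->
  z ^+ 2 = A ^+ 2 + E -> `|E| < D * A -> `|z - A| < D.
Proof.
move=> z0 A0 zE; have -> : E = (z - A) * (z + A) by rewrite -subr_sqr zE; ring.
rewrite normrM [`|z + A|]ger0_norm ?addr_ge0 ?(ltW A0) // => lt.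
rewrite -(ltr_pM2r A0); apply: le_lt_trans lt.
by rewrite ler_wpM2l // lerDr.
Qed.

Section SmallRatio.
Variables (R : realDomainType) (a b : R).
Hypothesis ab : 100 * `|a| <= b.

Let b0 : 0 <= b. Proof. by apply: le_trans ab; rewrite mulr_ge0. Qed.

(** Each factor a costs 100 against b. Keeping 100 for i = 1 and 100 * 100 beyond is enough for the
    linear estimates of the forms. *)
Lemma monomial_le i j n : (0 < i)%N -> (i + j = n)%N ->
  - b ^+ n <= 100 * (if i == 1%N then 1 else 100) * (a ^+ i * b ^+ j) <= b ^+ n.
Proof.
move=> i0 <-; have X : 100 * (if i == 1%N then 1 else 100) <= 100 ^+ i :> R.
  case: i i0 => [|[|i]] // _; rewrite ?expr1 ?mulr1 // 2!exprS.
  by rewrite mulrA -[X in X <= _]mulr1 ler_wpM2l ?mulr_ge0 ?ler0n // exprn_ege1 // ler1n.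
have c0 : 0 <= 100 * (if i == 1%N then 1 else 100) :> R.
  by apply: mulr_ge0; [|case: ifP => _]; rewrite ?ler01 ?ler0n.
rewrite -ler_norml normrM (ger0_norm c0) normrM !normrX (ger0_norm b0) exprD.
rewrite mulrA ler_wpM2r ?exprn_ge0 //.
apply: le_trans (_ : 100 ^+ i * `|a| ^+ i <= _); first by rewrite ler_wpM2r ?exprn_ge0.
by rewrite -exprMn lerXn2r ?nnegrE ?mulr_ge0.
Qed.

Lemma A3form_ge : 9 * b ^+ 3 <= 10 * A3form a b.
Proof.
have -> : A3form a b = 1 * b ^+ 3 - 2 * (a ^+ 1 * b ^+ 2) + 4 * (a ^+ 2 * b ^+ 1) + 4 * (a ^+ 3 * b ^+ 0).
  by rewrite /A3form; ring.
move: (@monomial_le 1 2 3 isT erefl) (@monomial_le 2 1 3 isT erefl) (@monomial_le 3 0 3 isT erefl).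
rewrite /=; move: (b ^+ 3) (a ^+ 1 * b ^+ 2) (a ^+ 2 * b ^+ 1) (a ^+ 3 * b ^+ 0).
move=> *; lra.
Qed.

Lemma A4form_ge : 9 * b ^+ 6 <= 10 * A4form a b.
Proof.
have -> : A4form a b = 1 * b ^+ 6 - 6 * (a ^+ 1 * b ^+ 5) + 24 * (a ^+ 2 * b ^+ 4) - 28 * (a ^+ 3 * b ^+ 3)
  + 8 * (a ^+ 4 * b ^+ 2) + 48 * (a ^+ 5 * b ^+ 1) - 112 * (a ^+ 6 * b ^+ 0).
  by rewrite /A4form; ring.
move: (@monomial_le 1 5 6 isT erefl) (@monomial_le 2 4 6 isT erefl) (@monomial_le 3 3 6 isT erefl)
  (@monomial_le 4 2 6 isT erefl) (@monomial_le 5 1 6 isT erefl) (@monomial_le 6 0 6 isT erefl).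
rewrite /=; move: (b ^+ 6) (a ^+ 1 * b ^+ 5) (a ^+ 2 * b ^+ 4) (a ^+ 3 * b ^+ 3) (a ^+ 4 * b ^+ 2) (a ^+ 5 * b ^+ 1)
  (a ^+ 6 * b ^+ 0).
move=> *; lra.
Qed.

Lemma Bform_ge : 6 * b ^+ 9 <= 10 * Bform a b.
Proof.
have -> : Bform a b = 1 * b ^+ 9 - 8 * (a ^+ 1 * b ^+ 8) + 40 * (a ^+ 2 * b ^+ 7) - 96 * (a ^+ 3 * b ^+ 6)
  + 144 * (a ^+ 4 * b ^+ 5) - 48 * (a ^+ 5 * b ^+ 4) - 64 * (a ^+ 6 * b ^+ 3)
  - 64 * (a ^+ 7 * b ^+ 2) - 352 * (a ^+ 8 * b ^+ 1) + 1984 * (a ^+ 9 * b ^+ 0).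
  by rewrite /Bform; ring.
move: (@monomial_le 1 8 9 isT erefl) (@monomial_le 2 7 9 isT erefl) (@monomial_le 3 6 9 isT erefl)
  (@monomial_le 4 5 9 isT erefl) (@monomial_le 5 4 9 isT erefl) (@monomial_le 6 3 9 isT erefl)
  (@monomial_le 7 2 9 isT erefl) (@monomial_le 8 1 9 isT erefl) (@monomial_le 9 0 9 isT erefl).
rewrite /=; move: (b ^+ 9) (a ^+ 1 * b ^+ 8) (a ^+ 2 * b ^+ 7) (a ^+ 3 * b ^+ 6) (a ^+ 4 * b ^+ 5) (a ^+ 5 * b ^+ 4)
  (a ^+ 6 * b ^+ 3) (a ^+ 7 * b ^+ 2) (a ^+ 8 * b ^+ 1) (a ^+ 9 * b ^+ 0).
move=> *; lra.
Qed.

Lemma G4form_le : `|G4form a b| <= 4 * b ^+ 5.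
Proof.
rewrite ler_norml.
have -> : G4form a b = - 3 * b ^+ 5 + 16 * (a ^+ 1 * b ^+ 4) - 16 * (a ^+ 2 * b ^+ 3) - 14 * (a ^+ 3 * b ^+ 2)
  + 80 * (a ^+ 4 * b ^+ 1) - 96 * (a ^+ 5 * b ^+ 0).
  by rewrite /G4form; ring.
move: (exprn_ge0 5 b0) (@monomial_le 1 4 5 isT erefl) (@monomial_le 2 3 5 isT erefl) (@monomial_le 3 2 5 isT erefl)
  (@monomial_le 4 1 5 isT erefl) (@monomial_le 5 0 5 isT erefl).
rewrite /=; move: (b ^+ 5) (a ^+ 1 * b ^+ 4) (a ^+ 2 * b ^+ 3) (a ^+ 3 * b ^+ 2) (a ^+ 4 * b ^+ 1) (a ^+ 5 * b ^+ 0).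
by move=> *; apply/andP; split; lra.
Qed.

Lemma Gform_le : `|Gform a b| <= 14 * b ^+ 8.
Proof.
rewrite ler_norml.
have -> : Gform a b = 12 * b ^+ 8 - 88 * (a ^+ 1 * b ^+ 7) + 234 * (a ^+ 2 * b ^+ 6) - 288 * (a ^+ 3 * b ^+ 5)
  - 124 * (a ^+ 4 * b ^+ 4) + 312 * (a ^+ 5 * b ^+ 3) + 127 * (a ^+ 6 * b ^+ 2)
  + 1348 * (a ^+ 7 * b ^+ 1) - 3840 * (a ^+ 8 * b ^+ 0).
  by rewrite /Gform; ring.
move: (exprn_ge0 8 b0) (@monomial_le 1 7 8 isT erefl) (@monomial_le 2 6 8 isT erefl) (@monomial_le 3 5 8 isT erefl)
  (@monomial_le 4 4 8 isT erefl) (@monomial_le 5 3 8 isT erefl) (@monomial_le 6 2 8 isT erefl)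
  (@monomial_le 7 1 8 isT erefl) (@monomial_le 8 0 8 isT erefl).
rewrite /=; move: (b ^+ 8) (a ^+ 1 * b ^+ 7) (a ^+ 2 * b ^+ 6) (a ^+ 3 * b ^+ 5) (a ^+ 4 * b ^+ 4) (a ^+ 5 * b ^+ 3)
  (a ^+ 6 * b ^+ 2) (a ^+ 7 * b ^+ 1) (a ^+ 8 * b ^+ 0).
by move=> *; apply/andP; split; lra.
Qed.

End SmallRatio.

Section LargeRatio.
Variables (R : realDomainType) (a b : R).
Hypotheses (b0 : 0 <= b) (ab : b <= 100 * `|a|).

Lemma monomial_ge i j :
  - (100 ^+ j * `|a| ^+ (i + j)) <= a ^+ i * b ^+ j <= 100 ^+ j * `|a| ^+ (i + j).
Proof.
rewrite -ler_norml normrM !normrX (ger0_norm b0) addnC exprD mulrA -exprMn mulrC.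
by rewrite ler_wpM2r ?exprn_ge0 // lerXn2r ?nnegrE ?mulr_ge0.
Qed.

(** The term b^3 costs 100^3, and the factor 2 absorbs the others. *)
Lemma A3form_le : `|A3form a b| <= 2 * (100 * (100 * 100)) * `|a| ^+ 3.
Proof.
rewrite ler_norml /A3form; have : 0 <= `|a| ^+ 3 by rewrite exprn_ge0.
have /andP[? ?] := monomial_ge 0 3. have /andP[? ?] := monomial_ge 1 2.
have /andP[? ?] := monomial_ge 2 1. have /andP[? ?] := monomial_ge 3 0.
move=> ?; apply/andP; split; lra.
Qed.

Lemma M3form_le z : 0 <= z -> z ^+ 2 = M3form a b -> z <= 3 * (100 * (100 * 100)) * `|a| ^+ 3.
Proof.
move=> z0 zE; have A3 := A3form_le; have s0 : 0 <= `|a| by [].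
have s3 : 0 <= `|a| ^+ 3 by rewrite exprn_ge0.
have s6 : 0 <= `|a| ^+ 6 by rewrite exprn_ge0.
rewrite -(ler_pXn2r (_ : 0 < 2)%N) ?nnegrE ?mulr_ge0 ?ler0n // zE /M3form.
have A3' : A3form a b ^+ 2 <= (2 * (100 * (100 * 100)) * `|a| ^+ 3) ^+ 2.
  by rewrite -real_normK ?num_real // lerXn2r ?nnegrE ?mulr_ge0 ?ler0n.
have := monomial_ge 4 2; have := monomial_ge 5 1; rewrite expr1.
have e6 : (`|a| ^+ 3) ^+ 2 = `|a| ^+ 6 by rewrite -exprM.
rewrite exprMn e6 in A3' *.
move=> /andP[h1 h2] /andP[h3 h4]; lra.
Qed.

End LargeRatio.

(** * Congruences modulo powers of two for square roots of the forms *)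

Definition oddz (x : int) := exists y, x = 2 * y + 1.

Lemma oddzM x y : oddz x -> oddz y -> oddz (x * y).
Proof. by move=> [m ->] [n ->]; exists (2 * (m * n) + m + n); ring. Qed.

Lemma oddzX x n : oddz x -> oddz (x ^+ n).
Proof.
move=> ox; elim: n => [|n IH]; first by exists 0.
by rewrite exprS; apply: oddzM.
Qed.

Lemma oddzD x y : oddz x -> oddz (x + 2 * y).
Proof. by move=> [m ->]; exists (m + y); ring. Qed.

Lemma oddzN x : oddz x -> oddz (- x).
Proof. by move=> [m ->]; exists (- m - 1); ring. Qed.

Lemma oddz_neq0 x : oddz x -> x != 0.
Proof. by move=> [m ->]; lia. Qed.

Lemma oddz_not2 x y : oddz x -> x != 2 * y.
Proof. by move=> [m ->]; lia. Qed.

(** Powers of 2 up to sign, encoded by the property that Gauss's lemma consumes. *)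
Definition two_power (a : int) := forall w, oddz w -> coprimez a w.

Lemma two_powerM a c : two_power a -> two_power c -> two_power (a * c).
Proof. by move=> pa pc w ow; rewrite coprimezMl pa ?pc. Qed.

Lemma two_powerX a n : two_power a -> two_power (a ^+ n).
Proof. by move=> pa w ow; rewrite coprimezXl ?pa. Qed.

Lemma two_power2 : two_power 2.
Proof.
move=> w [m ->]; apply/coprimezP; exists (- m, 1) => /=; by ring.
Qed.

(** With z = 2 m + 1 and A = 2 q + 1 the equation is (m - q) 2 (m + q + 1) = N E. The two factors
    have opposite parity, and the odd one is coprime to N. *)
Lemma sqr_congr z A N E : oddz A -> two_power N -> z ^+ 2 = A ^+ 2 + 2 * N * E ->
  (N %| z - A)%Z \/ (N %| z + A)%Z.
Proof.
move=> [q AE] pN zE.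
have [m [zm|zm]] : exists m, z = 2 * m \/ z = 2 * m + 1.
- exists (z %/ 2)%Z; have := divz_eq z 2; have := modz_ge0 z (isT : 2 != 0 :> int).
  by have := ltz_pmod z (isT : 0 < 2 :> int); clear; lia.
- exfalso; have : oddz (A ^+ 2) by apply: oddzX; exists q.
  move=> [y yE]; rewrite yE zm in zE; move: zE.
  have -> : (2 * m) ^+ 2 = 2 * (2 * m ^+ 2) by ring.
  by rewrite -mulrA; move: (m ^+ 2) (N * E); clear; lia.
have E1 : (m - q) * (2 * (m + q + 1)) = N * E.
  have : 2 * ((m - q) * (2 * (m + q + 1))) = 2 * (N * E).
    have -> : 2 * ((m - q) * (2 * (m + q + 1))) = (2 * m + 1) ^+ 2 - (2 * q + 1) ^+ 2 by ring.
    by rewrite -zm -AE zE; ring.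
  exact: mulfI.
have dv : (N %| (m - q) * (2 * (m + q + 1)))%Z by rewrite E1 dvdz_mulr.
have [y [y0|y1]] : exists y, m - q = 2 * y \/ m - q = 2 * y + 1.
- exists ((m - q) %/ 2)%Z; have := divz_eq (m - q) 2; have := modz_ge0 (m - q) (isT : 2 != 0 :> int).
  by have := ltz_pmod (m - q) (isT : 0 < 2 :> int); clear; lia.
- left; have o : oddz (m + q + 1) by exists (y + q); move: y0; clear; lia.
  have -> : z - A = (m - q) * 2 by rewrite zm AE; ring.
  by move: dv; rewrite mulrA Gauss_dvdzl // pN.
- right; have o : oddz (m - q) by exists y.
  have -> : z + A = 2 * (m + q + 1) by rewrite zm AE; ring.
  by move: dv; rewrite Gauss_dvdzr // pN.
Qed.

Lemma dvdz_small N x : (N %| x)%Z -> `|x| < `|N| -> x = 0.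
Proof.
move=> /dvdzP[y ->]; rewrite normrM => lt; have [->|y0] := eqVneq y 0; first exact: mul0r.
have : `|N| <= `|y| * `|N| by rewrite ler_peMl // -gtz0_ge1 normr_gt0.
by rewrite leNgt lt.
Qed.

(** The size condition gives |z - A| < |N|, so divisibility by N leaves only z = A. *)
Lemma sqr_eq_of_close z A N E : 0 <= z -> 0 < A -> z ^+ 2 = A ^+ 2 + 2 * N * E -> N != 0 ->
  (N %| z - A)%Z -> 2 * `|E| < A -> E = 0.
Proof.
move=> z0 A0 zE N0 dv lt; have Nlt : `|2 * N * E| < `|N| * A.
  by rewrite normrM normrM [`|2|]ger0_norm // [2 * _]mulrC -mulrA ltr_pM2l ?normr_gt0.
have /(dvdz_small dv)/eqP := sqr_close z0 A0 zE Nlt.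
rewrite subr_eq0 => /eqP zA; move: zE; rewrite zA -[LHS]addr0 => /addrI/esym/eqP.
by rewrite !mulf_eq0 (negPf N0) => /eqP.
Qed.

Section TwoPowerNumerator.
Variables (a b : int).
Hypotheses (a0 : a != 0) (pa : two_power a) (aev : exists al, a = 2 * al) (ob : oddz b) (b0 : 0 < b).

Lemma oddz_Kform : oddz (Kform a b).
Proof.
have -> : Kform a b = b ^+ 3 + 2 * (- 2 * a * b ^+ 2 + 6 * a ^+ 2 * b - 4 * a ^+ 3).
  by rewrite /Kform; ring.
by apply: oddzD; apply: oddzX.
Qed.

Lemma oddz_Hform : oddz (Hform a b).
Proof.
have -> : Hform a b = b ^+ 6 + 2 * (- 2 * a * b ^+ 5 + 6 * a ^+ 2 * b ^+ 4 + 4 * a ^+ 3 * b ^+ 3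
  - 24 * a ^+ 4 * b ^+ 2 + 24 * a ^+ 5 * b - 8 * a ^+ 6) by rewrite /Hform; ring.
by apply: oddzD; apply: oddzX.
Qed.

Lemma oddz_A3form : oddz (A3form a b).
Proof.
have -> : A3form a b = b ^+ 3 + 2 * (- a * b ^+ 2 + 2 * a ^+ 2 * b + 2 * a ^+ 3).
  by rewrite /A3form; ring.
by apply: oddzD; apply: oddzX.
Qed.

Lemma oddz_A4form : oddz (A4form a b).
Proof.
have -> : A4form a b = b ^+ 6 + 2 * (- 3 * a * b ^+ 5 + 12 * a ^+ 2 * b ^+ 4 - 14 * a ^+ 3 * b ^+ 3
  + 4 * a ^+ 4 * b ^+ 2 + 24 * a ^+ 5 * b - 56 * a ^+ 6) by rewrite /A4form; ring.
by apply: oddzD; apply: oddzX.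
Qed.

Lemma oddz_M3form : oddz (M3form a b).
Proof.
rewrite /M3form; have -> : 16 * a ^+ 4 * (b * (b - 4 * a)) = 2 * (8 * a ^+ 4 * (b * (b - 4 * a))).
  by ring.
by apply: oddzD; apply: oddzX oddz_A3form.
Qed.

Lemma oddz_M4form : oddz (M4form a b).
Proof.
rewrite /M4form; have -> : 128 * a ^+ 7 * G4form a b = 2 * (64 * a ^+ 7 * G4form a b) by ring.
by apply: oddzD; apply: oddzX oddz_A4form.
Qed.

Lemma G4form_neq0 : G4form a b != 0.
Proof.
have -> : G4form a b = b ^+ 5 + 2 * (- 2 * b ^+ 5 + 8 * a * b ^+ 4 - 8 * a ^+ 2 * b ^+ 3
  - 7 * a ^+ 3 * b ^+ 2 + 40 * a ^+ 4 * b - 48 * a ^+ 5) by rewrite /G4form; ring.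
by apply: oddz_neq0; apply: oddzD; apply: oddzX.
Qed.

Lemma Gform_neq0 : Gform a b != 0.
Proof.
have [al aE] := aev.
have -> : Gform a b = 4 * (b ^+ 8 + 2 * (b ^+ 8 - 11 * a * b ^+ 7 + 117 * al ^+ 2 * b ^+ 6
  - 36 * a ^+ 3 * b ^+ 5 - 31 * a ^+ 3 * al * b ^+ 4 + 39 * a ^+ 5 * b ^+ 3
  + 127 * a ^+ 3 * al ^+ 3 * b ^+ 2 + 337 * a ^+ 6 * al * b - 480 * a ^+ 8)).
  by rewrite /Gform aE; ring.
by rewrite mulf_neq0 //; apply: oddz_neq0; apply: oddzD; apply: oddzX.
Qed.

(** This fixes a sign: the roots turn out to be - [A3form] and - [A4form] modulo 8, so their product
    is [Bform] and not its opposite. *)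
Lemma Bform_congr : Bform a b = A3form a b * A4form a b + 8 * (a ^+ 4 * b ^+ 5 - 8 * a ^+ 5 * b ^+ 4
  + 28 * a ^+ 6 * b ^+ 3 - 64 * a ^+ 7 * b ^+ 2 - 12 * a ^+ 8 * b + 304 * a ^+ 9).
Proof. by rewrite /Bform /A3form /A4form; ring. Qed.

Lemma oddz_Bform : oddz (Bform a b).
Proof.
rewrite Bform_congr (_ : 8 = 2 * 4) // -mulrA; apply: oddzD.
by apply: oddzM; [apply: oddz_A3form | apply: oddz_A4form].
Qed.

(** A square root is congruent to plus or minus [A3form] modulo 8 a^4, whereas both are of order
    |a|^3: the sum is at most 5 * 100^3 |a|^3. They then agree up to sign, and b (b - 4 a) would
    vanish. *)
Lemma M3form_not_sqr : b <= 100 * `|a| -> 100 * (100 * 100) <= `|a| -> nonsquarez (M3form a b).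
Proof.
move=> ab big z'; apply/eqP=> zE'; pose z := `|z'|; have z0 : 0 <= z by [].
have zE : z ^+ 2 = M3form a b by rewrite /z real_normK ?num_real.
have zle := M3form_le (ltW b0) ab z0 zE; have Ale := A3form_le (ltW b0) ab.
have n0 : 0 < `|a| ^+ 3 by rewrite exprn_gt0 ?normr_gt0.
have lt : z + `|A3form a b| < `|8 * a ^+ 4|.
  rewrite normrM normrX [`|8|]ger0_norm ?ler0n // exprSr mulrA.
  have : 8 * (`|a| ^+ 3 * (100 * (100 * 100))) <= 8 * (`|a| ^+ 3 * `|a|).
    by rewrite ler_pM2l // ler_pM2l.
  by rewrite mulrA; lra.
have p8 : two_power (8 * a ^+ 4).
  apply: two_powerM; last exact: two_powerX.
  by rewrite (_ : 8 = 2 ^+ 3) //; apply: two_powerX two_power2.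
have zE2 : z ^+ 2 = A3form a b ^+ 2 + 2 * (8 * a ^+ 4) * (b * (b - 4 * a)).
  by rewrite zE /M3form; ring.
have nz : b * (b - 4 * a) != 0.
  rewrite mulf_neq0 ?oddz_neq0 //; have -> : b - 4 * a = b + 2 * (- 2 * a) by ring.
  exact: oddzD.
have E0 : z = A3form a b \/ z = - A3form a b.
  have [dv|dv] := sqr_congr oddz_A3form p8 zE2; [left | right].
    apply/eqP; rewrite -subr_eq0; apply/eqP/(dvdz_small dv); apply: le_lt_trans lt.
    by apply: le_trans (ler_normB _ _) _; rewrite (ger0_norm z0).
  apply/eqP; rewrite -subr_eq0 opprK; apply/eqP/(dvdz_small dv); apply: le_lt_trans lt.
  by apply: le_trans (ler_normD _ _) _; rewrite (ger0_norm z0).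
have : z ^+ 2 = A3form a b ^+ 2 by case: E0 => ->; rewrite ?sqrrN.
move/eqP; rewrite zE2 -subr_eq0 addrC addrA addNr add0r; apply/negP; apply: mulf_neq0 nz.
by rewrite !mulf_neq0 ?expf_neq0.
Qed.

(* Were both squares, [z3 z4] would be congruent to [Bform] modulo [512 a ^ 10], hence equal to it. *)
Lemma M3form_M4form_not_sqr (z3 z4 : int) : 100 * `|a| <= b -> 0 <= z3 -> 0 <= z4 ->
  z3 ^+ 2 = M3form a b -> z4 ^+ 2 = M4form a b -> False.
Proof.
move=> ab z30 z40 zE3 zE4.
have bX n : 0 < b ^+ n by rewrite exprn_gt0.
have A3ge := A3form_ge ab; have A4ge := A4form_ge ab; have Bge := Bform_ge ab.
have b100 : 100 <= b.
  by apply: le_trans ab; rewrite -[X in X <= _]mulr1 ler_pM2l // -gtz0_ge1 normr_gt0.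
have bS n : 100 * b ^+ n <= b ^+ n.+1 by rewrite exprS ler_pM2r.
have A30 : 0 < A3form a b by have := bX 3; lra.
have A40 : 0 < A4form a b by have := bX 6; lra.
have B0 : 0 < Bform a b by have := bX 9; lra.
have na n : 0 < `|a| ^+ n by rewrite exprn_gt0 ?normr_gt0.
have pX k n : two_power (2 ^+ k * a ^+ n) by apply: two_powerM (two_powerX _ pa); apply: two_powerX two_power2.
have [p3 p4 p10] : [/\ two_power (8 * a ^+ 4), two_power (64 * a ^+ 7) & two_power (512 * a ^+ 10)].
  by split; [apply: (pX 3) | apply: (pX 6) | apply: (pX 9)].
have ba4 : b * (b - 4 * a) != 0.
  rewrite mulf_neq0 ?oddz_neq0 //; have -> : b - 4 * a = b + 2 * (- 2 * a) by ring.
  exact: oddzD.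
have [T3 T3E] : exists T, z3 = - A3form a b + 8 * T.
  have zE : z3 ^+ 2 = A3form a b ^+ 2 + 2 * (8 * a ^+ 4) * (b * (b - 4 * a)).
    by rewrite zE3 /M3form; ring.
  have [dv|/dvdzP[y yE]] := sqr_congr oddz_A3form p3 zE; last first.
    by exists (y * a ^+ 4); rewrite mulrCA -yE; ring.
  (* The class of [A3form] itself is excluded, as size would force equality; likewise for z4 and
     [A4form]. *)
  exfalso; move/eqP: ba4; apply; apply: (sqr_eq_of_close z30 A30 zE _ dv).
    by rewrite mulf_neq0 ?expf_neq0.
  have := @monomial_le _ _ _ ab 1 1 2 isT erefl; rewrite /= !expr1 => /andP[h1 h2].
  have : `|b * (b - 4 * a)| <= 2 * b ^+ 2.
    have -> : b * (b - 4 * a) = b ^+ 2 - 4 * (a * b) by ring.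
    by rewrite ler_norml; apply/andP; have := bX 2; split; lra.
  by have := bS 2; have := bX 2; lra.
have [T4 T4E] : exists T, z4 = - A4form a b + 8 * T.
  have zE : z4 ^+ 2 = A4form a b ^+ 2 + 2 * (64 * a ^+ 7) * G4form a b.
    by rewrite zE4 /M4form; ring.
  have [dv|/dvdzP[y yE]] := sqr_congr oddz_A4form p4 zE; last first.
    by exists (y * (8 * a ^+ 7)); rewrite mulrCA (_ : 8 * (8 * a ^+ 7) = 64 * a ^+ 7); [rewrite -yE|]; ring.
  exfalso; move/eqP: G4form_neq0; apply; apply: (sqr_eq_of_close z40 A40 zE _ dv).
    by rewrite mulf_neq0 ?expf_neq0.
  by have := G4form_le ab; have := bS 5; have := bX 5; lra.
have z0 : 0 <= z3 * z4 by rewrite mulr_ge0.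
have zE : (z3 * z4) ^+ 2 = Bform a b ^+ 2 + 2 * (512 * a ^+ 10) * Gform a b.
  by rewrite exprMn zE3 zE4 M3M4form; ring.
(* The two minus signs cancel modulo 8. *)
have [U UE] : exists U, z3 * z4 = Bform a b + 8 * U.
  rewrite Bform_congr T3E T4E; move: (A3form a b) (A4form a b) (_ + 304 * _) => A3 A4 C.
  by exists (8 * T3 * T4 - T3 * A4 - A3 * T4 - C); ring.
have [dv|/dvdzP[y yE]] := sqr_congr oddz_Bform p10 zE.
  move/eqP: Gform_neq0; apply; apply: (sqr_eq_of_close z0 B0 zE _ dv).
    by rewrite mulf_neq0 ?expf_neq0.
  by have := Gform_le ab; have := bS 8; have := bX 8; lra.
(* In the class of - [Bform] the number 2 [Bform] would be divisible by 8, although [Bform] is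
   odd. *)
have /eqP := oddz_not2 (y * (128 * a ^+ 10) - 2 * U) oddz_Bform; apply.
move: yE; rewrite UE; move: (Bform a b) (a ^+ 10) => B a10 yE; apply: (@mulfI _ 2) => //.
have -> : 2 * (2 * (y * (128 * a10) - 2 * U)) = y * (512 * a10) - 8 * U by ring.
by rewrite -yE; ring.
Qed.

End TwoPowerNumerator.

Lemma nonsquarezP (n : int) : nonsquarez n \/ exists2 m, 0 <= m & m ^+ 2 = n.
Proof.
have [n0|n0] := ltP n 0.
  by left=> m; apply/eqP=> E; move: n0; rewrite E ltNge sqr_ge0.
have [/existsP[m /eqP E]|/existsPn H] := boolP [exists m : 'I_(`|n|).+1, m%:Z ^+ 2 == n].
  by right; exists m%:Z.
left=> m; apply/eqP=> E; have lt : (`|m| < (`|n|).+1)%N.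
  by rewrite ltnS E abszX; case: (`|m|)%N => // k; rewrite leq_pmulr.
have /eqP := H (Ordinal lt); apply; rewrite /= E.
by rewrite abszE real_normK ?num_real.
Qed.

Lemma nonsquarez_mul_sqr (n w : int) : w != 0 -> nonsquarez n -> nonsquarez (n * w ^+ 2).
Proof.
move=> w0 ns m; apply/eqP=> E; have wq : (w%:~R : rat) != 0 by rewrite intr_eq0.
have [k kE] : exists k : int, n = k ^+ 2.
  apply: (@rat_sqr_int n (m%:~R / w%:~R)).
  by rewrite expr_div_n -[m%:~R ^+ 2]rmorphXn -E rmorphM rmorphXn mulfK // expf_neq0.
by move/eqP: (ns k); apply.
Qed.

Lemma sqr_coprime_factor (x y m : int) : x != 0 -> coprimez x y -> x * y = m ^+ 2 ->
  exists2 u, 0 <= u & `|x| = u ^+ 2.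
Proof.
move=> x0 cop E; have [y0|y0] := eqVneq y 0.
  exists 1 => //; move: cop; rewrite y0 /coprimez gcdz0 => /eqP /= h.
  by rewrite expr1n -abszE; case: h => ->.
have x0' : (0 < `|x|)%N by rewrite absz_gt0.
have y0' : (0 < `|y|)%N by rewrite absz_gt0.
have En : (`|x| * `|y| = `|m| ^ 2)%N by rewrite -abszM E abszX.
have [u uE] : exists u, `|x|%N = (u ^ 2)%N.
  apply: even_logn_sqr => // q qp; have [qx|qx] := boolP (q %| `|x|)%N; last first.
    by rewrite lognE qp x0' (negPf qx).
  have qy : logn q `|y| = 0%N.
    rewrite lognE qp y0' /=; case: ifP => // qy.
    have : (q %| gcdn `|x| `|y|)%N by rewrite dvdn_gcd qx qy.
    move: cop; rewrite coprimezE /coprime => /eqP ->; rewrite dvdn1 => /eqP q1.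
    by rewrite q1 in qp.
  have := congr1 (logn q) En; rewrite lognM // qy addn0 lognX => ->.
  by rewrite oddM.
by exists u%:Z => //; rewrite -abszE uE PoszM.
Qed.

Lemma oddz_sqr4 x : oddz x -> exists y, x ^+ 2 = 4 * y + 1.
Proof. by move=> [m ->]; exists (m ^+ 2 + m); ring. Qed.

Lemma evenzP x : (exists y, x = 2 * y) \/ oddz x.
Proof.
have [m E] : exists m, x = 2 * m \/ x = 2 * m + 1; last by case: E => E; [left|right]; exists m.
exists (x %/ 2)%Z; have := divz_eq x 2; have := modz_ge0 x (isT : 2 != 0 :> int).
by have := ltz_pmod x (isT : 0 < 2 :> int); clear; lia.
Qed.

Lemma two_power_dvd r u : two_power r -> oddz u -> (u %| r ^+ 2)%Z -> `|u| = 1.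
Proof.
move=> pr ou; have : coprimez (r ^+ 2) u by rewrite (two_powerX 2 pr).
rewrite coprimezE => cop; rewrite dvdzE => dv; rewrite -abszE; congr (Posz _).
by apply/eqP; rewrite -dvdn1 -(eqP cop) dvdn_gcd dv dvdnn.
Qed.

(** Half the sum and half the difference of y and x have opposite parity and product r^2, so the odd
    one is 1; this must be the difference, whence y = x + 2. *)
Lemma two_power_triple (r x y : int) : two_power r -> r != 0 -> 0 <= x -> 0 <= y ->
  oddz x -> oddz y -> y ^+ 2 = x ^+ 2 + (2 * r) ^+ 2 -> x = r ^+ 2 - 1 /\ y = r ^+ 2 + 1.
Proof.
move=> pr r0 x0 y0 [i xE] [j yE] E.
have E' : (j - i) * (i + j + 1) = r ^+ 2.
  have : 4 * ((j - i) * (i + j + 1)) = 4 * r ^+ 2.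
    have -> : 4 * ((j - i) * (i + j + 1)) = (2 * j + 1) ^+ 2 - (2 * i + 1) ^+ 2 by ring.
    by rewrite -xE -yE E; ring.
  exact: mulfI.
have r20 : 0 < r ^+ 2 by rewrite exprn_even_gt0.
have s0 : 0 < i + j + 1 by lia.
have d0 : 0 < j - i by rewrite -(pmulr_lgt0 _ s0) E'.
have [[y' jiE]|oji] := evenzP (j - i).
  have os : oddz (i + j + 1) by exists (i + y'); lia.
  have dv : (i + j + 1 %| r ^+ 2)%Z by rewrite -E' dvdz_mull.
  have := two_power_dvd pr os dv; rewrite ger0_norm ?(ltW s0) //; lia.
have dv : (j - i %| r ^+ 2)%Z by rewrite -E' dvdz_mulr.
have := two_power_dvd pr oji dv; rewrite (ger0_norm (ltW d0)) => d1.
by rewrite -E' d1; lia.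
Qed.

Lemma two_powerN a : two_power a -> two_power (- a).
Proof. by move=> pa w /pa; rewrite !coprimezE abszN. Qed.

Lemma coprimez_two_power w q t : oddz w -> two_power t -> coprimez w (q * w + t).
Proof. by move=> ow pt; rewrite /coprimez gcdzMDl; move: (pt w ow); rewrite coprimez_sym. Qed.

Section Coprimality.
Variables (a b : int).
Hypotheses (pa : two_power a) (aev : exists al, a = 2 * al) (ob : oddz b).

Lemma oddz_sub : oddz (b - a).
Proof. by have [al ->] := aev; rewrite -mulrN; apply: oddzD. Qed.

Let oba := oddz_sub.
Let pX k n : two_power (2 ^+ k * a ^+ n).
Proof. by apply: two_powerM (two_powerX _ pa); apply: two_powerX two_power2. Qed.

(** Modulo b each form reduces to a power of a times a power of 2, up to sign, and modulo b - a to a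
    power of a; both are prime to the odd moduli. *)
Lemma coprimez_Kform : coprimez b (Kform a b) /\ coprimez (b - a) (Kform a b).
Proof.
split.
- have -> : Kform a b = (b ^+ 2 - 4 * a * b + 12 * a ^+ 2) * b + (- (2 ^+ 3 * a ^+ 3)).
    by rewrite /Kform; ring.
  by apply: coprimez_two_power ob _; apply: two_powerN; apply: pX.
- have -> : Kform a b = (b ^+ 2 - 3 * a * b + 9 * a ^+ 2) * (b - a) + a ^+ 3.
    by rewrite /Kform; ring.
  exact: coprimez_two_power oba (two_powerX _ pa).
Qed.

Lemma coprimez_Hform : coprimez b (Hform a b) /\ coprimez (b - a) (Hform a b).
Proof.
split.
- have -> : Hform a b = (b ^+ 5 - 4 * a * b ^+ 4 + 12 * a ^+ 2 * b ^+ 3 + 8 * a ^+ 3 * b ^+ 2 - 48 * a ^+ 4 * b +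
    48 * a ^+ 5) * b + (- (2 ^+ 4 * a ^+ 6)).
    by rewrite /Hform; ring.
  by apply: coprimez_two_power ob _; apply: two_powerN; apply: pX.
- have -> : Hform a b = (b ^+ 5 - 3 * a * b ^+ 4 + 9 * a ^+ 2 * b ^+ 3 + 17 * a ^+ 3 * b ^+ 2 - 31 * a ^+ 4 * b +
    17 * a ^+ 5) * (b - a) + a ^+ 6.
    by rewrite /Hform; ring.
  exact: coprimez_two_power oba (two_powerX _ pa).
Qed.

Lemma coprimez_M3form : coprimez b (M3form a b) /\ coprimez (b - a) (M3form a b).
Proof.
split.
- have -> : M3form a b = (b ^+ 5 - 4 * a * b ^+ 4 + 12 * a ^+ 2 * b ^+ 3 - 8 * a ^+ 3 * b ^+ 2 + 16 * a ^+ 4 * b -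
    32 * a ^+ 5) * b + 2 ^+ 4 * a ^+ 6.
    by rewrite /M3form /A3form; ring.
  by apply: coprimez_two_power ob _; apply: pX.
- have -> : M3form a b = (b ^+ 5 - 3 * a * b ^+ 4 + 9 * a ^+ 2 * b ^+ 3 + a ^+ 3 * b ^+ 2 + 17 * a ^+ 4 * b - 15 *
    a ^+ 5) * (b - a) + a ^+ 6.
    by rewrite /M3form /A3form; ring.
  exact: coprimez_two_power oba (two_powerX _ pa).
Qed.

Lemma coprimez_M4form : coprimez b (M4form a b) /\ coprimez (b - a) (M4form a b).
Proof.
split.
- have -> : M4form a b = (b ^+ 11 - 12 * a * b ^+ 10 + 84 * a ^+ 2 * b ^+ 9 - 344 * a ^+ 3 * b ^+ 8 + 928 * a ^+ 4
    * b ^+ 7 - 1344 * a ^+ 5 * b ^+ 6 + 368 * a ^+ 6 * b ^+ 5 + 2816 * a ^+ 7 * b ^+ 4 -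
    5952 * a ^+ 8 * b ^+ 3 + 4992 * a ^+ 9 * b ^+ 2 - 1280 * a ^+ 10 * b - 512 * a ^+ 11) * b + 2 ^+ 8 * a ^+ 12.
    by rewrite /M4form /A4form /G4form; ring.
  by apply: coprimez_two_power ob _; apply: pX.
- have -> : M4form a b = (b ^+ 11 - 11 * a * b ^+ 10 + 73 * a ^+ 2 * b ^+ 9 - 271 * a ^+ 3 * b ^+ 8 + 657 * a ^+ 4
    * b ^+ 7 - 687 * a ^+ 5 * b ^+ 6 - 319 * a ^+ 6 * b ^+ 5 + 2497 * a ^+ 7 * b ^+ 4 - 3455
    * a ^+ 8 * b ^+ 3 + 1537 * a ^+ 9 * b ^+ 2 + 257 * a ^+ 10 * b - 255 * a ^+ 11) * (b - a) + a ^+ 12.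
    by rewrite /M4form /A4form /G4form; ring.
  exact: coprimez_two_power oba (two_powerX _ pa).
Qed.

End Coprimality.

(** The factors a, b, b - a and X are pairwise coprime, so the first three are squares up to sign.
    As |a| = (2 r)^2, the roots of b and b - a form a Pythagorean triple with 2 r, whose legs are
    known because r is a power of 2 up to sign. *)
Lemma square_forces (a b X m : int) : a != 0 -> two_power a -> (exists al, a = 2 * al) ->
  0 < b -> oddz b -> oddz X -> coprimez b X -> coprimez (b - a) X ->
  a * b * (b - a) * X = m ^+ 2 ->
  exists2 r, two_power r & exists2 q, q = r ^+ 2 \/ q = - r ^+ 2 & a = 4 * q /\ b = (q + 1) ^+ 2.
Proof.
move=> a0 pa aev b0 ob oX cbX cbaX E; have oba := oddz_sub aev ob.
have cb : coprimez b (b - a).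
  have -> : b - a = 1 * b + - a by ring.
  by apply: coprimez_two_power ob _; apply: two_powerN.
have cab : coprimez b a by rewrite coprimez_sym pa.
have caba : coprimez (b - a) a by rewrite coprimez_sym pa.
have [al al0 alE] : exists2 u, 0 <= u & `|a| = u ^+ 2.
  apply: (@sqr_coprime_factor a (b * (b - a) * X) m) => //; last by rewrite -E; ring.
  by apply: pa; apply: oddzM oX; apply: oddzM.
have [be be0 beE] : exists2 u, 0 <= u & `|b| = u ^+ 2.
  apply: (@sqr_coprime_factor b (a * (b - a) * X) m); first by rewrite gt_eqF.
    by rewrite !coprimezMr cab cb cbX.
  by rewrite -E; ring.
have [de de0 deE] : exists2 u, 0 <= u & `|b - a| = u ^+ 2.
  apply: (@sqr_coprime_factor (b - a) (b * a * X) m); first exact: oddz_neq0.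
    by rewrite !coprimezMr caba cbaX coprimez_sym cb.
  by rewrite -E; ring.
rewrite (gtr0_norm b0) in beE.
have odd_root x y : oddz x -> `|x| = y ^+ 2 -> oddz y.
  move=> [k kE] xE; have [[z zE]|//] := evenzP y; exfalso; move: xE.
  by rewrite zE (_ : (2 * z) ^+ 2 = 4 * z ^+ 2); [rewrite kE; move: (z ^+ 2); clear; lia | ring].
have obe : oddz be by apply: (odd_root b) => //; rewrite gtr0_norm.
have ode : oddz de by apply: (odd_root (b - a)).
have [r rE] : exists r, al = 2 * r.
  have [//|oal] := evenzP al; exfalso; have [al' aE] := aev; have [y yE] := oddz_sqr4 oal.
  by move: alE; rewrite yE aE; clear; lia.
have a4 : `|a| = 4 * r ^+ 2 by rewrite alE rE; ring.
have r0 : r != 0 by apply: contraNneq a0 => r0; rewrite -normr_eq0 a4 r0.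
have r20 : 0 < r ^+ 2 by rewrite exprn_even_gt0.
have pr : two_power r.
  move=> w /pa caw; have : coprimez `|a| w by rewrite -abszE.
  by rewrite a4 expr2 !coprimezMl => /and3P[].
have r4 : (2 * r) ^+ 2 = 4 * r ^+ 2 by ring.
exists r => //; have [a_pos|a_neg] := ltP 0 a.
- exists (r ^+ 2); [by left|]; have aE : a = 4 * r ^+ 2 by rewrite -a4 gtr0_norm.
  split=> //; have [le|lt] := leP 0 (b - a).
    rewrite (ger0_norm le) in deE.
    have E4 : be ^+ 2 = de ^+ 2 + (2 * r) ^+ 2 by rewrite -beE -deE r4 -aE; ring.
    by have [_ bE] := two_power_triple pr r0 de0 be0 ode obe E4; rewrite beE bE.
  (* If b < a, the odd squares b and a - b are both 1 modulo 4, but their sum is a = 4 r^2. *)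
  exfalso; rewrite (ltr0_norm lt) in deE; have [y yE] := oddz_sqr4 obe; have [z zE] := oddz_sqr4 ode.
  by move: beE deE; rewrite yE zE aE; move: (r ^+ 2); clear; lia.
- exists (- r ^+ 2); [by right|]; have aE : a = 4 * - r ^+ 2.
    by move: a4; rewrite ler0_norm // mulrN => <-; rewrite opprK.
  split=> //; have ge : 0 <= b - a by move: b0 a_neg; clear; lia.
  rewrite (ger0_norm ge) in deE.
  have E4 : de ^+ 2 = be ^+ 2 + (2 * r) ^+ 2 by rewrite -beE -deE r4 aE; ring.
  by have [bE _] := two_power_triple pr r0 be0 de0 obe ode E4; rewrite beE bE; ring.
Qed.

Lemma nonsquarez_near (A E : int) : 0 < A -> `|E| < A -> E != 0 -> nonsquarez (A ^+ 2 + E).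
Proof.
move=> A0 lt E0 m; apply/eqP=> mE.
have zE : `|m| ^+ 2 = A ^+ 2 + E by rewrite real_normK ?num_real.
have : `| `|m| - A| < 1 by apply: (sqr_close _ A0 zE); rewrite ?normr_ge0 // mul1r.
move=> lt1; have mA : `|m| = A by move: lt1; clear; lia.
by move/eqP: E0; apply; move: zE; rewrite mA; move: (A ^+ 2); clear; lia.
Qed.

Lemma near_sqr_gt0 (A E : int) : 0 < A -> `|E| < A -> 0 < A ^+ 2 + E.
Proof.
move=> A0 lt; have : A <= A ^+ 2 by rewrite expr2 ler_peMl ?(ltW A0) // -gtz0_ge1.
by move: lt; move: (A ^+ 2); clear; lia.
Qed.

(** * The exceptional family gamma = 4 q / (q + 1)^2 *)

Definition Sform (x : int) := x ^+ 6 - 2 * x ^+ 5 + 47 * x ^+ 4 + 356 * x ^+ 3 + 2095 * x ^+ 2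
  - (20 * 1000 + 482) * x - (190 * 1000 + 463).
Definition Rform (x : int) := - 84 * x ^+ 5 + 3 * 2287 * x ^+ 4 + (54 * 1001 + 6) * x ^+ 3
  + 98 * 943 * x ^+ 2 - 272 * 47 * 149 * x - 93 * (95 * 1000 + 231).

(** [Sform] is the truncated square root in the single variable x. The remainder has degree 5
    against 6, so for large |x| it is smaller than [Sform] and the value lies strictly between
    neighbouring squares. *)
Lemma M3form_special x : M3form (4 * x) ((x + 1) ^+ 2) = Sform x ^+ 2 + 4096 * Rform x.
Proof. by rewrite /M3form /A3form /Sform /Rform; ring. Qed.

Section SpecialBounds.
Variables x1 x2 x3 x4 x5 c1 c2 c3 c4 c5 c6 : int.
Local Notation T := (100 * (100 * 100)).
Hypotheses (h1 : - c1 <= x1 <= c1) (h2 : - c2 <= x2 <= c2) (h3 : - c3 <= x3 <= c3)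
  (h4 : - c4 <= x4 <= c4) (h5 : - c5 <= x5 <= c5).
Hypotheses (T0 : T <= c1) (T1 : T * c1 <= c2) (T2 : T * c2 <= c3) (T3 : T * c3 <= c4)
  (T4 : T * c4 <= c5) (T5 : T * c5 <= c6).
Let S := c6 - 2 * x5 + 47 * x4 + 356 * x3 + 2095 * x2
  - (20 * 1000 + 482) * x1 - (190 * 1000 + 463).
Let Rr := - 84 * x5 + 3 * 2287 * x4 + (54 * 1001 + 6) * x3
  + 98 * 943 * x2 - 272 * 47 * 149 * x1 - 93 * (95 * 1000 + 231).

(** The x_i and c_i stand for q^i and |q|^i; as independent variables they make the estimates
    linear. *)
Lemma special_bound_S : 9 * c6 <= 10 * S.
Proof. by rewrite /S; lia. Qed.

Lemma special_bound_R : - S < 4096 * Rr < S.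
Proof. by rewrite /S /Rr; apply/andP; split; lia. Qed.

Lemma special_sign_R : x5 = c5 \/ x5 = - c5 -> Rr != 0.
Proof. by rewrite /Rr; lia. Qed.

End SpecialBounds.

Section SpecialFamily.
Variable q : int.
Hypothesis big : 100 * (100 * 100) <= `|q|.
Local Notation a := (4 * q).
Local Notation b := ((q + 1) ^+ 2).

Let qpow i : - `|q| ^+ i <= q ^+ i <= `|q| ^+ i.
Proof. by rewrite -ler_norml normrX. Qed.

Let tpow i : 100 * (100 * 100) * `|q| ^+ i <= `|q| ^+ i.+1.
Proof. by rewrite exprS ler_wpM2r ?exprn_ge0. Qed.

Let q6 : q ^+ 6 = `|q| ^+ 6.
Proof. by rewrite -normrX ger0_norm ?exprn_even_ge0. Qed.

Lemma special_bounds : [/\ `|4096 * Rform q| < Sform q, 0 < Sform q & 4096 * Rform q != 0].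
Proof.
have T0 := tpow 0; rewrite expr0 mulr1 in T0.
have H1 := special_bound_R (qpow 1) (qpow 2) (qpow 3) (qpow 4) (qpow 5) T0 (tpow 1) (tpow 2)
  (tpow 3) (tpow 4) (tpow 5).
have H2 := special_bound_S (qpow 1) (qpow 2) (qpow 3) (qpow 4) (qpow 5) T0 (tpow 1) (tpow 2)
  (tpow 3) (tpow 4) (tpow 5).
have H3 := special_sign_R (qpow 1) (qpow 2) (qpow 3) (qpow 4) (qpow 5) T0 (tpow 1) (tpow 2)
  (tpow 3) (tpow 4) (tpow 5).
rewrite -q6 !expr1 in H1 H2 H3; split.
- by rewrite ltr_norml; exact: H1.
- have : 0 < q ^+ 6 by rewrite q6 exprn_gt0 // (lt_le_trans _ big).
  by move: H2; rewrite -/(Sform q); clear; lia.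
rewrite mulf_neq0 //.
apply: H3; have [q0|q0] := leP 0 q; [left; rewrite ger0_norm // | right; rewrite ler0_norm ?ltW //].
by rewrite exprNn -signr_odd mulN1r opprK.
Qed.

Lemma special_M3form_not_sqr : nonsquarez (M3form a b).
Proof. by have [R1 S1 R0] := special_bounds; rewrite M3form_special; apply: nonsquarez_near. Qed.

Lemma special_Kform_gt0 : 0 < q -> 0 < Kform a b.
Proof.
move=> q0; have := big; rewrite (gtr0_norm q0) => big'.
have -> : Kform a b = q ^+ 5 * (q - 10) + q ^+ 3 * (143 * q - 204) + q * (143 * q - 10) + 1.
  by rewrite /Kform; ring.
by rewrite ltr_wpDl // !addr_ge0 // mulr_ge0 ?exprn_ge0 ?(ltW q0) //; lia.
Qed.

Lemma special_M3form_gt0 : 0 < M3form a b.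
Proof. by have [R1 S1 _] := special_bounds; rewrite M3form_special; apply: near_sqr_gt0. Qed.

End SpecialFamily.

Lemma sqr_F3 (m : 'F_3) : m ^+ 2 != -1.
Proof. by case: m => [[|[|[|m]]]]. Qed.

Lemma sqr1_F3 (m : 'F_3) : m != 0 -> m ^+ 2 = 1.
Proof. by case: m => [[|[|[|m]]]] // i _; apply: val_inj. Qed.

(* Modulo 3 the parameter is -1, so [Kform] is 2 and [M3form] is 1. *)
Lemma special_form_F3 (r q : int) : two_power r -> q = - r ^+ 2 ->
  (Kform (4 * q) ((q + 1) ^+ 2))%:~R = -1 :> 'F_3 /\
  (M3form (4 * q) ((q + 1) ^+ 2))%:~R = 1 :> 'F_3.
Proof.
move=> pr qE; have r3 : (r%:~R : 'F_3) ^+ 2 = 1.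
  apply: sqr1_F3; have /coprimezP[[u w] /= uw] := pr 3 (ex_intro _ 1 erefl).
  have := congr1 (fun x : int => x%:~R : 'F_3) uw; rewrite rmorphD !rmorphM /=.
  have -> : (3%:~R : 'F_3) = 0 by apply: val_inj.
  by rewrite mulr0 addr0; apply: contra_eq_neq => ->; rewrite mulr0 eq_sym oner_eq0.
have q3 : (q%:~R : 'F_3) = -1 by rewrite qE rmorphN rmorphXn /= r3.
have aE : ((4 * q)%:~R : 'F_3) = -1 by rewrite rmorphM /= q3; apply: val_inj.
have bE : (((q + 1) ^+ 2)%:~R : 'F_3) = 0.
  by rewrite rmorphXn (rmorphD _ q 1) /= q3 addNr expr0n.
rewrite rmorph_Kform rmorph_M3form.
rewrite [X in Kform X]aE [X in Kform _ X]bE [X in M3form X]aE [X in M3form _ X]bE.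
by split; apply: val_inj.
Qed.

(** For q > 0 the numbers representing -c_3 and -c_3 phi_3 are negative. For q = - r^2 they are K
    and K M3 up to squares, with K and M3 the values of [Kform] and [M3form], and both are -1 modulo
    3. *)
Lemma special_infinite (gamma : rat) (q r : int) : two_power r -> q = r ^+ 2 \/ q = - r ^+ 2 ->
  100 * (100 * 100) <= `|q| -> gamma = (4 * q)%:~R / ((q + 1) ^+ 2)%:~R ->
  forall s : seq rat, exists c, c \notin s /\ inS3 gamma c.
Proof.
move=> pr qr big gE; have ns := special_M3form_not_sqr big; have M0 := special_M3form_gt0 big.
have r0 : r != 0.
  by apply: contraTneq big => r0; case: qr => ->; rewrite r0.
have r20 : 0 < r ^+ 2 by rewrite exprn_even_gt0.
have q0 : q != 0 by clear - big; lia.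
have q1 : q + 1 != 0 by clear - big; lia.
have q1' : q - 1 != 0 by clear - big; lia.
have P0 : 0 < q -> 0 < 4 * q * (q + 1) ^+ 2 * (q - 1) ^+ 2.
  move=> pos; apply: mulr_gt0; last by rewrite exprn_even_gt0.
  by apply: mulr_gt0; [rewrite mulr_gt0 | rewrite exprn_even_gt0].
have ba : (q + 1) ^+ 2 - 4 * q = (q - 1) ^+ 2 by ring.
apply: (infinite_of_nonsquarez3 gE) ns _; rewrite ?ba ?mulf_neq0 ?expf_neq0 //.
  case: qr => qE; first have pos : 0 < q by rewrite qE.
    have K0 := special_Kform_gt0 big pos.
    move=> m; apply/eqP=> E; have := sqr_ge0 m; rewrite -E oppr_ge0 leNgt => /negP; apply.
    by apply: mulr_gt0 K0; apply: P0.
  rewrite (_ : - _ = Kform (4 * q) ((q + 1) ^+ 2) * (2 * r * (q + 1) * (q - 1)) ^+ 2); last first.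
    rewrite [X in - (4 * X * _ * _ * _)]qE; ring.
  apply: nonsquarez_mul_sqr; first by rewrite !mulf_neq0.
  move=> m; apply/eqP=> E; have [K3 _] := special_form_F3 pr qE.
  have E3 : (m%:~R : 'F_3) ^+ 2 = -1 by rewrite -K3 E rmorphXn.
  by have := sqr_F3 m%:~R; rewrite E3 eqxx.
case: qr => qE; first have pos : 0 < q by rewrite qE.
  have K0 := special_Kform_gt0 big pos.
  move=> m; apply/eqP=> E; have := sqr_ge0 m; rewrite -E mulNr oppr_ge0 leNgt => /negP; apply.
  by apply: mulr_gt0 M0; apply: mulr_gt0 K0; apply: P0.
rewrite (_ : - _ * _ = Kform (4 * q) ((q + 1) ^+ 2) * M3form (4 * q) ((q + 1) ^+ 2) *
    (2 * r * (q + 1) * (q - 1)) ^+ 2); last first.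
  rewrite [X in - (4 * X * _ * _ * _)]qE; ring.
apply: nonsquarez_mul_sqr; first by rewrite !mulf_neq0.
move=> m; apply/eqP=> E; have [K3 M3] := special_form_F3 pr qE.
have E3 : (m%:~R : 'F_3) ^+ 2 = -1.
  transitivity ((m ^+ 2)%:~R : 'F_3); first by rewrite rmorphXn.
  by rewrite -E intrM K3 M3 mulr1.
by have := sqr_F3 m%:~R; rewrite E3 eqxx.
Qed.

(** * Numerators 1 and -1 *)

Section UnitNumerator.
Variables (gamma : rat) (b : int).

Let bS n : 100 * 100 <= b -> 100 * 100 * b ^+ n <= b ^+ n.+1.
Proof. by move=> big; rewrite exprS ler_wpM2r // exprn_ge0 // (le_trans _ big). Qed.

(** The remainder 16 b^2 - 64 b is below the truncated root, of order b^3, so phi_3 is not a square;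
    -c_3 and -c_3 phi_3 are negative. *)
Lemma unit_infinite : 100 * 100 <= b -> gamma = 1%:~R / b%:~R ->
  forall s : seq rat, exists c, c \notin s /\ inS3 gamma c.
Proof.
move=> big gE; have b0 : 0 < b by apply: lt_le_trans big.
have [B1 B2 B3] : [/\ 100 * 100 * b ^+ 1 <= b ^+ 2, 100 * 100 * b ^+ 2 <= b ^+ 3 & 0 < b ^+ 2].
  by rewrite !bS // exprn_gt0.
have Age : 9 * b ^+ 3 <= 10 * A3form 1 b by apply: A3form_ge; rewrite normr1 mulr1; lia.
have EE : 16 * 1 ^+ 4 * (b * (b - 4 * 1)) = 16 * b ^+ 2 - 64 * b by ring.
rewrite expr1 in B1.
have [A0 lt E0] : [/\ 0 < A3form 1 b, `|16 * 1 ^+ 4 * (b * (b - 4 * 1))| < A3form 1 b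
    & 16 * 1 ^+ 4 * (b * (b - 4 * 1)) != 0].
  rewrite EE; move: Age B1 B2 B3 b0; move: (A3form 1 b) (b ^+ 3) (b ^+ 2); clear => *.
  by split; lia.
have ns : nonsquarez (M3form 1 b) by apply: nonsquarez_near.
have M0 : 0 < M3form 1 b by apply: near_sqr_gt0.
have K0 : 0 < Kform 1 b.
  have -> : Kform 1 b = b ^+ 3 - 4 * b ^+ 2 + 12 * b - 8 by rewrite /Kform; ring.
  by move: B1 B2 B3 b0 big; move: (b ^+ 3) (b ^+ 2); clear; lia.
have P0 : 0 < 1 * b * (b - 1) * Kform 1 b.
  by rewrite mul1r; apply: mulr_gt0 K0; apply: mulr_gt0 => //; lia.
apply: (infinite_of_nonsquarez3 gE) ns _ => //; try lia.
  move=> m; apply/eqP=> E; have := sqr_ge0 m; rewrite -E oppr_ge0 leNgt => /negP; exact.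
move=> m; apply/eqP=> E; have := sqr_ge0 m; rewrite -E mulNr oppr_ge0 leNgt => /negP; apply.
exact: mulr_gt0.
Qed.

(** The sign of a now makes -c_3 positive, but -c_4 negative, so k = 4 takes over: the remainder is
    of order b^5 against a truncated root of order b^6. *)
Lemma neg_unit_infinite : 100 * 100 <= b -> gamma = (-1)%:~R / b%:~R ->
  forall s : seq rat, exists c, c \notin s /\ inS3 gamma c.
Proof.
move=> big gE; have b0 : 0 < b by apply: lt_le_trans big.
have [B1 B2 B3] : [/\ 100 * 100 * b ^+ 1 <= b ^+ 2, 100 * 100 * b ^+ 2 <= b ^+ 3 & 0 < b ^+ 2].
  by rewrite !bS // exprn_gt0.
have [B4 B5 B6] : [/\ 100 * 100 * b ^+ 3 <= b ^+ 4, 100 * 100 * b ^+ 4 <= b ^+ 5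
  & 100 * 100 * b ^+ 5 <= b ^+ 6] by rewrite !bS.
have small : 100 * `|-1| <= b by rewrite normrN1 mulr1; lia.
have Age := A4form_ge small; have Gle := G4form_le small; rewrite expr1 in B1.
have GE : G4form (-1) b = - 3 * b ^+ 5 - 16 * b ^+ 4 - 16 * b ^+ 3 + 14 * b ^+ 2 + 80 * b + 96.
  by rewrite /G4form; ring.
have EE : 128 * (-1) ^+ 7 * G4form (-1) b = - 128 * G4form (-1) b by ring.
have [A0 lt E0] : [/\ 0 < A4form (-1) b, `|128 * (-1) ^+ 7 * G4form (-1) b| < A4form (-1) b
    & 128 * (-1) ^+ 7 * G4form (-1) b != 0].
  rewrite EE; move: Age Gle GE B1 B2 B3 B4 B5 B6 b0 big.
  move: (A4form (-1) b) (G4form (-1) b) (b ^+ 6) (b ^+ 5) (b ^+ 4) (b ^+ 3) (b ^+ 2); clear => *.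
  by split; lia.
have ns : nonsquarez (M4form (-1) b) by apply: nonsquarez_near.
have M0 : 0 < M4form (-1) b by apply: near_sqr_gt0.
have K0 : 0 < Kform (-1) b.
  have -> : Kform (-1) b = b ^+ 3 + 4 * b ^+ 2 + 12 * b + 8 by rewrite /Kform; ring.
  by rewrite !addr_gt0 ?mulr_gt0 ?exprn_gt0.
have H0 : 0 < Hform (-1) b.
  have -> : Hform (-1) b = b ^+ 6 + 4 * b ^+ 5 + 12 * b ^+ 4 - 8 * b ^+ 3 - 48 * b ^+ 2
    - 48 * b - 16 by rewrite /Hform; ring.
  move: B1 B2 B3 B4 B5 B6 b0 big.
  by move: (b ^+ 6) (b ^+ 5) (b ^+ 4) (b ^+ 3) (b ^+ 2); clear; lia.
have P0 : 0 < - (-1 * b * (b - -1) * (Kform (-1) b * Hform (-1) b)).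
  rewrite !mulN1r !mulNr opprK; apply: mulr_gt0 (mulr_gt0 K0 H0); apply: mulr_gt0 => //; lia.
apply: (infinite_of_nonsquarez4 gE) ns _ => //; try lia.
- by rewrite gt_eqF.
- by move=> m; apply/eqP=> E; have := sqr_ge0 m; rewrite -E leNgt -oppr_gt0 P0.
- move=> m; apply/eqP=> E; have := sqr_ge0 m; rewrite -E leNgt -oppr_gt0 -mulNr.
  by rewrite mulr_gt0.
Qed.

End UnitNumerator.

(** * Even numerators without odd prime factor, and the height bound *)

Section EvenNumerator.
Variables (gamma : rat) (a b : int).
Local Notation T := (100 * (100 * 100)).
Hypotheses (gE : gamma = a%:~R / b%:~R) (a0 : a != 0) (pa : two_power a).
Hypotheses (aev : exists al, a = 2 * al) (b0 : 0 < b) (ob : oddz b).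
Hypothesis big : 4 * ((T + 1) * (T + 1)) < Num.max `|a| b.

Let bn0 : b != 0. Proof. by rewrite gt_eqF. Qed.
Let ban0 : b - a != 0. Proof. by apply: oddz_neq0; apply: oddz_sub. Qed.
Let oK : oddz (Kform a b). Proof. exact: oddz_Kform. Qed.

Lemma M3form_or_M4form : nonsquarez (M3form a b) \/ nonsquarez (M4form a b).
Proof.
have [le|gt] := leP b (100 * `|a|).
  left; apply: M3form_not_sqr => //; move: big; rewrite lt_max => /orP[].
    by move: (`|a|); clear; lia.
  by move: le; move: (`|a|); clear; lia.
have [|[z3 z30 z3E]] := nonsquarezP (M3form a b); first by left.
have [|[z4 z40 z4E]] := nonsquarezP (M4form a b); first by right.
by have := M3form_M4form_not_sqr a0 pa aev ob b0 (ltW gt) z30 z40 z3E z4E.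
Qed.

(** Applied whenever one of the numbers representing -c_k or -c_k phi_k is a square: gamma then
    belongs to the exceptional family, which is settled separately. *)
Lemma infinite_of_square X m : oddz X -> coprimez b X -> coprimez (b - a) X ->
  a * b * (b - a) * X = m ^+ 2 -> forall s : seq rat, exists c, c \notin s /\ inS3 gamma c.
Proof.
move=> oX cbX cbaX E; have [r pr [q qr [aE bE]]] := square_forces a0 pa aev b0 ob oX cbX cbaX E.
apply: (special_infinite pr qr); last by rewrite gE aE bE.
(* For smaller q both |a| = 4 |q| and b = (q + 1)^2 stay below the bound in [big]. *)
rewrite leNgt; apply/negP=> lt; move: big; rewrite aE bE lt_max => /orP[].
  by move: lt; rewrite normrM; move: (`|q|); clear; lia.
have le : `|q + 1| <= T by move: lt; clear; lia.
rewrite -real_normK ?num_real // expr2 ltNge => /negP; apply.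
apply: le_trans (_ : T * T <= _); first by rewrite ler_pM.
by clear; lia.
Qed.

Lemma even_infinite : forall s : seq rat, exists c, c \notin s /\ inS3 gamma c.
Proof.
have [cK cK'] := coprimez_Kform pa aev ob; have [cH cH'] := coprimez_Hform pa aev ob.
have [cM3 cM3'] := coprimez_M3form pa aev ob; have [cM4 cM4'] := coprimez_M4form pa aev ob.
have oH : oddz (Hform a b) by apply: oddz_Hform.
have oM3 : oddz (M3form a b) by apply: oddz_M3form.
have oM4 : oddz (M4form a b) by apply: oddz_M4form.
have [ns|ns] := M3form_or_M4form.
  have [n1|[m _ mE]] := nonsquarezP (- (a * b * (b - a) * Kform a b)); last first.
    by apply: (@infinite_of_square (- Kform a b) m); rewrite ?coprimezN ?mulrN //; apply: oddzN.
  have [n2|[m _ mE]] := nonsquarezP (- (a * b * (b - a) * Kform a b) * M3form a b); last first.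
    apply: (@infinite_of_square (- Kform a b * M3form a b) m); rewrite ?coprimezMr ?coprimezN ?cK ?cK' //.
      by apply: oddzM => //; apply: oddzN.
    by rewrite mE; ring.
  exact: infinite_of_nonsquarez3 gE a0 bn0 ban0 n1 ns n2.
have [n1|[m _ mE]] := nonsquarezP (a * b * (b - a) * (Kform a b * Hform a b)); last first.
  apply: (@infinite_of_square (Kform a b * Hform a b) m); rewrite ?coprimezMr ?cK ?cK' //.
  exact: oddzM.
have [n2|[m _ mE]] := nonsquarezP (a * b * (b - a) * (Kform a b * Hform a b) * M4form a b); last first.
  apply: (@infinite_of_square (Kform a b * Hform a b * M4form a b) m).
  - by apply: oddzM => //; apply: oddzM.
  - by rewrite coprimezMr cM4 coprimezMr cK cH.
  - by rewrite coprimezMr cM4' coprimezMr cK' cH'.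
  - by rewrite mE; ring.
exact: infinite_of_nonsquarez4 gE a0 bn0 ban0 (oddz_neq0 oK) n1 ns n2.
Qed.

End EvenNumerator.

Lemma two_powerP (a : int) : a != 0 ->
  two_power a \/ exists p, [/\ prime p, odd p & (p %| `|a|)%N].
Proof.
move=> a0; have [/hasP[p]|/hasPn H] := boolP (has odd (primes `|a|)).
  by rewrite mem_primes => /and3P[pp _ pa] op; right; exists p.
left=> w ow; rewrite coprimezE; apply/negPn/negP => ncop.
have w0 : (0 < `|w|)%N by rewrite absz_gt0 oddz_neq0.
have a0' : (0 < `|a|)%N by rewrite absz_gt0.
have g1 : (1 < gcdn `|a| `|w|)%N.
  by rewrite ltn_neqAle eq_sym ncop gcdn_gt0 a0'.
pose p := pdiv (gcdn `|a| `|w|); have pp : prime p := pdiv_prime g1.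
have := pdiv_dvd (gcdn `|a| `|w|); rewrite dvdn_gcd -/p => /andP[pa pw].
have := H p; rewrite mem_primes pp a0' pa => /(_ isT) /negP; apply.
move: pw => /dvdnP[k kE]; have : odd `|w| by move: ow => [y ->]; clear; lia.
by rewrite kE oddM => /andP[].
Qed.

Lemma infinite_of_large (gamma : rat) (a b : int) (Y : int) :
  Y = 4 * ((100 * (100 * 100) + 1) * (100 * (100 * 100) + 1)) -> gamma = a%:~R / b%:~R ->
  0 < b -> coprimez a b -> Y < Num.max `|a| b ->
  forall s : seq rat, exists c, c \notin s /\ inS3 gamma c.
Proof.
move=> YE gE b0 cab big; have bn0 : b != 0 by rewrite gt_eqF.
have bq : (b%:~R : rat) != 0 by rewrite intr_eq0.
have unit_big : `|a| <= 1 -> 100 * 100 <= b.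
  by move: big; rewrite lt_max => /orP[]; rewrite YE; move: (`|a|); clear; lia.
have a0 : a != 0.
  apply/eqP=> aE; have : `|b| = 1 by move: cab; rewrite aE /coprimez gcd0z => /eqP.
  by have := unit_big; rewrite aE normr0 (gtr0_norm b0) => /(_ isT) + bE; rewrite bE.
have gamma0 : gamma != 0 by rewrite gE mulf_neq0 ?invr_eq0 ?intr_eq0.
have gamma1 : gamma != 1.
  apply/eqP=> g1; have aE : a = b.
    by apply/eqP; rewrite -(eqr_int rat); apply/eqP; rewrite gE in g1; rewrite (canRL (divfK bq) g1) mul1r.
  have : `|b| = 1 by move: cab; rewrite aE /coprimez gcdzz => /eqP.
  by rewrite (gtr0_norm b0) => bE; have := unit_big; rewrite aE bE normr1 => /(_ isT).
have [pa|[p [pp op pa]]] := two_powerP a0; last first.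
  apply: (infinite_of_odd_prime gamma0 gamma1 pp op).
  have pb : padic p b%:~R = 1.
    apply: pabs_int_eq1 => //; apply/negP=> pb.
    have : (p %| gcdn `|a| `|b|)%N by rewrite dvdn_gcd pa.
    by move: cab; rewrite coprimezE => /eqP ->; rewrite dvdn1 => /eqP p1; rewrite p1 in pp.
  rewrite gE pabsM pabsV pb invr1 mulr1; apply: le_lt_trans (pabs_int_lt1 pp pa) _.
  by rewrite invf_lt1 ?ltr1n ?ltr0n ?prime_gt1 ?prime_gt0.
have [aev|oa] := evenzP a; last first.
  have a1 : `|a| = 1 by have := pa a oa; rewrite /coprimez gcdzz => /eqP.
  have bb : 100 * 100 <= b by apply: unit_big; rewrite a1.
  have [apos|aneg] := ltP 0 a.
    by apply: (unit_infinite bb); rewrite gE -a1 gtr0_norm.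
  by apply: (neg_unit_infinite bb); rewrite gE -a1 ler0_norm // opprK.
have [bev|ob] := evenzP b; last by apply: (even_infinite gE a0 pa aev b0 ob); rewrite -YE.
exfalso; have [x xE] := aev; have [y yE] := bev.
have : (2 %| gcdz a b)%Z by rewrite dvdz_gcd xE yE !dvdz_mulr.
by move: cab; rewrite /coprimez => /eqP ->.
Qed.

Theorem infinite_of_large_height : exists X : nat, forall gamma : rat,
  (X < `|numq gamma|)%N || (X < `|denq gamma|)%N ->
  forall s : seq rat, exists c, c \notin s /\ inS3 gamma c.
Proof.
pose Y : int := 4 * ((100 * (100 * 100) + 1) * (100 * (100 * 100) + 1)).
have : 0 <= Y by rewrite /Y; lia.
have : Y = 4 * ((100 * (100 * 100) + 1) * (100 * (100 * 100) + 1)) by [].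
move: Y => Y YE; case: Y YE => // X YE _; exists X => gamma gX.
apply: (infinite_of_large YE (esym (divq_num_den gamma)) (denq_gt0 gamma)).
  by rewrite coprimezE coprime_num_den.
rewrite lt_max -abszE ltz_nat; case/orP: gX => [->//|h].
by rewrite -(gtr0_norm (denq_gt0 gamma)) -abszE ltz_nat h orbT.
Qed.

Lemma rat_height_le (X : nat) : exists bad : seq rat, forall gamma,
  gamma \notin bad -> (X < `|numq gamma|)%N || (X < `|denq gamma|)%N.
Proof.
pose fr (i j : nat) : rat := i%:R / j%:R.
exists ([seq fr i j | i <- iota 0 X.+1, j <- iota 0 X.+1] ++
  [seq - fr i j | i <- iota 0 X.+1, j <- iota 0 X.+1]) => gamma.
apply: contraR; rewrite negb_or -!leqNgt => /andP[nX dX]; rewrite mem_cat.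
have mem k : (k <= X)%N -> k \in iota 0 X.+1 by rewrite mem_iota.
have dE : (`|denq gamma|%N%:R : rat) = (denq gamma)%:~R.
  by rewrite -[in RHS](gtz0_abs (denq_gt0 gamma)).
have [n0|n0] := leP 0 (numq gamma); apply/orP; [left|right]; apply/allpairsP;
  exists (`|numq gamma|, `|denq gamma|)%N; split; rewrite ?mem //=; rewrite /fr dE.
  rewrite -[LHS]divq_num_den; congr (_ / _).
  by rewrite -[in LHS](gez0_abs n0).
rewrite -[LHS]divq_num_den -mulNr; congr (_ / _).
by rewrite -[in LHS](opprK (numq gamma)) -(ltz0_abs n0) rmorphN.
Qed.

(* For all gamma outside a finite exceptional list, S_gamma^(3) is infinite
   (not contained in any finite list of rationals). *)
Theorem mainTheorem14 :
  exists bad : seq rat, forall gamma : rat, gamma \notin bad ->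
    forall s : seq rat, exists c : rat, c \notin s /\ inS3 gamma c.
Proof.
have [X largeX] := infinite_of_large_height; have [bad badX] := rat_height_le X.
by exists bad => gamma /badX; apply: largeX.
Qed.
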